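(* Let $n\ge2$. For any $\alpha\in(0,1)$ there exist a bounded smooth domain $\Omega\subset\mathbb{R}^n$ with connected boundary, a function $f\in C(\partial\Omega)$, and a function $a\in C^{1,\alpha}(\Omega)$ with $\inf_{x\in\Omega}a(x)>0$ such that the weighted least gradient problem $$\inf_{u\in BV_f(\Omega)}\int_\Omega a|Du|$$ has infinitely many minimizers in $BV_f(\Omega)$.
   Context: For $f\in C(\partial\Omega)$, $$BV_f(\Omega):=\Big\{v\in BV(\Omega):\ \forall x\in\partial\Omega,\ \lim_{r\to0}\ \operatorname*{ess\,sup}_{y\in\Omega,\,|x-y|<r}|f(x)-v(y)|=0\Big\}.$$ $|Du|$ is the total variation measure of the vector measure $Du$. Elements of $BV(\Omega)$ are identified up to a.e. equality. *)

(* Defs.v *)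
From HB Require Import structures.
From mathcomp Require Import all_boot all_order all_algebra.
From mathcomp Require Import all_classical all_reals all_analysis.
From mathcomp Require Import ring.

Set Implicit Arguments.
Unset Strict Implicit.
Unset Printing Implicit Defensive.

Import Order.TTheory GRing.Theory Num.Theory.
Import numFieldNormedType.Exports.

Local Open Scope classical_set_scope.
Local Open Scope ring_scope.

(* Points of R^n are row vectors 'rV[R]_n, with the library's topology. They
   carry the product sigma-algebra, i.e. the Borel sets of R^n. *)
Definition rV_display : measure_display.
Proof. by constructor. Qed.

Section rV_measurable.
Context {R : realType} {n : nat}.

Let coord (i : 'I_n) (x : 'rV[R]_n) : R := x ord0 i.

Let rV_set0 : g_sigma_preimage coord set0.
Proof. exact: sigma_algebra0. Qed.

Let rV_setC A : g_sigma_preimage coord A -> g_sigma_preimage coord (~` A).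
Proof. exact: sigma_algebraC. Qed.

Let rV_bigcup (F : (set 'rV[R]_n)^nat) :
  (forall i, g_sigma_preimage coord (F i)) ->
  g_sigma_preimage coord (\bigcup_i (F i)).
Proof. exact: sigma_algebra_bigcup. Qed.

HB.instance Definition _ := @isMeasurable.Build rV_display
  'rV[R]_n (g_sigma_preimage coord) rV_set0 rV_setC rV_bigcup.

Lemma measurable_rV_coord (i : 'I_n) :
  measurable_fun [set: 'rV[R]_n] (fun x : 'rV[R]_n => x ord0 i).
Proof.
move=> _ Y mY; rewrite setTI; apply: sub_sigma_algebra => /=.
rewrite -bigcup_seq/=; exists i => /=; first by rewrite mem_index_enum.
by exists Y => //; rewrite setTI.
Qed.

Lemma measurable_fun_rV d (T : measurableType d) (f : T -> 'rV[R]_n) :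
  (forall i, measurable_fun [set: T] (fun t => f t ord0 i)) ->
  measurable_fun [set: T] f.
Proof.
move=> mf _ A mA.
rewrite setTI; suff : [set f @^-1` A] `<=` measurable by apply.
have : preimage_set_system [set: T] f (g_sigma_preimage coord) `<=` measurable.
  rewrite -[X in X `<=` _]g_sigma_preimageE.
  apply: smallest_sub; first exact: sigma_algebra_measurable.
  move=> _ [B + <-].
  rewrite -bigcup_seq => -[i _] [C mC <-].
  by rewrite !setTI; have := mf i measurableT _ mC; rewrite setTI.
by move=> + _ ->; apply; exists A => //; rewrite setTI.
Qed.

End rV_measurable.

Lemma product_sigma_finite d1 d2 (T1 : measurableType d1)
    (T2 : measurableType d2) (R : realType)
    (m1 : {sigma_finite_measure set T1 -> \bar R})
    (m2 : {sigma_finite_measure set T2 -> \bar R}) :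
  sigma_finite setT (m1 \x m2)%E.
Proof.
have /sigma_finiteP[F [TF ndF Foo]] := sigma_finiteT m1.
have /sigma_finiteP[G [TG ndG Goo]] := sigma_finiteT m2.
exists (fun n => F n `*` G n).
  rewrite -setXTT TF TG predeqE => -[x y]; split.
    move=> [/= [n _ Fnx] [k _ Gky]]; exists (maxn n k) => //; split.
    - by move: x Fnx; exact/subsetPset/ndF/leq_maxl.
    - by move: y Gky; exact/subsetPset/ndG/leq_maxr.
  by move=> [n _ []/= ? ?]; split; exists n.
move=> k; have [? ?] := Foo k; have [? ?] := Goo k.
split; first exact: measurableX.
by rewrite product_measure1E// lte_mul_pinfty// ge0_fin_numE.
Qed.

Section lebesgue_rV.
Context {R : realType}.

Definition rV_cons n (p : R * 'rV[R]_n) : 'rV[R]_n.+1 :=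
  \row_i (if unlift ord0 i is Some j then p.2 ord0 j else p.1).

Definition rV_uncons n (x : 'rV[R]_n.+1) : R * 'rV[R]_n :=
  (x ord0 ord0, \row_j x ord0 (lift ord0 j)).

Lemma rV_consE0 n (p : R * 'rV[R]_n) : rV_cons p ord0 ord0 = p.1.
Proof. by rewrite mxE unlift_none. Qed.

Lemma rV_consES n (p : R * 'rV[R]_n) (j : 'I_n) :
  rV_cons p ord0 (lift ord0 j) = p.2 ord0 j.
Proof. by rewrite mxE liftK. Qed.

Lemma rV_consK n : cancel (@rV_cons n) (@rV_uncons n).
Proof.
move=> [a x]; rewrite /rV_uncons rV_consE0; congr pair.
by apply/rowP => j; rewrite mxE rV_consES.
Qed.

Lemma measurable_rV_cons n : measurable_fun [set: R * 'rV[R]_n] (@rV_cons n).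
Proof.
apply: measurable_fun_rV => i.
case: (unliftP ord0 i) => [j ->|->].
  rewrite (_ : (fun _ => _) = (fun x : 'rV[R]_n => x ord0 j) \o snd).
    by apply: measurableT_comp => //; exact: measurable_rV_coord.
  by apply/funext => p /=; rewrite rV_consES.
rewrite (_ : (fun _ => _) = fst)//.
by apply/funext => p /=; rewrite rV_consE0.
Qed.

Lemma measurable_rV_uncons n : measurable_fun [set: 'rV[R]_n.+1] (@rV_uncons n).
Proof.
apply/measurable_fun_pair; first exact: measurable_rV_coord.
apply: measurable_fun_rV => i.
rewrite (_ : (fun _ => _) = fun x : 'rV[R]_n.+1 => x ord0 (lift ord0 i)).
  exact: measurable_rV_coord.
by apply/funext => x; rewrite mxE.
Qed.

(* One-dimensional Lebesgue measure times m, transported by rV_cons. *)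
Section step.
Variables (n : nat) (m : {sigma_finite_measure set 'rV[R]_n -> \bar R}).

Definition lebesgue_rV_step : set 'rV[R]_n.+1 -> \bar R :=
  pushforward (@lebesgue_measure R \x m)%E (@rV_cons n).

Let step0 : lebesgue_rV_step set0 = 0%E.
Proof. by rewrite /lebesgue_rV_step /pushforward preimage_set0 measure0. Qed.

Let step_ge0 A : (0 <= lebesgue_rV_step A)%E.
Proof. by rewrite /lebesgue_rV_step /pushforward; exact: measure_ge0. Qed.

Let step_sigma_additive : semi_sigma_additive lebesgue_rV_step.
Proof.
move=> F mF tF mUF; rewrite /lebesgue_rV_step /pushforward preimage_bigcup.
have mc A : measurable A -> measurable (@rV_cons n @^-1` A).
  by move=> mA; rewrite -[X in measurable X]setTI; exact: measurable_rV_cons.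
apply: measure_semi_sigma_additive; first by move=> k; exact: mc.
- apply/trivIsetP => /= i j _ _ ij; rewrite -preimage_setI.
  by move/trivIsetP : tF => /(_ _ _ _ _ ij) ->//; rewrite preimage_set0.
- by rewrite -preimage_bigcup; exact: mc.
Qed.

HB.instance Definition _ := isMeasure.Build _ _ _
  lebesgue_rV_step step0 step_ge0 step_sigma_additive.

Let step_sigma_finite : sigma_finite setT lebesgue_rV_step.
Proof.
have [F FT Foo] := product_sigma_finite (@lebesgue_measure R) m.
exists (fun k => @rV_uncons n @^-1` F k).
  by rewrite -preimage_bigcup -FT preimage_setT.
move=> k; have [mF Fk] := Foo k; split.
  by rewrite -[X in measurable X]setTI; exact: measurable_rV_uncons.
rewrite /lebesgue_rV_step /pushforward -comp_preimage.
by rewrite (_ : _ \o _ = id)//; apply/funext => x; exact: rV_consK.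
Qed.

HB.instance Definition _ := Measure_isSigmaFinite.Build _ _ _
  lebesgue_rV_step step_sigma_finite.

End step.

Fixpoint lebesgue_rV n : {sigma_finite_measure set 'rV[R]_n -> \bar R} :=
  match n with
  | 0 => (\d_(0 : 'rV[R]_0) : {sigma_finite_measure set 'rV[R]_0 -> \bar R})
  | k.+1 => lebesgue_rV_step (lebesgue_rV k)
  end.

End lebesgue_rV.

Section euclidean_norm.
Context {R : realType} {n : nat}.
Implicit Types x y : 'rV[R]_n.

Definition enorm x : R := Num.sqrt (\sum_i x ord0 i ^+ 2).

Lemma enorm_ge0 x : 0 <= enorm x. Proof. exact: sqrtr_ge0. Qed.

Lemma enorm0 : enorm 0 = 0.
Proof.
rewrite /enorm big1 ?sqrtr0// => i _.
by rewrite mxE expr0n.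
Qed.

Let CS x y : (\sum_i x ord0 i * y ord0 i) ^+ 2 <=
  (\sum_i x ord0 i ^+ 2) * (\sum_i y ord0 i ^+ 2).
Proof.
set C := \sum_i _ * _; set A := \sum_i x _ _ ^+ 2; set B := \sum_i y _ _ ^+ 2.
have sq_ge0 (z : 'rV[R]_n) : 0 <= \sum_i z ord0 i ^+ 2.
  by apply: sumr_ge0 => i _; exact: sqr_ge0.
have [B0|B0] := eqVneq B 0.
  have y0 i : y ord0 i = 0.
    apply/eqP; rewrite -sqrf_eq0.
    by move/eqP: B0; rewrite psumr_eq0 => [/allP/(_ i)|j _];
      [rewrite mem_index_enum; exact | exact: sqr_ge0].
  by rewrite /C big1 ?expr0n ?mulr_ge0 ?sq_ge0// => i _; rewrite y0 mulr0.
have Bgt0 : 0 < B by rewrite lt_neqAle eq_sym B0 sq_ge0.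
rewrite -subr_ge0 -(pmulr_rge0 _ Bgt0).
suff -> : B * (A * B - C ^+ 2) = \sum_i (B * x ord0 i - C * y ord0 i) ^+ 2.
  by apply: sumr_ge0 => i _; exact: sqr_ge0.
transitivity (B ^+ 2 * A - (B * C *+ 2) * C + C ^+ 2 * B).
  rewrite mulrBr mulrA [in RHS]mulrnAl -addrA; congr (_ + _).
    by rewrite mulrAC -expr2.
  by rewrite -mulrA -expr2 (mulrC (C ^+ 2)) mulr2n opprD addrNK.
have AE D : D * A = \sum_i D * x ord0 i ^+ 2 by rewrite mulr_sumr.
have BE D : D * B = \sum_i D * y ord0 i ^+ 2 by rewrite mulr_sumr.
have CE D : D * C = \sum_i D * (x ord0 i * y ord0 i) by rewrite mulr_sumr.
by rewrite AE BE CE -sumrB -big_split/=; apply: eq_bigr => i _; ring.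
Qed.

Lemma enormD x y : enorm (x + y) <= enorm x + enorm y.
Proof.
have sq_ge0 (z : 'rV[R]_n) : 0 <= \sum_i z ord0 i ^+ 2.
  by apply: sumr_ge0 => i _; exact: sqr_ge0.
rewrite -(@ler_pXn2r _ 2)// ?nnegrE ?enorm_ge0 ?addr_ge0 ?enorm_ge0//.
rewrite sqrrD !sqr_sqrtr ?sq_ge0//.
under eq_bigr do rewrite mxE sqrrD.
rewrite !big_split/= lerD2r lerD2l -mulr2n lerMn2r/=.
rewrite (le_trans (ler_norm _))// -sqrtr_sqr -sqrtrM ?sq_ge0//.
by rewrite ler_wsqrtr// CS.
Qed.

Lemma enorm_cvg (u : (('rV[R]_n))^nat) (x : 'rV[R]_n) :
  (forall i, u k ord0 i @[k --> \oo] --> x ord0 i) ->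
  enorm (u k) @[k --> \oo] --> enorm x.
Proof.
move=> ux; apply: (cvg_comp _ Num.sqrt); last exact: sqrt_continuous.
apply: cvg_big => [|i _]; first exact: add_continuous.
by apply: cvgM; exact: ux.
Qed.

End euclidean_norm.

Section total_variation.
Local Open Scope ereal_scope.
Context d (T : measurableType d) (R : realType) (n : nat).
Variable nu : 'I_n -> {charge set T -> \bar R}.

(* Euclidean norm of the vector nu(A); charges are finite on measurable sets. *)
Definition vnorm (A : set T) : \bar R :=
  (enorm (\row_i fine (nu i A)))%:E.

Definition countable_partition (A : set T) (B : (set T)^nat) :=
  [/\ forall k, measurable (B k), trivIset setT B & \bigcup_k B k = A].

(* |nu|(A), set to 0 off the sigma-algebra so as to be a total set function. *)
Definition total_variation (A : set T) : \bar R :=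
  if A \in measurable then
    ereal_sup [set \sum_(k <oo) vnorm (B k) | B in countable_partition A]
  else 0.

Let vnorm_ge0 A : 0 <= vnorm A.
Proof. by rewrite lee_fin enorm_ge0. Qed.

Let vnorm0 : vnorm set0 = 0.
Proof.
rewrite /vnorm (_ : \row__ _ = 0%R) ?enorm0//.
by apply/rowP => i; rewrite !mxE charge0.
Qed.

Let partition1 A : measurable A ->
  countable_partition A (fun k => if k is 0 then A else set0).
Proof.
move=> mA; split; first by case.
  by apply/trivIsetP => -[|i] [|j]//= _ _ _; rewrite ?setI0 ?set0I.
rewrite eqEsubset; split=> [x [[|k]]//|x Ax].
by exists 0%N.
Qed.

Let tvE A : measurable A -> total_variation A =
  ereal_sup [set \sum_(k <oo) vnorm (B k) | B in countable_partition A].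
Proof. by move=> mA; rewrite /total_variation mem_set. Qed.

Let tv_ub A B : countable_partition A B ->
  \sum_(k <oo) vnorm (B k) <= total_variation A.
Proof.
move=> pB; rewrite tvE; first by apply: ereal_sup_ubound; exists B.
by have [mB _ <-] := pB; exact: bigcupT_measurable.
Qed.

Let tv_ge0 A : 0 <= total_variation A.
Proof.
rewrite /total_variation; case: ifPn => //; rewrite inE => mA.
apply: (@le_trans _ _ (\sum_(k <oo) vnorm (if k is 0 then A else set0))).
  exact: nneseries_ge0.
by apply: ereal_sup_ubound; exists (fun k => if k is 0 then A else set0) => //;
  exact: partition1.
Qed.

Let tv0 : total_variation set0 = 0.
Proof.
apply/eqP; rewrite eq_le tv_ge0 andbT tvE//.
apply: ge_ereal_sup => _ [B [_ _ B0] <-].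
rewrite eseries0// => k _ _.
suff -> : B k = set0 by [].
by apply/seteqP; split => // x Bx; rewrite -B0; exists k.
Qed.

Let vnorm_sum (B : (set T)^nat) : (forall k, measurable (B k)) ->
  trivIset setT B -> vnorm (\bigcup_k B k) <= \sum_(k <oo) vnorm (B k).
Proof.
move=> mB tB; have mU := bigcupT_measurable B mB.
pose w k : 'rV[R]_n := (\sum_(0 <= j < k) \row_i fine (nu i (B j)))%R.
have wU : enorm (w k) @[k --> \oo] --> enorm (\row_i fine (nu i (\bigcup_k B k))).
  apply: enorm_cvg => i; rewrite mxE.
  have nuU : nu i (\bigcup_k B k) = (fine (nu i (\bigcup_k B k)))%:E.
    by rewrite fineK// fin_num_measure.
  have := @charge_semi_sigma_additive _ _ _ (nu i) B mB tB mU.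
  rewrite nuU => /fine_cvgP[_]; apply: cvg_trans.
  apply: near_eq_cvg; near=> k => /=.
  have -> : w k ord0 i = (\sum_(0 <= j < k) fine (nu i (B j)))%R.
    by rewrite /w summxE; apply: eq_bigr => j _; rewrite mxE.
  by rewrite sum_fine// => j _; exact: fin_num_measure.
have wle k : (enorm (w k))%:E <= \sum_(j <oo) vnorm (B j).
  apply: (@le_trans _ _ (\sum_(0 <= j < k) vnorm (B j))); last first.
    exact: nneseries_lim_ge.
  rewrite /w /vnorm sumEFin lee_fin.
  elim/big_ind2 : _ => [|x1 x2 y1 y2 h1 h2|//]; first by rewrite enorm0.
  by rewrite (le_trans (enormD _ _))// lerD.
have : (fun k => (enorm (w k))%:E) @ \oo --> vnorm (\bigcup_k B k).
  exact: cvg_EFin (nearW _ _) wU.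
move=> /cvg_lim <-//; apply: lime_le.
  by apply/cvg_ex; eexists; exact: cvg_EFin (nearW _ _) wU.
exact: nearW.
Unshelve. all: by end_near. Qed.

Let tv_superadd A B : measurable A -> measurable B -> A `&` B = set0 ->
  total_variation A + total_variation B <= total_variation (A `|` B).
Proof.
move=> mA mB AB0.
have key P Q : countable_partition A P -> countable_partition B Q ->
    \sum_(k <oo) vnorm (P k) + \sum_(k <oo) vnorm (Q k)
    <= total_variation (A `|` B).
  move=> [mP tP UP] [mQ tQ UQ].
  pose C k := if odd k then Q k./2 else P k./2.
  have pC : countable_partition (A `|` B) C.
    split.
    - by move=> k; rewrite /C; case: ifP.
    - move=> i j _ _ [x []]; rewrite /C.
      have PQ a b : P a x -> Q b x -> False.
        move=> Pa Qb; suff : (A `&` B) x by rewrite AB0.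
        by split; [rewrite -UP; exists a|rewrite -UQ; exists b].
      have hE k : k = (odd k + k./2.*2)%N by rewrite odd_double_half.
      case: ifPn => oi; case: ifPn => oj xi xj.
      + rewrite (hE i) (hE j) oi oj (tQ i./2 j./2)//; by exists x.
      + by case: (PQ _ _ xj xi).
      + by case: (PQ _ _ xi xj).
      + rewrite (hE i) (hE j) (negbTE oi) (negbTE oj) (tP i./2 j./2)//; by exists x.
    - rewrite -UP -UQ eqEsubset; split=> [x [k _]|x [[k _ Px]|[k _ Qx]]].
      + by rewrite /C; case: ifPn => _ h; [right|left]; exists k./2.
      + by exists k.*2 => //; rewrite /C odd_double doubleK.
      + by exists k.*2.+1 => //; rewrite /C /= odd_double /= uphalf_double.
  rewrite -nneseriesD; [|by []|by []].
  apply: (le_trans _ (tv_ub pC)).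
  apply: lime_le; first by apply: is_cvg_nneseries => k _ _; exact: adde_ge0.
  apply: nearW => N.
  apply: (@le_trans _ _ (\sum_(0 <= k < N.*2) vnorm (C k))); last first.
    exact: nneseries_lim_ge.
  elim: N => [|N IH]; first by rewrite !big_nil.
  rewrite big_nat_recr//= doubleS big_nat_recr//= big_nat_recr//= -addeA.
  rewrite leeD// /C/= odd_double/= doubleK uphalf_double.
  exact: lexx.
have [->|Xoo] := eqVneq (total_variation (A `|` B)) +oo; first by rewrite leey.
have Xlty : total_variation (A `|` B) < +oo by rewrite ltey.
have Xfin : total_variation (A `|` B) \is a fin_num by rewrite ge0_fin_numE.
have Qfin Q : countable_partition B Q ->
    \sum_(k <oo) vnorm (Q k) \is a fin_num.
  move=> pQ; rewrite ge0_fin_numE; last exact: nneseries_ge0.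
  apply: le_lt_trans Xlty; apply: le_trans (key _ _ (partition1 mA) pQ).
  by rewrite leeDr// nneseries_ge0.
have lea Q : countable_partition B Q ->
    total_variation A <= total_variation (A `|` B) - \sum_(k <oo) vnorm (Q k).
  move=> pQ; rewrite tvE//; apply: ge_ereal_sup => _ [P pP <-].
  by rewrite leeBrDr ?key ?Qfin.
have Afin : total_variation A \is a fin_num.
  rewrite ge0_fin_numE//; apply: le_lt_trans (lea _ (partition1 mB)) _.
  apply: le_lt_trans Xlty.
  by rewrite leeBlDr ?leeDl ?nneseries_ge0 ?Qfin//; exact: partition1.
rewrite addeC -leeBrDr//= [leLHS]tvE//; apply: ge_ereal_sup => _ [Q pQ <-].
by have := lea _ pQ; rewrite !leeBrDr ?Qfin// addeC.
Qed.

Let tv_le A B : measurable A -> measurable B -> A `<=` B ->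
  total_variation A <= total_variation B.
Proof.
move=> mA mB AB; rewrite -(setDUK AB).
apply: (@le_trans _ _ (total_variation A + total_variation (B `\` A))).
  by rewrite leeDl.
apply: tv_superadd => //; first exact: measurableD.
by rewrite setDIK.
Qed.

Let tv_sigma_additive : semi_sigma_additive total_variation.
Proof.
move=> F mF tF mUF.
suff -> : total_variation (\bigcup_k F k) = \sum_(k <oo) total_variation (F k).
  exact: is_cvg_nneseries.
apply/eqP; rewrite eq_le; apply/andP; split; last first.
  apply: lime_le; first exact: is_cvg_nneseries.
  apply: nearW => N.
  apply: (@le_trans _ _ (total_variation (\big[setU/set0]_(0 <= k < N) F k))).
    elim: N => [|N IH]; first by rewrite !big_nil tv0.
    rewrite !big_nat_recr//=.
    apply: (le_trans (leeD2r _ IH)); apply: tv_superadd => //.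
      by rewrite big_mkord; exact: bigsetU_measurable.
    rewrite big_mkord; apply: (@trivIset_bigsetUI _ predT) => //.
    by apply: sub_trivIset tF => i.
  apply: tv_le => //.
    by rewrite big_mkord; exact: bigsetU_measurable.
  by rewrite big_mkord; exact: bigsetU_bigcup.
rewrite tvE//; apply: ge_ereal_sup => _ [B [mB tB UB] <-].
have BE k : B k = \bigcup_j (B k `&` F j).
  rewrite -setI_bigcupr -UB; apply/esym/setIidl => x Bx; by exists k.
apply: (@le_trans _ _ (\sum_(k <oo) \sum_(j <oo) vnorm (B k `&` F j))).
  apply: lee_nneseries => // k _; rewrite {1}(BE k).
  apply: vnorm_sum => [j|]; first exact: measurableI.
  exact: trivIset_setIl.
rewrite nneseries_interchange//; apply: lee_nneseries => [j _ _|j _].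
  exact: nneseries_ge0.
apply: tv_ub; split => [k||]; first exact: measurableI.
  exact: trivIset_setIr.
rewrite -setI_bigcupl UB; apply/setIidr => x Fx; by exists j.
Qed.

HB.instance Definition _ := isMeasure.Build _ _ _
  total_variation tv0 tv_ge0 tv_sigma_additive.

End total_variation.

Section charge_integral.
Local Open Scope ereal_scope.
Context d (T : measurableType d) (R : realType).

(* Integral with respect to a signed measure, through its Jordan decomposition;
   by Hahn_decomposition_uniq the value does not depend on the chosen Hahn
   decomposition. *)
Definition charge_integral (nu : {charge set T -> \bar R}) (D : set T)
    (g : T -> \bar R) : \bar R :=
  let nuPN := projT2 (cid (projT2 (cid (Hahn_decomposition nu)))) in
  \int[jordan_pos nuPN]_(x in D) g x - \int[jordan_neg nuPN]_(x in D) g x.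

End charge_integral.

Section differentiability_classes.
Context {R : realType} {n : nat}.
Implicit Types (U Omega : set 'rV[R]_n) (g : 'rV[R]_n -> R).

Definition partial (i : 'I_n) g : 'rV[R]_n -> R :=
  fun x => 'D_(delta_mx ord0 i) g x.

(* C^k(U) for U open: the iterated partial derivatives of order <= k exist and
   are continuous on U. *)
Fixpoint Ck (k : nat) U g : Prop :=
  (forall x, U x -> {for x, continuous g}) /\
  match k with
  | 0 => True
  | k'.+1 => forall i, (forall x, U x -> derivable g x (delta_mx ord0 i)) /\
                       Ck k' U (partial i g)
  end.

Definition Cinfty U g := forall k, Ck k U g.

Definition bounded_on Omega g := exists M, forall x, Omega x -> `|g x| <= M.

Definition hoelder_on (alpha : R) Omega g := exists M, forall x y,
  Omega x -> Omega y -> `|g x - g y| <= M * enorm (x - y) `^ alpha.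

(* C^{1,alpha}(Omega): finiteness of the usual C^{1,alpha} norm on Omega. *)
Definition C1_hoelder (alpha : R) Omega g :=
  [/\ Ck 1 Omega g, bounded_on Omega g,
      forall i, bounded_on Omega (partial i g) &
      forall i, hoelder_on alpha Omega (partial i g)].

Definition boundary Omega : set 'rV[R]_n := closure Omega `\` Omega°.

(* Nonempty connected open set which near each boundary point is the negative
   side of a C^oo defining function with nonvanishing gradient. *)
Definition smooth_domain Omega :=
  [/\ open Omega, connected Omega, Omega !=set0 &
      forall x0, boundary Omega x0 -> exists U rho,
        [/\ open_nbhs x0 U, Cinfty U rho,
            forall x, U x -> exists i, partial i rho x != 0 &
            Omega `&` U = [set x | rho x < 0] `&` U]].

End differentiability_classes.

Section bounded_variation.
Context {R : realType} {n : nat}.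
Implicit Types (Omega D : set 'rV[R]_n) (u v f a phi : 'rV[R]_n -> R).

Definition test_function Omega phi := Cinfty [set: 'rV[R]_n] phi /\
  exists K, [/\ compact K, K `<=` Omega & forall x, ~ K x -> phi x = 0].

(* nu represents the distributional gradient Du on Omega. Only the values of u
   on Omega and those of nu on subsets of Omega matter. *)
Definition is_gradient Omega u
    (nu : 'I_n -> {charge set 'rV[R]_n -> \bar R}) :=
  forall phi, test_function Omega phi -> forall i,
    (\int[lebesgue_rV n]_(x in Omega) (u x * partial i phi x)%:E =
     - charge_integral (nu i) Omega (EFin \o phi))%E.

(* BV(Omega); functions are identified up to a.e. equality by ae_class below. *)
Definition BV Omega u :=
  (lebesgue_rV n).-integrable Omega (EFin \o u) /\
  exists nu, is_gradient Omega u nu.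

(* The vector measure Du, junk unless BV Omega u. On subsets of Omega it is
   uniquely determined by u. *)
Definition gradient Omega u : 'I_n -> {charge set 'rV[R]_n -> \bar R} :=
  if pselect (exists nu, is_gradient Omega u nu) is left h
  then projT1 (cid h) else fun=> czero.

Definition weighted_variation Omega a u : \bar R :=
  (\int[total_variation (gradient Omega u)]_(x in Omega) (a x)%:E)%E.

(* The library's ess_sup, for Lebesgue measure restricted to D. *)
Definition ess_sup_on D (g : 'rV[R]_n -> \bar R) : \bar R :=
  ereal_inf [set y | {ae lebesgue_rV n, forall x, D x -> (g x <= y)%E}].

Definition BV_with_trace Omega f v := BV Omega v /\
  forall x, boundary Omega x ->
    ess_sup_on (Omega `&` [set y | enorm (x - y) < r])
      (fun y => `|f x - v y|%:E) @[r --> 0^'+] --> 0%E.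

Definition least_gradient_minimizers Omega a f : set ('rV[R]_n -> R) :=
  [set u | BV_with_trace Omega f u /\
    forall v, BV_with_trace Omega f v ->
      (weighted_variation Omega a u <= weighted_variation Omega a v)%E].

Definition ae_class Omega u : set ('rV[R]_n -> R) :=
  [set v | ae_eq (lebesgue_rV n) Omega u v].

End bounded_variation.

(* Main.v *)
(** A continuous divergence-free field Z with |Z| = a calibrates every function
    whose level sets are orthogonal to Z: such a function minimizes the integral
    of a|Du| among the functions with the same trace. In the unit ball, with
    x = (z, x') and s = |x'|^2, choose Z(z, s) so that three families of sheets
    are orthogonal to it: the graphs z = ((ep (s - 1/2) - l)_+)^k for s > 1/2,
    and, for s < 1/2, both the flat piece z = 0 and the graph
    z = (G(s)_+)^k bounding a lens above it. Each sheet is flat near s = 1/2,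
    from where it may run below or above the lens. Stacking the sheets of levels
    l in [0, ep/4], those with l < c above the lens and the others below, gives
    a function of bounded variation which depends on c only inside the lens, so
    that all of them share the same trace and the same weighted variation. The
    field is only Hoelder continuous, but |Z|^2 involves no power of z lower
    than z^(1 + alpha). Damping the powers t^q into t^q exp(-d/t) approximates
    Z uniformly by smooth fields which are still divergence-free. *)

Require Import Defs.
From HB Require Import structures.
From mathcomp Require Import all_boot all_order all_algebra.
From mathcomp Require Import all_classical all_reals all_analysis.
From mathcomp Require Import measurable_realfun ring lra.

Set Implicit Arguments.
Unset Strict Implicit.
Unset Printing Implicit Defensive.

Import Order.TTheory GRing.Theory Num.Theory.
Import numFieldNormedType.Exports.

Local Open Scope classical_set_scope.
Local Open Scope ring_scope.

(** * Truncated powers and their smooth damping *)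

Section truncated_powers.
Context {R : realType}.
Implicit Types (q t : R).

(** The sheets can branch because [p < 1]. A graph z = h(s) orthogonal to Z satisfies an equation of
    the type h' = C h^p, whose solutions may rest on z = 0 and leave it anywhere as a power of
    exponent k, with k p = k - 1. The exponents are then forced: the horizontal part of Z behaves
    like z^p, so |Z|^2 contains z^(2p), and 2p = 1 + alpha yields k = 2 / (1 - alpha). The
    horizontal part of Z is a radial field times E'(z), where E(z) = exp(nu z^(p + 1)), so its
    divergence is integrated explicitly in z. The remaining freedom, a function of s, is spent on
    making the vertical part equal to E(z) on the lens top and for s > 1/2; the ratio E'/E is then
    exactly the power above. Test functions are C^oo with compact support, and Z is neither. Damping
    keeps the relations behind the zero divergence. A radial cutoff near the sphere costs a term
    weighted by the difference of two functions with the same trace; as the mass of the gradient of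
    the cutoff stays bounded, this term vanishes in the limit. *)

Definition ppow q t : R := Num.max t 0 `^ q.

Lemma ppow_ge0 q t : 0 <= ppow q t.
Proof. exact: powR_ge0. Qed.

Lemma ppow_ge0E q t : 0 <= t -> ppow q t = t `^ q.
Proof. by move=> t0; rewrite /ppow (max_idPl t0). Qed.

Lemma ppow_le0 q t : q != 0 -> t <= 0 -> ppow q t = 0.
Proof. by move=> q0 t0; rewrite /ppow (max_idPr t0) powR0. Qed.

Lemma ppow_comp p q t : ppow p (ppow q t) = ppow (q * p) t.
Proof. by rewrite {1}/ppow (max_idPl (ppow_ge0 _ _)) -powRrM. Qed.

Lemma ppow_mono q : 0 <= q -> {homo ppow q : x y / x <= y}.
Proof.
move=> q0 x y xy; apply: ge0_ler_powR => //.
- by rewrite nnegrE le_max lexx orbT.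
- by rewrite nnegrE le_max lexx orbT.
- by rewrite ge_max !le_max xy lexx orbT.
Qed.

Lemma derivable_continuous (f : R -> R) t df : is_derive t 1 f df ->
  {for t, continuous f}.
Proof.
by move=> [df1 _]; apply: differentiable_continuous; exact/derivable1_diffP.
Qed.

Lemma is_derive_ppow_gt0 q t : 0 < t ->
  is_derive t 1 (ppow q) (q * ppow (q - 1) t).
Proof.
move=> t0; rewrite ppow_ge0E ?ltW//.
apply: (@near_eq_is_derive _ _ _ (fun t => t `^ q)).
  by near=> y; rewrite ppow_ge0E//; apply: ltW; near: y; exact: lt_nbhsr.
by apply: is_derive_eq; [exact: is_derive1_powR|rewrite ?scaler1 ?mulr1].
Unshelve. all: by end_near. Qed.

Lemma continuous_ppow q : 0 < q -> continuous (ppow q).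
Proof.
move=> q0 t; have [t0|t0] := ltP 0 t.
  exact: derivable_continuous (is_derive_ppow_gt0 q t0).
apply/cvgrPdist_le => e e0; rewrite ppow_le0 ?gt_eqF//.
near=> y; rewrite sub0r normrN ger0_norm ?ppow_ge0//.
(* Writing [e] as a value of [ppow q] turns the estimate at a point [t <= 0] into monotonicity. *)
have -> : e = ppow q (e `^ q^-1).
  by rewrite ppow_ge0E ?powR_ge0// -powRrM mulVf ?gt_eqF// powRr1 ?ltW.
apply: ppow_mono; first exact: ltW.
apply: ltW; near: y; apply: lt_nbhsl => //.
by rewrite (le_lt_trans t0)// powR_gt0.
Unshelve. all: by end_near. Qed.

(** Serves at the junction point [0] of functions defined by cases, where the usual rules do not
    apply. *)
Lemma is_derive0_squeeze (f g : R -> R) : f 0 = 0 ->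
  (\forall h \near 0, `|f h| <= `|h| * g h) ->
  g h @[h --> 0] --> 0 -> is_derive (0 : R) 1 f 0.
Proof.
move=> f0 fg g0.
have C : h^-1 *: ((f \o shift 0) (h *: 1) - f 0) @[h --> 0^'] --> (0 : R).
  apply/cvgr0Pnorm_le => e e0; near=> h.
  have h0 : h != 0 by near: h; exact: nbhs_dnbhs_neq.
  rewrite f0 subr0/= addr0 scaler1 /GRing.scale/= normrM normfV.
  rewrite ler_pdivrMl ?normr_gt0//.
  have hg : `|f h| <= `|h| * g h by near: h; exact: nbhs_dnbhs.
  apply: (le_trans hg); rewrite ler_wpM2l//.
  apply: le_trans (ler_norm _) _; near: h; apply: nbhs_dnbhs.
  by move/cvgr0Pnorm_le: g0; exact.
split; first by apply/cvg_ex; exists 0.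
exact: cvg_lim C.
Unshelve. all: by end_near. Qed.

Lemma is_derive_ppow q t : 1 < q ->
  is_derive t 1 (ppow q) (q * ppow (q - 1) t).
Proof.
move=> q1; have q0 : q != 0 by rewrite gt_eqF// (lt_trans _ q1).
have q10 : q - 1 != 0 by rewrite gt_eqF// subr_gt0.
have [t0|t0|->] := ltgtP t 0.
- rewrite ppow_le0 ?(ltW t0)// mulr0.
  apply: (@near_eq_is_derive _ _ _ (cst (0 : R))).
  by near=> y; rewrite ppow_le0//; apply: ltW; near: y; exact: lt_nbhsl.
- exact: is_derive_ppow_gt0.
- rewrite ppow_le0// mulr0.
  apply: (@is_derive0_squeeze _ (ppow (q - 1))); first by rewrite ppow_le0.
    near=> h; rewrite ger0_norm ?ppow_ge0//.
    have [h0|h0] := leP h 0; first by rewrite !ppow_le0// mulr0.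
    rewrite !ppow_ge0E ?(ltW h0)// gtr0_norm// mulr_powRB1 ?(ltW h0)//.
    by rewrite (lt_trans _ q1).
  have := @continuous_ppow (q - 1) _ 0; rewrite /continuous_at ppow_le0//.
  by apply; rewrite subr_gt0.
Unshelve. all: by end_near. Qed.

(* The factor [exp (- d / t)] makes this C^oo on the whole line, for every real
   exponent [q]; it tends to [ppow q] as [d] tends to [0]. *)
Definition damped q d t : R :=
  if 0 < t then t `^ q * expR (- (d / t)) else 0.

Lemma damped_gt0 q d t : 0 < t -> damped q d t = t `^ q * expR (- (d / t)).
Proof. by rewrite /damped => ->. Qed.

Lemma damped_le0 q d t : t <= 0 -> damped q d t = 0.
Proof. by rewrite /damped ltNge => ->. Qed.

Lemma damped_ge0 q d t : 0 <= damped q d t.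
Proof. by rewrite /damped; case: ifP => // _; rewrite mulr_ge0 ?powR_ge0 ?expR_ge0. Qed.

Lemma expRN_le1 (x : R) : 0 <= x -> expR (- x) <= 1.
Proof. by move=> x0; rewrite -expR0 ler_expR oppr_le0. Qed.

Lemma damped_le_ppow q d t : 0 <= d -> damped q d t <= ppow q t.
Proof.
move=> d0; have [t0|t0] := ltP 0 t; last by rewrite damped_le0// ppow_ge0.
rewrite damped_gt0// ppow_ge0E ?(ltW t0)// ler_piMr ?powR_ge0//.
by rewrite expRN_le1// divr_ge0// ltW.
Qed.

Lemma mulr_expRN_le1 (x : R) : 0 <= x -> x * expR (- x) <= 1.
Proof.
move=> x0; rewrite expRN ler_pdivrMr ?expR_gt0// mul1r.
by apply: le_trans (expR_ge1Dx x); rewrite lerDr.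
Qed.

(** Raise [y <= expR y], with y = x / (N + 1), to the power N + 1. With x = d / t this shows that
    the damping factor beats every negative power of t. *)
Lemma expRN_le_pow (x : R) (N : nat) : 0 < x -> expR (- x) <= (N.+1%:R / x) ^+ N.+1.
Proof.
move=> x0; have N0 : (0 : R) < N.+1%:R by [].
rewrite expRN.
have -> : (N.+1%:R / x) ^+ N.+1 = ((x / N.+1%:R) ^+ N.+1)^-1.
  by rewrite -exprVn invf_div.
rewrite (_ : expR x = expR (x / N.+1%:R) ^+ N.+1); last first.
  by rewrite -expRM_natl mulrC divfK// gt_eqF.
rewrite lef_pV2 ?posrE ?exprn_gt0 ?expR_gt0 ?divr_gt0//.
rewrite lerXn2r ?nnegrE ?expR_ge0 ?divr_ge0 ?(ltW x0)//.
by apply: le_trans (expR_ge1Dx _); rewrite lerDr.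
Qed.

(** The derivative stays in the span of damped powers, whose exponents may become negative;
    smoothness of all orders follows by induction. *)
Lemma is_derive_damped q d t : 0 < d ->
  is_derive t 1 (damped q d)
    (q * damped (q - 1) d t + d * damped (q - 2) d t).
Proof.
move=> d0; have [t0|t0|->] := ltgtP t 0.
- rewrite !damped_le0 ?(ltW t0)// !mulr0 addr0.
  apply: (@near_eq_is_derive _ _ _ (cst (0 : R))).
  by near=> y; rewrite damped_le0//; apply: ltW; near: y; exact: lt_nbhsl.
- apply: (@near_eq_is_derive _ _ _ (fun t => t `^ q * expR (- (d / t)))).
    by near=> y; rewrite damped_gt0//; near: y; exact: lt_nbhsr.
  have e1 : is_derive t 1 (fun t => t `^ q) (q * t `^ (q - 1)).
    by apply: is_derive_eq; [exact: is_derive1_powR|rewrite ?scaler1 ?mulr1].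
  have e2 : is_derive t 1 (fun t => - (d / t)) (d * t `^ (-2)).
    have iV : is_derive t 1 (fun t => t^-1) (- t ^- 2).
      have := @is_deriveV _ id t 1 1 (lt0r_neq0 t0) (is_derive_id _ _).
      by move=> H; refine (is_derive_eq H _); rewrite scaler1.
    have := @is_deriveZ _ _ _ (fun t : R => t^-1) (- d) t 1 _ iV.
    have E : (- d) \*: (fun t : R => t^-1) = (fun t => - (d / t)).
      by apply/funext => y /=; rewrite /GRing.scale/= mulNr.
    rewrite E => H; refine (is_derive_eq H _).
    by rewrite powR_invn ?(ltW t0)// /GRing.scale/= mulrNN.
  have e3 := @is_derive1_comp _ expR (fun t => - (d / t)) t _ _ (is_derive_expR _) e2.
  have := is_deriveM e1 e3 => H; refine (is_derive_eq H _).
  rewrite !damped_gt0// /GRing.scale/=.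
  rewrite (_ : t `^ (q - 2) = t `^ q * t `^ (-2)); last first.
    by rewrite -powRD// (gt_eqF t0) implybT.
  ring.
- rewrite !damped_le0// !mulr0 addr0.
  (* [N] is so large that [q + N.+1 >= 2]; near [0] the damped power is then at most a constant
     times h^2, whatever the sign of [q]. *)
  pose N := (Num.truncn (`|q| + 2)).
  have qN : 2 <= q + N.+1%:R.
    have : `|q| + 2 < N.+1%:R by rewrite truncnS_gt.
    have := ler_norm (- q); rewrite normrN; lra.
  pose C := (N.+1%:R / d) ^+ N.+1.
  have C0 : 0 <= C by rewrite exprn_ge0// divr_ge0 ?ltW.
  apply: (@is_derive0_squeeze _ (fun h => C * `|h|)).
  + by rewrite damped_le0.
  + near=> h; rewrite ger0_norm ?damped_ge0//.
    have [h0|h0] := leP h 0; first by rewrite damped_le0// !mulr_ge0.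
    rewrite damped_gt0// gtr0_norm//.
    apply: (@le_trans _ _ (h `^ q * (h ^+ N.+1 * C))).
      rewrite ler_wpM2l ?powR_ge0// (le_trans (expRN_le_pow N _)) ?divr_gt0//.
      by rewrite /C -exprMn invf_div mulrCA.
    rewrite mulrA mulrCA (mulrC C) ler_wpM2r// -powR_mulrn ?(ltW h0)//.
    rewrite -powRD; last by rewrite (gt_eqF h0) implybT.
    rewrite -expr2 -powR_mulrn ?(ltW h0)//.
    apply: ger_powR => //; rewrite h0/=.
    by apply: ltW; near: h; exact: lt_nbhsl.
  + rewrite -[X in _ --> X](mulr0 C); apply: cvgMr; rewrite -[X in _ --> X](@normr0 _ R).
    exact: norm_continuous.
Unshelve. all: by end_near. Qed.

Section damped_cvg.
Context {T : Type} {F : set_system T} {FF : Filter F}.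
Variables (f g : T -> R) (t q : R).
Hypotheses (q0 : 0 < q) (f0 : f x @[x --> F] --> 0)
  (fgt0 : \forall x \near F, 0 < f x) (gt : g x @[x --> F] --> t).

(** The damping parameter and the argument move together; compactness later turns this joint
    convergence into a uniform one. When the limit [t] is not positive, the damped power is squeezed
    between [0] and [ppow q]. *)
Lemma cvg_damped : damped q (f x) (g x) @[x --> F] --> ppow q t.
Proof.
have gp : ppow q (g x) @[x --> F] --> ppow q t.
  by apply: (@cvg_comp _ _ _ g (ppow q) F _ _ gt); exact: continuous_ppow.
have [t0|t0] := ltP 0 t.
  have : ppow q (g x) * expR (- (f x / g x)) @[x --> F] --> ppow q t * expR (- (0 / t)).
    apply: cvgM => //; apply: continuous_cvg; first exact: continuous_expR.
    apply: cvgN; apply: cvgM => //; apply: cvgV => //.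
    by rewrite gt_eqF.
  rewrite mul0r oppr0 expR0 mulr1; apply: cvg_trans; apply: near_eq_cvg.
  near=> x; have gx : 0 < g x.
    by near: x; move/cvgrPdist_lt: gt => /(_ _ t0); apply: filterS => x;
      rewrite ltr_norml => /andP[_]; rewrite ltrBlDr ltrDl.
  by rewrite damped_gt0// ppow_ge0E// ltW.
apply: (@squeeze_cvgr _ _ _ _ (fun=> 0) (fun x => ppow q (g x))) => //.
  by near=> x; rewrite damped_ge0/= damped_le_ppow// ltW//; near: x.
rewrite ppow_le0 ?gt_eqF//; exact: cvg_cst.
Unshelve. all: by end_near. Qed.

(** These are the extra terms created by differentiating the damping factor. Each equals [ppow q g]
    times y exp(-y) with y = f / g; the second factor is at most [1], and either it or the first one
    tends to [0]. *)
Lemma cvg_damped_subr1 : f x * damped (q - 1) (f x) (g x) @[x --> F] --> 0.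
Proof.
have gp : ppow q (g x) @[x --> F] --> ppow q t.
  by apply: (@cvg_comp _ _ _ g (ppow q) F _ _ gt); exact: continuous_ppow.
have E x : 0 < g x -> f x * damped (q - 1) (f x) (g x) =
    ppow q (g x) * (f x / g x * expR (- (f x / g x))).
  move=> gx; rewrite damped_gt0// ppow_ge0E ?ltW//.
  rewrite -(@mulr_powRB1 _ (g x) q) ?(ltW gx)//.
  by field; rewrite gt_eqF.
have [t0|t0] := ltP 0 t.
  have : ppow q (g x) * (f x / g x * expR (- (f x / g x))) @[x --> F]
      --> ppow q t * (0 / t * expR (- (0 / t))).
    have fg : f x / g x @[x --> F] --> 0 / t.
      by apply: cvgM => //; apply: cvgV => //; rewrite gt_eqF.
    apply: cvgM => //; apply: cvgM => //.
    apply: continuous_cvg; first exact: continuous_expR.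
    exact: cvgN.
  rewrite !mul0r mulr0; apply: cvg_trans; apply: near_eq_cvg.
  near=> x; have gx : 0 < g x.
    by near: x; move/cvgrPdist_lt: gt => /(_ _ t0); apply: filterS => x;
      rewrite ltr_norml => /andP[_]; rewrite ltrBlDr ltrDl.
  by rewrite E.
apply: (@squeeze_cvgr _ _ _ _ (fun=> 0) (fun x => ppow q (g x))) => //.
- near=> x; have fx : 0 < f x by near: x.
  rewrite mulr_ge0 ?damped_ge0 ?(ltW fx)//=.
  have [gx|gx] := ltP 0 (g x); last by rewrite damped_le0// mulr0 ppow_ge0.
  by rewrite E// ler_piMr ?ppow_ge0// mulr_expRN_le1// divr_ge0// ltW.
- exact: cvg_cst.
- by move: gp; rewrite ppow_le0// gt_eqF.
Unshelve. all: by end_near. Qed.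

End damped_cvg.
End truncated_powers.

(** * Pointwise operations on continuous real functions *)

Section continuous_real_functions.
Context {R : realType} {T : topologicalType}.
Implicit Types f g : T -> R.

Lemma contC (c : R) : continuous (fun _ : T => c).
Proof. by move=> x; exact: cvg_cst. Qed.

Lemma contD f g : continuous f -> continuous g -> continuous (fun x => f x + g x).
Proof. by move=> cf cg x; apply: (@cvgD R R T (nbhs x)); [exact: cf|exact: cg]. Qed.

Lemma contN f : continuous f -> continuous (fun x => - f x).
Proof. by move=> cf x; apply: (@cvgN R R T (nbhs x)); exact: cf. Qed.

Lemma contB f g : continuous f -> continuous g -> continuous (fun x => f x - g x).
Proof. by move=> cf cg; apply: contD => //; exact: contN. Qed.

Lemma contM f g : continuous f -> continuous g -> continuous (fun x => f x * g x).
Proof. by move=> cf cg x; apply: (@cvgM R T (nbhs x)); [exact: cf|exact: cg]. Qed.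

Lemma cont_comp (F : R -> R) f : continuous F -> continuous f ->
  continuous (fun x => F (f x)).
Proof. by move=> cF cf x; apply: (@continuous_comp _ _ _ f F); [exact: cf|exact: cF]. Qed.

Lemma contX f k : continuous f -> continuous (fun x => f x ^+ k).
Proof.
move=> cf; elim: k => [|k IH]; first by under eq_fun do rewrite expr0; exact: contC.
by under eq_fun do rewrite exprS; exact: contM.
Qed.

Lemma cont_sum (I : Type) (r : seq I) (h : I -> T -> R) :
  (forall i, continuous (h i)) -> continuous (fun x => \sum_(i <- r) h i x).
Proof.
move=> ch; elim: r => [|i r IH]; first by under eq_fun do rewrite big_nil; exact: contC.
by under eq_fun do rewrite big_cons; exact: contD.
Qed.

End continuous_real_functions.

(** * Smooth functions on R^n *)

Section directional_calculus.
Context {R : realType} {n : nat}.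
Implicit Types (f g : 'rV[R]_n -> R) (x v : 'rV[R]_n) (F : R -> R).

(** Restricting to the line through [x] reduces directional derivatives to one variable, where the
    chain rule is available without differentiability on R^n. *)
Lemma is_derive_lineE f x v df :
  is_derive x v f df <-> is_derive (0 : R) 1 (fun t : R => f (t *: v + x)) df.
Proof.
have E : (fun h : R => h^-1 *: ((f \o shift x) (h *: v) - f x)) =
  (fun h : R => h^-1 *: (((fun t : R => f (t *: v + x)) \o shift 0) (h *: 1) -
     (fun t : R => f (t *: v + x)) 0)).
  apply/funext => h /=.
  by rewrite scale0r add0r addr0 /GRing.scale/= mulr1.
split=> -[d1 d2]; split; move: d1 d2; rewrite /derivable /derive E//.
Qed.

Lemma is_derive_comp1 f x v df F dF : is_derive x v f df ->
  is_derive (f x) 1 F dF -> is_derive x v (fun y => F (f y)) (dF * df).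
Proof.
move=> /is_derive_lineE fx Ff; apply/is_derive_lineE.
apply: (@is_derive1_comp _ F (fun t : R => f (t *: v + x))) => //.
by rewrite scale0r add0r.
Qed.

Lemma is_deriveD_fun f g x v a b : is_derive x v f a -> is_derive x v g b ->
  is_derive x v (fun y => f y + g y) (a + b).
Proof. exact: is_deriveD. Qed.

Lemma is_deriveB_fun f g x v a b : is_derive x v f a -> is_derive x v g b ->
  is_derive x v (fun y => f y - g y) (a - b).
Proof. exact: is_deriveB. Qed.

Lemma is_deriveM_fun f g x v a b : is_derive x v f a -> is_derive x v g b ->
  is_derive x v (fun y => f y * g y) (f x * b + g x * a).
Proof. exact: is_deriveM. Qed.

Lemma is_deriveZ_fun f x v a (c : R) : is_derive x v f a ->
  is_derive x v (fun y => c * f y) (c * a).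
Proof. exact: is_deriveZ. Qed.

Lemma is_derive_cst_fun (c : R) x v : is_derive x v (fun=> c) 0.
Proof. exact: is_derive_cst. Qed.

Lemma is_derive_sum_fun m (h : 'I_m -> 'rV[R]_n -> R) x v dh :
  (forall i, is_derive x v (h i) (dh i)) ->
  is_derive x v (fun y => \sum_(i < m) h i y) (\sum_(i < m) dh i).
Proof.
move=> hh; have := is_derive_sum hh; congr is_derive.
by apply/funext => y; rewrite fct_sumE.
Qed.

Lemma is_derive_coord (j : 'I_n) x v :
  is_derive x v (fun y : 'rV[R]_n => y ord0 j) (v ord0 j).
Proof.
apply/is_derive_lineE.
have -> : (fun t : R => (t *: v + x) ord0 j) = (fun t => t * v ord0 j + x ord0 j).
  by apply/funext => t; rewrite !mxE.
have H : is_derive (0 : R) 1 (fun t : R => t * v ord0 j) (v ord0 j).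
  have := @is_deriveM _ _ id (cst (v ord0 j)) 0 1 _ _ (is_derive_id _ _) (is_derive_cst _ _ _).
  by move=> H; refine (is_derive_eq H _); rewrite scaler0 add0r scaler1.
have := @is_deriveD _ _ _ _ (cst (x ord0 j)) _ _ _ _ H (is_derive_cst _ _ _).
by move=> H'; refine (is_derive_eq H' _); rewrite addr0.
Qed.

Lemma is_derive_sqr f x v df : is_derive x v f df ->
  is_derive x v (fun y => f y ^+ 2) (2 * f x * df).
Proof.
move=> fd; have := is_deriveM_fun fd fd => H; refine (is_derive_eq H _); ring.
Qed.

Definition unitv (i : 'I_n) : 'rV[R]_n := delta_mx ord0 i.

Lemma unitvE i j : unitv i ord0 j = (j == i)%:R.
Proof. by rewrite mxE eqxx. Qed.

Lemma partialE f x i d : is_derive x (unitv i) f d -> partial i f x = d.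
Proof. by move=> H; exact: derive_val. Qed.

End directional_calculus.

(** * Closure properties of C^k and C^oo functions *)

Section smooth_functions.
Context {R : realType} {n : nat}.
Implicit Types (f g : 'rV[R]_n -> R) (F : R -> R) (x : 'rV[R]_n).

(** Differentiability [k] times, with no continuity asked of the last derivative: [Ck_comp] takes
    one order more, and the existence of that further derivative supplies the continuity. *)
Fixpoint Ck1 k F : Prop :=
  match k with
  | 0 => True
  | k'.+1 => exists F' : R -> R, (forall t : R, is_derive t 1 F (F' t)) /\ Ck1 k' F'
  end.

Lemma Ck1D k F G : Ck1 k F -> Ck1 k G -> Ck1 k (F + G).
Proof.
elim: k F G => [//|k IH] F G [F' [FF' cF']] [G' [GG' cG']].
exists (F' + G'); split; last exact: IH.
by move=> t; exact: is_deriveD.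
Qed.

Lemma Ck1Z k F (c : R) : Ck1 k F -> Ck1 k (c \*: F).
Proof.
elim: k F => [//|k IH] F [F' [FF' cF']].
exists (c \*: F'); split; last exact: IH.
by move=> t; exact: is_deriveZ.
Qed.

Lemma Ck1_expR k : Ck1 k (@expR R).
Proof. by elim: k => // k IH; exists expR; split => // t; exact: is_derive_expR. Qed.

Lemma Ck1_damped k (q d : R) : 0 < d -> Ck1 k (damped q d).
Proof.
move=> d0; elim: k q => // k IH q.
exists (q \*: damped (q - 1) d + d \*: damped (q - 2) d); split.
  by move=> t; exact: is_derive_damped.
by apply: Ck1D; apply: Ck1Z.
Qed.

Let U : set 'rV[R]_n := setT.

Lemma CkW k f : Ck k.+1 U f -> Ck k U f.
Proof.
elim: k f => [|k IH] f /= [cf pf]; split => // i; have [df cd] := pf i.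
by split=> //; exact: IH.
Qed.

Lemma Ck_continuous k f : Ck k U f -> continuous f.
Proof. by case: k => [|k] [cf _] x; exact: cf. Qed.

Lemma Ck_is_derive k f : Ck k.+1 U f -> forall x i,
  is_derive x (unitv i) f (partial i f x).
Proof. by move=> [_ pf] x i; apply: derivableP; have [df _] := pf i; exact: df. Qed.

Lemma Ck_intro k f (df : 'I_n -> 'rV[R]_n -> R) : continuous f ->
  (forall x i, is_derive x (unitv i) f (df i x)) ->
  (forall i, Ck k U (df i)) -> Ck k.+1 U f.
Proof.
move=> cf fd cd; split; first by move=> x _; exact: cf.
move=> i; split; first by move=> x _; have [] := fd x i.
rewrite (_ : partial i f = df i)//; apply/funext => x.
exact: partialE.
Qed.

Lemma Ck_cst k (c : R) : Ck k U (fun=> c).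
Proof.
elim: k c => [|k IH] c; first by split => // x _; exact: cst_continuous.
by apply: (@Ck_intro _ _ (fun _ _ => 0)) => //; exact: cst_continuous.
Qed.

Lemma continuous_coord (j : 'I_n) : continuous (fun x : 'rV[R]_n => x ord0 j).
Proof. exact: coord_continuous. Qed.

Lemma Ck_coord k (j : 'I_n) : Ck k U (fun x => x ord0 j).
Proof.
case: k => [|k]; first by split => // x _; exact: coord_continuous.
apply: (@Ck_intro _ _ (fun i _ => unitv i ord0 j)).
- exact: continuous_coord.
- by move=> x i; exact: is_derive_coord.
- by move=> i; exact: Ck_cst.
Qed.

Lemma CkD k f g : Ck k U f -> Ck k U g -> Ck k U (fun x => f x + g x).
Proof.
elim: k f g => [|k IH] f g cf cg.
  split => // x _; apply: continuousD; exact: (Ck_continuous (k := 0)).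
apply: (@Ck_intro _ _ (fun i x => partial i f x + partial i g x)).
- by move=> x; apply: continuousD; exact: (Ck_continuous (k := k.+1)).
- by move=> x i; apply: is_deriveD_fun; exact: (Ck_is_derive (k := k)).
- move=> i; apply: IH; first by have [_ /(_ i) []] := cf.
  by have [_ /(_ i) []] := cg.
Qed.

Lemma CkM k f g : Ck k U f -> Ck k U g -> Ck k U (fun x => f x * g x).
Proof.
elim: k f g => [|k IH] f g cf cg.
  split => // x _; apply: continuousM; exact: (Ck_continuous (k := 0)).
apply: (@Ck_intro _ _ (fun i x => f x * partial i g x + g x * partial i f x)).
- by move=> x; apply: continuousM; exact: (Ck_continuous (k := k.+1)).
- by move=> x i; apply: is_deriveM_fun; exact: (Ck_is_derive (k := k)).
- move=> i; apply: CkD; apply: IH; try exact: CkW.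
    by have [_ /(_ i) []] := cg.
  by have [_ /(_ i) []] := cf.
Qed.

Lemma Ck_comp k f F : Ck k U f -> Ck1 k.+1 F -> Ck k U (fun x => F (f x)).
Proof.
have cont k0 f0 F0 : Ck k0 U f0 -> Ck1 k0.+1 F0 -> continuous (fun x => F0 (f0 x)).
  move=> cf [F' [FF' _]] x; apply: (@continuous_comp _ _ _ f0 F0).
    exact: (Ck_continuous cf).
  exact: derivable_continuous (FF' _).
elim: k f F => [|k IH] f F cf cF.
  by split => // x _; exact: (cont 0%N).
have [F' [FF' cF']] := cF.
apply: (@Ck_intro _ _ (fun i x => F' (f x) * partial i f x)).
- exact: (cont k.+1).
- move=> x i; exact: (is_derive_comp1 (Ck_is_derive (k := k) cf x i) (FF' _)).
- move=> i; apply: CkM; first by apply: IH => //; exact: CkW.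
  by have [_ /(_ i) []] := cf.
Qed.

Definition smooth f := Cinfty setT f.

Lemma smooth_cst (c : R) : smooth (fun=> c). Proof. by move=> k; exact: Ck_cst. Qed.

Lemma smooth_coord (j : 'I_n) : smooth (fun x => x ord0 j).
Proof. by move=> k; exact: Ck_coord. Qed.

Lemma smoothD f g : smooth f -> smooth g -> smooth (fun x => f x + g x).
Proof. by move=> sf sg k; exact: CkD. Qed.

Lemma smoothM f g : smooth f -> smooth g -> smooth (fun x => f x * g x).
Proof. by move=> sf sg k; exact: CkM. Qed.

Lemma smoothZ f (c : R) : smooth f -> smooth (fun x => c * f x).
Proof. by move=> sf; apply: smoothM => //; exact: smooth_cst. Qed.

Lemma smoothB f g : smooth f -> smooth g -> smooth (fun x => f x - g x).
Proof.
move=> sf sg; rewrite (_ : (fun _ => _) = fun x => f x + -1 * g x).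
  by apply: smoothD => //; exact: smoothZ.
by apply/funext => x; rewrite mulN1r.
Qed.

Lemma smooth_sum (I : Type) (r : seq I) (h : I -> 'rV[R]_n -> R) :
  (forall i, smooth (h i)) -> smooth (fun x => \sum_(i <- r) h i x).
Proof.
move=> sh; elim: r => [|i r IH].
  rewrite (_ : (fun _ => _) = fun=> 0); first exact: smooth_cst.
  by apply/funext => x; rewrite big_nil.
rewrite (_ : (fun _ => _) = fun x => h i x + \sum_(j <- r) h j x).
  exact: smoothD.
by apply/funext => x; rewrite big_cons.
Qed.

Lemma smooth_comp f F : smooth f -> (forall k, Ck1 k F) -> smooth (fun x => F (f x)).
Proof. by move=> sf sF k; exact: Ck_comp. Qed.

Lemma smooth_sqr f : smooth f -> smooth (fun x => f x ^+ 2).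
Proof. by move=> sf; exact: (smoothM sf sf). Qed.

Lemma smooth_is_derive f x i : smooth f -> is_derive x (unitv i) f (partial i f x).
Proof. by move=> sf; exact: (Ck_is_derive (k := 0) (sf 1%N)). Qed.

Lemma smooth_continuous f : smooth f -> continuous f.
Proof. by move=> sf; exact: (Ck_continuous (sf 0%N)). Qed.

Lemma smooth_partial f i : smooth f -> smooth (partial i f).
Proof. by move=> sf k; have [_ /(_ i)[]] := sf k.+1. Qed.

Definition sqn (x : 'rV[R]_n) := \sum_i x ord0 i ^+ 2.

Lemma sqn_ge0 x : 0 <= sqn x. Proof. by apply: sumr_ge0 => i _; exact: sqr_ge0. Qed.

Lemma smooth_sqn : smooth sqn.
Proof. by apply: smooth_sum => i; apply: smooth_sqr; exact: smooth_coord. Qed.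

Lemma is_derive_sqn x i : is_derive x (unitv i) sqn (2 * x ord0 i).
Proof.
have := @is_derive_sum_fun R n n (fun j y => y ord0 j ^+ 2) x (unitv i) _
  (fun j => is_derive_sqr (is_derive_coord j x (unitv i))).
move=> H; refine (is_derive_eq H _).
rewrite (bigD1 i)//= unitvE eqxx mulr1 big1 ?addr0// => j ji.
by rewrite unitvE (negbTE ji) mulr0.
Qed.

Lemma sqn_coord x i : x ord0 i ^+ 2 <= sqn x.
Proof.
rewrite /sqn (bigD1 i)//= lerDl; apply: sumr_ge0 => j _; exact: sqr_ge0.
Qed.

End smooth_functions.

(** * Lebesgue integration on R^n *)

Section integration_on_rV.
Context {R : realType}.
Local Notation leb := (@lebesgue_measure R).
Local Notation "'lam' n" := (@lebesgue_rV R n) (at level 10, n at level 8).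

(** Open balls of the sup norm, written by coordinates so that they split as products along
    [rV_cons]. *)
Definition box n (c : 'rV[R]_n) (r : R) : set 'rV[R]_n :=
  [set x | forall i, `|c ord0 i - x ord0 i| < r].

Lemma measurable_box n (c : 'rV[R]_n) r : measurable (box c r).
Proof.
have -> : box c r = ~` \bigcup_(i in [set: 'I_n])
    (~` ((fun x : 'rV[R]_n => x ord0 i) @^-1` ball (c ord0 i) r)).
  rewrite setC_bigcup; apply/seteqP; split => x /=.
    by move=> bx i _; apply; exact: bx.
  by move=> h i; apply: contrapT => nb; exact: (h i Logic.I).
apply: measurableC; apply: fin_bigcup_measurable; first exact: finite_finset.
move=> i _; apply: measurableC; rewrite -[X in measurable X]setTI.
by apply: measurable_rV_coord => //; rewrite ball_itv; exact: measurable_itv.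
Qed.

Lemma rV_unconsK n (x : 'rV[R]_n.+1) : rV_cons (rV_uncons x) = x.
Proof.
apply/rowP => i; case: (unliftP ord0 i) => [j ->|->].
  by rewrite rV_consES /= mxE.
by rewrite rV_consE0.
Qed.

Lemma nbhs_box n (x : 'rV[R]_n) (A : set 'rV[R]_n) : nbhs x A ->
  exists2 r : R, 0 < r & box x r `<=` A.
Proof.
move=> /nbhs_ballP[r /= r0 rA]; exists r => // y yx; apply: rA.
split => // i j; rewrite !ord1; exact: yx.
Qed.

(** The sigma-algebra is generated by the coordinates, so an open set is written as the union of the
    boxes with rational centre and radius 1 / (k + 1) that it contains. *)
Lemma open_measurable_rV n (A : set 'rV[R]_n) : open A -> measurable A.
Proof.
move=> oA.
pose q (p : 'rV[rat]_n * nat) : set 'rV[R]_n :=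
  box (map_mx ratr p.1) (p.2.+1%:R^-1).
pose F k := if unpickle k is Some p then
  (if `[< q p `<=` A >] then q p else set0) else set0.
have -> : A = \bigcup_k F k.
  apply/seteqP; split => [x Ax|x [k _]]; last first.
    by rewrite /F; case: unpickle => // p; case: asboolP => // + qx; exact.
  have [r r0 rA] := nbhs_box (open_nbhs_nbhs (conj oA Ax)).
  have [k kr] : exists k : nat, k.+1%:R^-1 < r / 2.
    exists (Num.truncn (r / 2)^-1); rewrite -[ltRHS]invrK.
    by rewrite ltf_pV2 ?posrE ?invr_gt0 ?divr_gt0// truncnS_gt.
  have ex (i : 'I_n) : exists s : rat, `|ratr s - x ord0 i| < k.+1%:R^-1.
    have xk : x ord0 i - k.+1%:R^-1 < x ord0 i + k.+1%:R^-1.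
      by rewrite ltrBlDr -addrA ltrDl addr_gt0 ?invr_gt0.
    have [s] := rat_in_itvoo xk.
    by rewrite in_itv/= => /andP[s1 s2]; exists s; rewrite ltr_distl s1 s2.
  pose c := \row_i projT1 (cid (ex i)).
  exists (pickle (c, k)) => //; rewrite /F pickleK.
  have qx : q (c, k) x by move=> i /=; rewrite !mxE; case: cid.
  case: asboolP => // -[] y qy; apply: rA => i.
  have := qx i; have := qy i => /= h1 h2.
  rewrite (_ : _ - _ = (map_mx ratr c ord0 i - y ord0 i)
     - (map_mx ratr c ord0 i - x ord0 i)); last by ring.
  rewrite (le_lt_trans (ler_normB _ _))// (splitr r) ltrD//.
    exact: lt_trans h1 _.
  exact: lt_trans h2 _.
apply: bigcupT_measurable => k; rewrite /F; case: unpickle => // p.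
by case: asboolP => // _; exact: measurable_box.
Qed.

Lemma continuous_measurable_rV n (f : 'rV[R]_n -> R) : continuous f ->
  measurable_fun setT f.
Proof.
move=> cf; apply: (measurability _ (RGenOpens.measurableE R)) => //.
move=> _ [_ [a [b ->] <-]]; rewrite setTI; apply: open_measurable_rV.
by apply: open_comp => //; exact: interval_open.
Qed.

Lemma lebesgue_rVSE n (A : set 'rV[R]_n.+1) :
  lam n.+1 A = (leb \x lam n)%E (@rV_cons R n @^-1` A).
Proof. by []. Qed.

Lemma box_cons n (c : 'rV[R]_n.+1) r :
  @rV_cons R n @^-1` (box c r) = ball (c ord0 ord0) r `*` box (rV_uncons c).2 r.
Proof.
apply/seteqP; split => -[z x] /=.
  move=> h; split; first by have := h ord0; rewrite rV_consE0.
  by move=> i /=; have := h (lift ord0 i); rewrite rV_consES !mxE.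
move=> [h0 h] i; case: (unliftP ord0 i) => [j ->|->].
  by have := h j; rewrite rV_consES !mxE.
by rewrite rV_consE0; exact: h0.
Qed.

Lemma lebesgue_rV_box n (c : 'rV[R]_n) r : 0 <= r ->
  lam n (box c r) = ((r *+ 2) ^+ n)%:E.
Proof.
move=> r0; elim: n c => [|n IH] c.
  by rewrite expr0 /= diracE mem_set// => -[].
rewrite lebesgue_rVSE box_cons product_measure1E//; last 2 first.
  by rewrite ball_itv; exact: measurable_itv.
  exact: measurable_box.
by rewrite IH exprS EFinM; congr (_ * _)%E; exact: lebesgue_measure_ball.
Qed.

Lemma lebesgue_rV_box_lty n (c : 'rV[R]_n) r : 0 <= r ->
  (lam n (box c r) < +oo)%E.
Proof. by move=> r0; rewrite lebesgue_rV_box// ltry. Qed.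

Lemma open_lebesgue_rV_gt0 n (A : set 'rV[R]_n) x : open A -> A x ->
  (0 < lam n A)%E.
Proof.
move=> oA Ax; have [r r0 rA] := nbhs_box (open_nbhs_nbhs (conj oA Ax)).
apply: (@lt_le_trans _ _ (lam n (box x r))).
  by rewrite lebesgue_rV_box ?(ltW r0)// lte_fin exprn_gt0// mulrn_wgt0.
by apply: le_measure => //; rewrite inE;
  [exact: measurable_box|exact: open_measurable_rV].
Qed.

Lemma integrable_supp d (T : measurableType d) (mu : {measure set T -> \bar R})
    (A : set T) (f : T -> R) (M : R) : measurable A -> (mu A < +oo)%E ->
  measurable_fun setT f -> (forall x, `|f x| <= M) ->
  (forall x, f x != 0 -> A x) -> mu.-integrable setT (EFin \o f).
Proof.
move=> mA Aoo mf bf sf.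
have : mu.-integrable A (EFin \o f).
  apply: measurable_bounded_integrable => //; first exact: measurable_funTS.
  by exists M; split; rewrite ?num_real// => y My x _; exact: le_trans (bf x) (ltW My).
move/(integrable_mkcond _ mA); congr (_.-integrable _ _).
apply/funext => x; rewrite patchE; case: ifPn => // xA.
have [fx|/sf] := eqVneq (f x) 0; first by rewrite /= fx.
by move/mem_set; rewrite (negbTE xA).
Qed.

Definition cube n : set 'rV[R]_n := [set x | forall i, `|x ord0 i| <= 1].

(** Bounded measurable functions supported in the unit cube. The cube is a product, so the class is
    stable under slicing, and it carries all the integrability needed for Fubini. *)
Definition bms n (f : 'rV[R]_n -> R) :=
  [/\ measurable_fun setT f, exists M, forall x, `|f x| <= M &
      forall x, f x != 0 -> cube x].

Lemma bms_integrable n f : bms f -> (lam n).-integrable setT (EFin \o f).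
Proof.
move=> [mf [M fM] fc]; apply: (@integrable_supp _ _ _ (box 0 2) _ M) => //.
- exact: measurable_box.
- exact: lebesgue_rV_box_lty.
- move=> x /fc xc i; rewrite mxE sub0r normrN (le_lt_trans (xc i))//.
  by rewrite ltr1n.
Qed.

Lemma measurable_slice n (f : 'rV[R]_n.+1 -> R) : measurable_fun setT f ->
  measurable_fun setT (f \o @rV_cons R n).
Proof. by move=> mf; apply: measurableT_comp => //; exact: measurable_rV_cons. Qed.

Lemma cube_cons n z (x : 'rV[R]_n) : cube (rV_cons (z, x)) -> `|z| <= 1 /\ cube x.
Proof.
move=> h; split; first by have := h ord0; rewrite rV_consE0.
by move=> i; have := h (lift ord0 i); rewrite rV_consES.
Qed.

Lemma bms_slice1 n f (z : R) : bms f -> bms (fun x : 'rV[R]_n => f (rV_cons (z, x))).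
Proof.
move=> [mf [M fM] fc]; split; last 2 first.
- by exists M => x; exact: fM.
- by move=> x /fc /cube_cons[].
- apply: (@measurableT_comp _ _ _ _ _ _ (f \o @rV_cons R n)); last first.
    exact: pair1_measurable.
  exact: measurable_slice.
Qed.

Definition bms1 (f : R -> R) :=
  [/\ measurable_fun setT f, exists M, forall x, `|f x| <= M &
      forall x, f x != 0 -> `|x| <= 1].

Lemma bms1_integrable f : bms1 f -> leb.-integrable setT (EFin \o f).
Proof.
move=> [mf [M fM] fc]; refine (@integrable_supp _ _ leb `[-1, 1]%classic f M _ _ mf fM _) => //.
- by rewrite /= lebesgue_measure_itv/=; case: ifP => // _; rewrite -EFinB ltry.
- by move=> x /fc; rewrite /= in_itv/= ler_norml.
Qed.

Lemma bms_slice2 n f (x : 'rV[R]_n) : bms f -> bms1 (fun z => f (rV_cons (z, x))).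
Proof.
move=> [mf [M fM] fc]; split; last 2 first.
- by exists M => z; exact: fM.
- by move=> z /fc /cube_cons[].
- apply: (@measurableT_comp _ _ _ _ _ _ (f \o @rV_cons R n)); last first.
    exact: pair2_measurable.
  exact: measurable_slice.
Qed.

Lemma bms_prod_integrable n f : bms f ->
  (leb \x lam n)%E.-integrable setT (EFin \o (f \o @rV_cons R n)).
Proof.
move=> [mf [M fM] fc].
refine (@integrable_supp _ _ (leb \x lam n)%E (`[-1, 1]%classic `*` box 0 2) (f \o @rV_cons R n) M _ _ _ _ _).
- by apply: measurableX => //; exact: measurable_box.
- pose I : set (measurableTypeR R) := `[-1, 1]%classic.
  have mI : measurable I by exact: measurable_itv.
  have E := product_measure1E leb (lam n) mI (measurable_box 0 2).
  suff : (leb I * lam n (box 0 2) < +oo)%E by move=> H; rewrite -E in H.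
  apply: lte_mul_pinfty => //; last exact: lebesgue_rV_box_lty.
  by rewrite ge0_fin_numE// /= lebesgue_measure_itv/=; case: ifP => // _; rewrite -EFinB ltry.
- exact: measurable_slice.
- by move=> x; exact: fM.
- move=> [z x] /fc /cube_cons[z1 x1]; split; first by rewrite /= in_itv/= -ler_norml.
  by move=> i; rewrite mxE sub0r normrN (le_lt_trans (x1 i))// ltr1n.
Qed.

Lemma Rintegral_rVS n f : bms f ->
  (\int[lam n.+1]_x (f x)%:E =
   \int[(leb \x lam n)%E]_p (f (rV_cons p))%:E)%E.
Proof.
move=> bf; have [mf _ _] := bf.
transitivity (\int[pushforward (leb \x lam n)%E (@rV_cons R n)]_x (f x)%:E)%E.
  by [].
rewrite integral_pushforward//.
- exact: measurable_rV_cons.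
- exact/measurable_EFinP.
- by rewrite preimage_setT; exact: bms_prod_integrable.
Qed.

Lemma fubini_zx n f : bms f ->
  \int[lam n.+1]_x f x = \int[leb]_z \int[lam n]_x f (rV_cons (z, x)).
Proof.
move=> bf; rewrite /Rintegral Rintegral_rVS//.
rewrite -(integral12_prod_meas1 (bms_prod_integrable bf)); congr fine.
apply: eq_integral => z _; rewrite fineK//; apply: integrable_fin_num => //.
by have := bms_integrable (bms_slice1 z bf).
Qed.

Lemma fubini_xz n f : bms f ->
  \int[lam n.+1]_x f x = \int[lam n]_x \int[leb]_z f (rV_cons (z, x)).
Proof.
move=> bf; rewrite /Rintegral Rintegral_rVS//.
rewrite -(integral21_prod_meas1 (bms_prod_integrable bf)); congr fine.
apply: eq_integral => x _; rewrite fineK//; apply: integrable_fin_num => //.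
by have := bms1_integrable (bms_slice2 x bf).
Qed.

End integration_on_rV.

(** * Integration by parts above a graph *)

Section integration_by_parts_rV.
Context {R : realType}.
Local Notation leb := (@lebesgue_measure R).
Local Notation "'lam' n" := (@lebesgue_rV R n) (at level 10, n at level 8).

Lemma cvg_rV (T : Type) (F : set_system T) {FF : Filter F} n (f : T -> 'rV[R]_n)
    (l : 'rV[R]_n) :
  (forall i, f x ord0 i @[x --> F] --> l ord0 i) -> f x @[x --> F] --> l.
Proof.
move=> fl; apply/cvg_ballP => e e0.
have : \forall x \near F, forall i, ball (l ord0 i) e (f x ord0 i).
  by apply: filter_forall => i; move/cvg_ballP : (fl i); exact.
by apply: filterS => x h; split => // i j; rewrite !ord1.
Qed.

Lemma continuous_rV_cons1 n (z : R) : continuous (fun x : 'rV[R]_n => rV_cons (z, x)).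
Proof.
move=> x; apply: (@cvg_rV _ (nbhs x) _ n.+1 _ (rV_cons (z, x))) => i.
case: (unliftP ord0 i) => [j ->|->].
  have E : (fun y : 'rV[R]_n => rV_cons (z, y) ord0 (lift ord0 j)) = (fun y => y ord0 j).
    by apply/funext => y; rewrite rV_consES.
  by rewrite E rV_consES; exact: (@continuous_coord R n j x).
have E : (fun y : 'rV[R]_n => rV_cons (z, y) ord0 ord0) = cst z.
  by apply/funext => y; rewrite rV_consE0.
by rewrite E rV_consE0; exact: cvg_cst.
Qed.

Lemma continuous_rV_cons2 n (x : 'rV[R]_n) : continuous (fun z : R => rV_cons (z, x)).
Proof.
move=> z; apply: (@cvg_rV _ (nbhs z) _ n.+1 _ (rV_cons (z, x))) => i.
case: (unliftP ord0 i) => [j ->|->].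
  have E : (fun t : R => rV_cons (t, x) ord0 (lift ord0 j)) = cst (x ord0 j).
    by apply/funext => y; rewrite rV_consES.
  by rewrite E rV_consES; exact: cvg_cst.
have E : (fun t : R => rV_cons (t, x) ord0 ord0) = id.
  by apply/funext => y; rewrite rV_consE0.
by rewrite E rV_consE0; exact: cvg_id.
Qed.

Definition tl n (x : 'rV[R]_n.+1) : 'rV[R]_n := (rV_uncons x).2.

Lemma tlE n (x : 'rV[R]_n.+1) j : tl x ord0 j = x ord0 (lift ord0 j).
Proof. by rewrite /tl /= mxE. Qed.

Lemma tl_cons n z (x : 'rV[R]_n) : tl (rV_cons (z, x)) = x.
Proof. by apply/rowP => j; rewrite tlE rV_consES. Qed.

Lemma continuous_tl n : continuous (@tl n).
Proof.
move=> x; apply: (@cvg_rV _ (nbhs x) _ n (@tl n) (tl x)) => i.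
have E : (fun y : 'rV[R]_n.+1 => tl y ord0 i) = (fun y => y ord0 (lift ord0 i)).
  by apply/funext => y; rewrite tlE.
by rewrite E tlE; exact: (@continuous_coord R n.+1 (lift ord0 i) x).
Qed.

Lemma continuous_slice1 n (f : 'rV[R]_n.+1 -> R) z : continuous f ->
  continuous (fun x => f (rV_cons (z, x))).
Proof.
move=> cf x; apply: (@continuous_comp _ _ _ (fun y => rV_cons (z, y)) f); last exact: cf.
exact: continuous_rV_cons1.
Qed.

Lemma continuous_slice2 n (f : 'rV[R]_n.+1 -> R) x : continuous f ->
  continuous (fun z => f (rV_cons (z, x))).
Proof.
move=> cf z; apply: (@continuous_comp _ _ _ (fun y => rV_cons (y, x)) f); last exact: cf.
exact: continuous_rV_cons2.
Qed.

Lemma rV_cons_line n (t z : R) (x v : 'rV[R]_n) (w : R) :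
  rV_cons (t * w + z, t *: v + x) = t *: rV_cons (w, v) + rV_cons (z, x).
Proof.
by apply/rowP => i; rewrite !mxE; case: (unlift ord0 i) => [j|] //=; rewrite !mxE.
Qed.

Lemma unitv0E n : @unitv R n.+1 ord0 = rV_cons (1, 0).
Proof.
apply/rowP => i; rewrite unitvE; case: (unliftP ord0 i) => [j ->|->].
  by rewrite rV_consES /= mxE.
by rewrite rV_consE0.
Qed.

Lemma unitvSE n (j : 'I_n) : @unitv R n.+1 (lift ord0 j) = rV_cons (0, unitv j).
Proof.
apply/rowP => i; rewrite unitvE; case: (unliftP ord0 i) => [k ->|->].
  by rewrite rV_consES /= unitvE (inj_eq lift_inj).
by rewrite rV_consE0.
Qed.

Lemma tl_line n (t : R) (v x : 'rV[R]_n.+1) : tl (t *: v + x) = t *: tl v + tl x.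
Proof. by apply/rowP => i; rewrite /tl /= !mxE. Qed.

Lemma is_derive_tl n (g : 'rV[R]_n -> R) (x v : 'rV[R]_n.+1) dg :
  is_derive (tl x) (tl v) g dg -> is_derive x v (fun y => g (tl y)) dg.
Proof.
move=> /is_derive_lineE h; apply/is_derive_lineE.
by under eq_fun do rewrite tl_line.
Qed.

Lemma tl_unitv0 n : tl (@unitv R n.+1 ord0) = 0.
Proof. by rewrite unitv0E tl_cons. Qed.

Lemma tl_unitvS n (j : 'I_n) : tl (@unitv R n.+1 (lift ord0 j)) = unitv j.
Proof. by rewrite unitvSE tl_cons. Qed.

Lemma is_derive_tl0 n (g : 'rV[R]_n -> R) (x : 'rV[R]_n.+1) :
  is_derive x (unitv ord0) (fun y => g (tl y)) 0.
Proof. by apply: is_derive_tl; rewrite tl_unitv0; exact: is_derive0. Qed.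

Lemma is_derive_slice2 n (f : 'rV[R]_n.+1 -> R) z x df :
  is_derive (rV_cons (z, x)) (unitv ord0) f df ->
  is_derive z 1 (fun t => f (rV_cons (t, x))) df.
Proof.
move=> /is_derive_lineE h.
have h1 : is_derive z 1 (fun t : R => t - z) 1.
  have := @is_deriveB _ _ _ id (cst z) z 1 _ _ (is_derive_id _ _) (is_derive_cst _ _ _).
  by move=> H; refine (is_derive_eq H _); rewrite subr0.
have h2 : is_derive (z - z) 1 (fun t : R => f (t *: unitv ord0 + rV_cons (z, x))) df.
  by rewrite subrr.
have := @is_derive1_comp _ (fun t : R => f (t *: unitv ord0 + rV_cons (z, x)))
  (fun t : R => t - z) _ _ _ h2 h1.
rewrite mulr1; congr is_derive; apply/funext => t /=.
by rewrite unitv0E -rV_cons_line mulr1 subrK scaler0 add0r.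
Qed.

Lemma is_derive_slice1 n (f : 'rV[R]_n.+1 -> R) z x j df :
  is_derive (rV_cons (z, x)) (unitv (lift ord0 j)) f df ->
  is_derive x (unitv j) (fun y => f (rV_cons (z, y))) df.
Proof.
move=> /is_derive_lineE h; apply/is_derive_lineE.
move: h; congr is_derive; apply/funext => t.
by rewrite unitvSE -rV_cons_line mulr0 add0r.
Qed.

(** The Heaviside function with value [0] at [0], which makes it the pointwise limit of [damped 0 e]
    as [e] tends to [0]. *)
Definition hv (t : R) : R := if 0 < t then 1 else 0.

Lemma hv_ge0 t : 0 <= hv t. Proof. by rewrite /hv; case: ifP. Qed.
Lemma hv_le1 t : hv t <= 1. Proof. by rewrite /hv; case: ifP. Qed.

Lemma measurable_hv : measurable_fun setT hv.
Proof.
apply: nondecreasing_measurable => // x y xy; rewrite /hv.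
by case: ltP => x0; case: ltP => y0 //; have := lt_le_trans x0 (le_trans xy y0); rewrite ltxx.
Qed.

(** The fundamental theorem of calculus on []g, 2]]: the supports lie in [[-1, 1]], so [2] stands
    for infinity. When [2 <= g] both sides vanish. *)
Lemma Rintegral_hv (f df : R -> R) (g : R) :
  (forall t : R, is_derive t 1 f (df t)) -> continuous df ->
  (forall t, f t != 0 -> `|t| <= 1) -> (forall t, df t != 0 -> `|t| <= 1) ->
  \int[leb]_z (df z * hv (z - g)) = - f g.
Proof.
move=> fd cdf f0 df0.
have [g2|g2] := leP 2 g.
  have -> : f g = 0.
    apply: contrapT => /eqP /f0; rewrite ler_norml => /andP[_ g1].
    by have := le_trans g2 g1; lra.
  rewrite oppr0 (@eq_Rintegral _ _ _ _ setT (cst 0)) ?Rintegral_cst ?mul0r// => z _ /=.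
  rewrite /hv; case: ifPn; last by rewrite mulr0.
  rewrite mulr1 subr_gt0 => gz; apply: contrapT => /eqP /df0.
  rewrite ler_norml => /andP[_ z1]; have := le_lt_trans g2 gz; lra.
have -> : \int[leb]_z (df z * hv (z - g)) = \int[leb]_(z in `]g, 2]) df z.
  rewrite [RHS]Rintegral_mkcond; apply: eq_Rintegral => z _.
  rewrite patchE /hv; case: ifPn => zg; case: ifPn; rewrite ?mulr1 ?mulr0//.
    move/negP => zi; apply: contrapT => /eqP /df0; rewrite ler_norml => /andP[_ z1].
    by apply: zi; rewrite inE/= in_itv/= -subr_gt0 zg/=; lra.
  by rewrite inE/= in_itv/= -subr_gt0 (negbTE zg).
have cab : {within `[g, 2], continuous df} by exact: continuous_subspaceT.
rewrite Rintegral_itv_obnd_cbnd; last first.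
  apply: (@integrableS _ _ _ leb `[g, 2]%classic) => //.
    by apply: subset_itvr; rewrite bnd_simp.
  exact: continuous_compact_integrable (@segment_compact _ _ _) cab.
rewrite /Rintegral (@continuous_FTC2 _ df f)//.
  rewrite -EFinB/= (_ : f 2 = 0) ?sub0r//.
  by apply: contrapT => /eqP /f0; rewrite ger0_norm// => ?; lra.
split.
- by move=> z _; have [] := fd z.
- by apply: cvg_at_right_filter; exact: derivable_continuous (fd _).
- by apply: cvg_at_left_filter; exact: derivable_continuous (fd _).
- by move=> z _; rewrite derive1E; exact: derive_val.
Qed.

Lemma Rintegral_partial n (f df : 'rV[R]_n -> R) i :
  (forall x, is_derive x (unitv i) f (df x)) -> continuous df ->
  bms df -> (forall x, f x != 0 -> cube x) -> \int[lam n]_x df x = 0.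
Proof.
elim: n f df i => [|n IH] f df i fd cdf bdf fc; first by case: i fd.
have [_ _ dfc] := bdf.
case: (unliftP ord0 i) => [j ij|i0]; subst i.
  rewrite fubini_zx//.
  rewrite (@eq_Rintegral _ _ _ _ setT (cst 0)) ?Rintegral_cst ?mul0r// => z _ /=.
  apply: (IH (fun x => f (rV_cons (z, x))) _ j).
  - by move=> x; apply: is_derive_slice1; exact: fd.
  - exact: continuous_slice1.
  - exact: bms_slice1.
  - by move=> x /fc /cube_cons[].
rewrite fubini_xz//.
rewrite (@eq_Rintegral _ _ _ _ setT (cst 0)) ?Rintegral_cst ?mul0r// => x _ /=.
(* The Heaviside factor with threshold [- 2] equals [1] on the support. *)
transitivity (\int[leb]_z (df (rV_cons (z, x)) * hv (z - - 2))).
  apply: eq_Rintegral => z _; rewrite /hv; case: ifPn; first by rewrite mulr1.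
  rewrite mulr0 -leNgt => z2; apply: contrapT => /eqP /dfc /cube_cons[+ _].
  rewrite ler_norml => /andP[z1 _]; lra.
have fd' (z : R) : is_derive z 1 (fun z => f (rV_cons (z, x))) (df (rV_cons (z, x))).
  by apply: is_derive_slice2; exact: fd.
rewrite (@Rintegral_hv _ (fun z => df (rV_cons (z, x))) (- 2) fd').
- rewrite (_ : f (rV_cons (- 2, x)) = 0) ?oppr0//.
  apply: contrapT => /eqP /fc /cube_cons[+ _].
  by rewrite normrN ger0_norm// => ?; lra.
- exact: continuous_slice2.
- by move=> z /fc /cube_cons[].
- by move=> z /dfc /cube_cons[].
Qed.

Lemma Rintegral_dct d (T : measurableType d) (mu : {measure set T -> \bar R})
    (D : set T) (mD : measurable D) (u : (T -> R)^nat) (f : T -> R) (g : T -> R) :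
  (forall k, measurable_fun D (u k)) -> measurable_fun D f ->
  (forall x, D x -> u k x @[k --> \oo] --> f x) ->
  mu.-integrable D (EFin \o g) -> (forall k x, D x -> `|u k x| <= g x) ->
  \int[mu]_(x in D) u k x @[k --> \oo] --> \int[mu]_(x in D) f x.
Proof.
move=> mu_ mf uf ig ug.
have [|||||int_f _ h] := @dominated_convergence _ _ _ mu D mD
  (fun k => EFin \o u k) (EFin \o f) (EFin \o g).
- by move=> k; apply/measurable_EFinP.
- exact/measurable_EFinP.
- by apply: aeW => x Dx; apply: cvg_EFin; [exact: nearW|exact: uf].
- by [].
- by apply: aeW => x k Dx; rewrite lee_fin ug.
apply: (@fine_cvg _ _ _ _ (fun k => \int[mu]_(x in D) (u k x)%:E)%E).
by rewrite fineK//; exact: integrable_fin_num.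
Qed.

Lemma cvg_damped0 (T : Type) (F : set_system T) {FF : Filter F} (e : T -> R) t :
  e x @[x --> F] --> 0 -> damped 0 (e x) t @[x --> F] --> hv t.
Proof.
move=> e0; rewrite /damped /hv; case: ifPn => t0; last exact: cvg_cst.
rewrite -[X in _ --> X](_ : t `^ 0 * expR (- (0 / t)) = 1); last first.
  by rewrite powRr0 mul0r oppr0 expR0 mulr1.
apply: cvgM; first exact: cvg_cst.
apply: continuous_cvg; first exact: continuous_expR.
by apply: cvgN; apply: cvgM => //; exact: cvg_cst.
Qed.

Lemma damped0_le1 (e t : R) : 0 <= e -> damped 0 e t <= 1.
Proof.
move=> e0; rewrite /damped; case: ifPn => // t0.
by rewrite powRr0 mul1r expRN_le1// divr_ge0// ltW.
Qed.

Lemma compact_cube n : compact (@cube R n).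
Proof.
have -> : @cube R n = [set v | forall i, `[-1, 1]%classic (v ord0 i)].
  by apply/seteqP; split => x h i; have := h i; rewrite /= in_itv/= ler_norml.
apply: (@rV_compact R n (fun=> `[-1, 1]%classic)) => i; exact: segment_compact.
Qed.

Lemma continuous_bounded_compact n (A : set 'rV[R]_n) (w : 'rV[R]_n -> R) : compact A ->
  continuous w -> exists M, forall x, A x -> `|w x| <= M.
Proof.
move=> cA cw; have [->|A0] := eqVneq A set0; first by exists 0.
have cw' : {within A, continuous (fun x => `|w x|)}.
  apply: continuous_subspaceT => x.
  by apply: (@continuous_comp _ _ _ w Num.norm); [exact: cw|exact: norm_continuous].
have [c _ h] := @compact_EVT_max _ R (fun x => `|w x|) A (((set0P _).1 A0)) cA cw'.
by exists `|w c| => x Ax; apply: h; rewrite inE.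
Qed.

Lemma bmsM n (f h : 'rV[R]_n -> R) : bms f -> measurable_fun setT h ->
  (exists M, forall x, cube x -> `|h x| <= M) -> bms (fun x => f x * h x).
Proof.
move=> [mf [M fM] fc] mh [K hK]; split; first exact: measurable_funM.
- exists (`|M| * `|K|) => x; rewrite normrM.
  have [->|fx] := eqVneq (f x) 0; first by rewrite normr0 mul0r mulr_ge0.
  rewrite ler_pM// ?(le_trans (fM _))// ?(le_trans (hK _ (fc _ fx)))// ler_norm//.
- by move=> x; rewrite mulf_eq0 negb_or => /andP[/fc].
Qed.

Lemma bmsMc n (f h : 'rV[R]_n -> R) : bms f -> continuous h -> bms (fun x => f x * h x).
Proof.
move=> bf ch; apply: bmsM => //; first exact: continuous_measurable_rV.
exact: continuous_bounded_compact (@compact_cube n) ch.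
Qed.

Lemma bmsD n (f h : 'rV[R]_n -> R) : bms f -> bms h -> bms (fun x => f x + h x).
Proof.
move=> [mf [M fM] fc] [mh [K hK] hc]; split; first exact: measurable_funD.
- by exists (M + K) => x; rewrite (le_trans (ler_normD _ _))// lerD.
- move=> x fhx; have [f0|/fc//] := eqVneq (f x) 0.
  by apply: hc; move: fhx; rewrite f0 add0r.
Qed.

Lemma bms_RintegralD n (f h : 'rV[R]_n -> R) : bms f -> bms h ->
  \int[lam n]_x (f x + h x) = \int[lam n]_x f x + \int[lam n]_x h x.
Proof.
move=> bf bh; apply: RintegralD => //; exact: bms_integrable.
Qed.

Lemma bms_RintegralZ n (f : 'rV[R]_n -> R) (c : R) : bms f ->
  \int[lam n]_x (c * f x) = c * \int[lam n]_x f x.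
Proof. by move=> bf; apply: RintegralZl => //; exact: bms_integrable. Qed.

Section sheet.
Variables (n : nat) (f : 'rV[R]_n.+1 -> R) (df : 'I_n.+1 -> 'rV[R]_n.+1 -> R).
Hypotheses (fd : forall i x, is_derive x (unitv i) f (df i x))
  (cf : continuous f) (cdf : forall i, continuous (df i))
  (bf : bms f) (bdf : forall i, bms (df i)).
Variables (g : 'rV[R]_n -> R) (dg : 'I_n -> 'rV[R]_n -> R).
Hypotheses (gd : forall j x, is_derive x (unitv j) g (dg j x))
  (cg : continuous g) (cdg : forall j, continuous (dg j)).

Let c0 : continuous (fun x : 'rV[R]_n.+1 => x ord0 ord0).
Proof. exact: continuous_coord. Qed.

Let ctl (w : 'rV[R]_n -> R) : continuous w -> continuous (fun x : 'rV[R]_n.+1 => w (tl x)).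
Proof.
by move=> cw x; apply: (@continuous_comp _ _ _ (@tl n) w); [exact: continuous_tl|exact: cw].
Qed.

Let cheight : continuous (fun x : 'rV[R]_n.+1 => x ord0 ord0 - g (tl x)).
Proof. by apply: contB => //; exact: ctl. Qed.

Let bms_hv w : bms w -> bms (fun x : 'rV[R]_n.+1 => w x * hv (x ord0 ord0 - g (tl x))).
Proof.
move=> bw; apply: bmsM => //.
  apply: measurableT_comp; first exact: measurable_hv.
  exact: continuous_measurable_rV.
by exists 1 => x _; rewrite ger0_norm ?hv_ge0// hv_le1.
Qed.

(** [Rintegral_hv] on each vertical line. The factor [w] is there for [w = dg j], through which the
    vertical derivative enters the horizontal formula. *)
Lemma Rintegral_sheet0 (w : 'rV[R]_n -> R) : continuous w ->
  \int[lam n.+1]_x (df ord0 x * hv (x ord0 ord0 - g (tl x)) * w (tl x)) =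
  - \int[lam n]_x (f (rV_cons (g x, x)) * w x).
Proof.
move=> cw; rewrite fubini_xz; last by apply: bmsMc; [exact: bms_hv|exact: ctl].
have bz : bms (fun x : 'rV[R]_n => f (rV_cons (g x, x)) * w x).
  have [_ [M fM] fc] := bf; apply: bmsMc => //; split.
  - apply: continuous_measurable_rV => x.
    apply: (@continuous_comp _ _ _ (fun x => rV_cons (g x, x)) f); last exact: cf.
    apply: (@cvg_rV _ (nbhs x) _ n.+1 _ (rV_cons (g x, x))) => i.
    case: (unliftP ord0 i) => [j ->|->].
      have E : (fun y : 'rV[R]_n => rV_cons (g y, y) ord0 (lift ord0 j)) = (fun y => y ord0 j).
        by apply/funext => y; rewrite rV_consES.
      by rewrite E rV_consES; exact: (@continuous_coord R n j x).
    have E : (fun y : 'rV[R]_n => rV_cons (g y, y) ord0 ord0) = g.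
      by apply/funext => y; rewrite rV_consE0.
    by rewrite E rV_consE0; exact: cg.
  - by exists M.
  - by move=> x /fc /cube_cons[].
rewrite -mulN1r -bms_RintegralZ//; apply: eq_Rintegral => x _.
under eq_Rintegral do rewrite rV_consE0 tl_cons.
have fd' (z : R) : is_derive z 1 (fun z => f (rV_cons (z, x))) (df ord0 (rV_cons (z, x))).
  by apply: is_derive_slice2; exact: fd.
have [_ _ dfc] := bdf ord0; have [_ _ fc] := bf.
rewrite RintegralZr//; last first.
  have := bms1_integrable (bms_slice2 x (bms_hv (bdf ord0))).
  by congr (_.-integrable _ _); apply/funext => z /=; rewrite rV_consE0 tl_cons.
rewrite (@Rintegral_hv _ (fun z => df ord0 (rV_cons (z, x))) (g x) fd') ?mulN1r ?mulNr//.
- exact: continuous_slice2.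
- by move=> z /fc /cube_cons[].
- by move=> z /dfc /cube_cons[].
Qed.

(* Integrate by parts against the smooth approximations [damped 0 e] of the
   indicator function of [0 < t], in the directions [j] and [0]; the boundary
   terms cancel. *)
Lemma Rintegral_sheetS j :
  \int[lam n.+1]_x (df (lift ord0 j) x * hv (x ord0 ord0 - g (tl x))) =
  \int[lam n]_x (f (rV_cons (g x, x)) * dg j x).
Proof.
pose b i := fun x : 'rV[R]_n.+1 => if i == 0%N then df (lift ord0 j) x
   else df ord0 x * dg j (tl x).
pose s := fun x : 'rV[R]_n.+1 => df (lift ord0 j) x + df ord0 x * dg j (tl x).
have bs : bms s by apply: bmsD => //; apply: bmsMc => //; exact: ctl.
(* [s] is the divergence of [f] times the field with components [1] in direction [j] and [dg j] in
   direction [0]. This field is tangent to all vertical translates of the graph, so nothing flows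
   through the graph. *)
suff S : \int[lam n.+1]_x (s x * hv (x ord0 ord0 - g (tl x))) = 0.
  have E : \int[lam n.+1]_x (s x * hv (x ord0 ord0 - g (tl x))) =
    \int[lam n.+1]_x (df (lift ord0 j) x * hv (x ord0 ord0 - g (tl x))) +
    \int[lam n.+1]_x (df ord0 x * hv (x ord0 ord0 - g (tl x)) * dg j (tl x)).
    rewrite -bms_RintegralD; last 2 first.
      exact: bms_hv.
      by apply: bmsMc; [exact: bms_hv|exact: ctl].
    by apply: eq_Rintegral => x _; rewrite /s; ring.
  by move: S; rewrite E Rintegral_sheet0// => /eqP; rewrite subr_eq0 => /eqP.
pose e k : R := k.+1%:R^-1.
have e_gt0 k : 0 < e k by rewrite invr_gt0.
have e0 : e k @[k --> \oo] --> 0 by exact: cvg_harmonic.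
pose H k (x : 'rV[R]_n.+1) := damped 0 (e k) (x ord0 ord0 - g (tl x)).
have cdamp q k : continuous (fun x : 'rV[R]_n.+1 => damped q (e k) (x ord0 ord0 - g (tl x))).
  move=> x; apply: (@continuous_comp _ _ _ (fun x : 'rV[R]_n.+1 => x ord0 ord0 - g (tl x))).
    exact: cheight.
  exact: derivable_continuous (is_derive_damped _ _ (e_gt0 k)).
have cH k : continuous (H k) by exact: cdamp.
suff Sk k : \int[lam n.+1]_x (s x * H k x) = 0.
  have L : (fun k => \int[lam n.+1]_x (s x * H k x)) @ \oo -->
      \int[lam n.+1]_x (s x * hv (x ord0 ord0 - g (tl x))); last first.
    have E : (fun k => \int[lam n.+1]_x (s x * H k x)) = cst 0 by exact/funext.
    rewrite E in L; exact: (cvg_unique _ L (cvg_cst 0)).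
  apply: (@Rintegral_dct _ _ (lam n.+1) setT measurableT _ _ (fun x => `|s x|)).
  - by move=> k; have [] : bms (fun x => s x * H k x) by exact: bmsMc.
  - by have [] := bms_hv bs.
  - by move=> x _; apply: cvgM; [exact: cvg_cst|exact: cvg_damped0].
  - exact: integrable_norm (bms_integrable bs).
  - move=> k x _; rewrite normrM ler_piMr// ger0_norm ?damped_ge0//.
    by rewrite damped0_le1// ltW.
pose H' (x : 'rV[R]_n.+1) := e k * damped (- 2) (e k) (x ord0 ord0 - g (tl x)).
have cH' : continuous H'.
  by apply: contM; [exact: contC|exact: cdamp].
have dH x i v : is_derive x (unitv i) (fun x : 'rV[R]_n.+1 => x ord0 ord0 - g (tl x)) v ->
    is_derive x (unitv i) (H k) (H' x * v).
  move=> dv; have := is_derive_comp1 dv (is_derive_damped 0 (x ord0 ord0 - g (tl x)) (e_gt0 k)).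
  by rewrite mul0r add0r sub0r.
have b1 : bms (fun x => f x * (- (H' x * dg j (tl x))) + H k x * df (lift ord0 j) x).
  apply: bmsD.
    by apply: bmsMc => //; apply: contN; apply: contM => //; exact: ctl.
  rewrite (_ : (fun x => H k x * _) = fun x => df (lift ord0 j) x * H k x).
    exact: bmsMc.
  by apply/funext => x; rewrite mulrC.
have I1 : \int[lam n.+1]_x (f x * (- (H' x * dg j (tl x))) + H k x * df (lift ord0 j) x) = 0.
  apply: (@Rintegral_partial _ (fun x => f x * H k x) _ (lift ord0 j)) => //.
  - move=> x; have h1 : is_derive x (unitv (lift ord0 j)) (fun x : 'rV[R]_n.+1 => x ord0 ord0) 0.
      by have := is_derive_coord ord0 x (unitv (lift ord0 j)); rewrite unitvE.
    have h2 : is_derive x (unitv (lift ord0 j)) (fun x : 'rV[R]_n.+1 => g (tl x)) (dg j (tl x)).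
      by apply: is_derive_tl; rewrite tl_unitvS; exact: gd.
    have := is_deriveM_fun (fd (lift ord0 j) x) (dH _ _ _ (is_deriveB_fun h1 h2)).
    by rewrite sub0r mulrN.
  - apply: contD; apply: contM => //.
    by apply: contN; apply: contM => //; exact: ctl.
  - by move=> x; rewrite mulf_eq0 negb_or => /andP[+ _]; have [_ _] := bf; exact.
have b2 : bms (fun x => f x * dg j (tl x) * (H' x * 1) + H k x * (df ord0 x * dg j (tl x))).
  apply: bmsD.
    apply: bmsMc; first by apply: bmsMc => //; exact: ctl.
    by apply: contM => //; exact: contC.
  rewrite (_ : (fun x => H k x * _) = fun x => df ord0 x * (dg j (tl x) * H k x)).
    by apply: bmsMc => //; apply: contM => //; exact: ctl.
  by apply/funext => x; ring.
have I2 : \int[lam n.+1]_x (f x * dg j (tl x) * (H' x * 1) + H k x * (df ord0 x * dg j (tl x))) = 0.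
  apply: (@Rintegral_partial _ (fun x => f x * dg j (tl x) * H k x) _ ord0) => //.
  - move=> x; have h1 : is_derive x (unitv ord0) (fun x : 'rV[R]_n.+1 => x ord0 ord0) 1.
      by have := is_derive_coord ord0 x (unitv ord0); rewrite unitvE eqxx.
    have h2 := is_deriveM_fun (fd ord0 x) (is_derive_tl0 (dg j) x).
    have := is_deriveM_fun h2 (dH _ _ _ (is_deriveB_fun h1 (is_derive_tl0 g x))).
    by rewrite subr0 mulr0 add0r (mulrC (dg j _)).
  - apply: contD; apply: contM => //; apply: contM => //; try exact: ctl.
    exact: contC.
  - move=> x; rewrite !mulf_eq0 !negb_or => /andP[/andP[+ _] _].
    by have [_ _] := bf; exact.
have := congr2 +%R I1 I2.
rewrite addr0 -bms_RintegralD// => <-.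
by apply: eq_Rintegral => x _; rewrite /s; ring.
Qed.

End sheet.
End integration_by_parts_rV.

(** * Layered functions *)

Section layered_function.
Context {R : realType} {m : nat}.
Local Notation leb := (@lebesgue_measure R).
Local Notation "'lam' n" := (@lebesgue_rV R n) (at level 10, n at level 8).
Variables (T : R) (G : 'rV[R]_m.+1 -> R) (dG : 'I_m -> 'rV[R]_m.+1 -> R).
Hypotheses (T1 : T <= 1)
  (mG : measurable_fun setT G) (mdG : forall j, measurable_fun setT (dG j))
  (Gd : forall l j x, is_derive x (unitv j) (fun y => G (rV_cons (l, y)))
     (dG j (rV_cons (l, x))))
  (cG : forall l, continuous (fun y => G (rV_cons (l, y))))
  (cdG : forall l j, continuous (fun y => dG j (rV_cons (l, y))))
  (bdG : forall j, exists M, forall p, cube p -> `|dG j p| <= M).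

(* A point [p] of R^(m+1) stands for the pair of the level [p ord0 ord0] and
   the base point [tl p] on the corresponding sheet. *)
Definition sheet_point (p : 'rV[R]_m.+1) : 'rV[R]_m.+1 := rV_cons (G p, tl p).

(** The upward normal (1, - grad G), not normalized: its length is the area factor of the graph. *)
Definition sheet_normal (i : 'I_m.+1) (p : 'rV[R]_m.+1) : R :=
  if unlift ord0 i is Some j then - dG j p else 1.

Definition level_domain : set 'rV[R]_m.+1 := [set p | cube p /\ 0 <= p ord0 ord0 <= T].

(** Density of a vector measure in the coordinates (level, base point); its image under
    [sheet_point] is the gradient of [layered]. *)
Definition sheet_density (i : 'I_m.+1) (p : 'rV[R]_m.+1) : R :=
  \1_level_domain p * sheet_normal i p.

(** The length of the set of levels whose sheet passes strictly below [x]. *)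
Definition layered (x : 'rV[R]_m.+1) : R :=
  \int[leb]_l (\1_`[0, T] l * hv (x ord0 ord0 - G (rV_cons (l, tl x)))).

Lemma measurable_cube n : measurable (@cube R n).
Proof.
rewrite -[X in measurable X]setCK; apply: measurableC; apply: open_measurable_rV.
apply: closed_openC; apply: compact_closed; last exact: compact_cube.
exact: norm_hausdorff.
Qed.

Lemma measurable_level_domain : measurable level_domain.
Proof.
have -> : level_domain = cube (n := m.+1) `&`
    ((fun x : 'rV[R]_m.+1 => x ord0 ord0) @^-1` `[0, T]%classic).
  by apply/seteqP; split => x; rewrite /level_domain /= in_itv.
apply: measurableI; first exact: measurable_cube.
rewrite -[X in measurable X]setTI; apply: measurable_rV_coord => //.
Qed.

Lemma measurable_sheet_point : measurable_fun setT sheet_point.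
Proof.
apply: measurable_fun_rV => i; case: (unliftP ord0 i) => [j ->|->].
  rewrite (_ : (fun _ => _) = (fun x : 'rV[R]_m.+1 => x ord0 (lift ord0 j))).
    exact: measurable_rV_coord.
  by apply/funext => x; rewrite rV_consES /= tlE.
by under eq_fun do rewrite rV_consE0.
Qed.

Lemma measurable_sheet_normal i : measurable_fun setT (sheet_normal i).
Proof.
rewrite /sheet_normal; case: unlift => [j|]; last exact: measurable_cst.
by under eq_fun do rewrite -mulN1r; apply: measurable_funM.
Qed.

Lemma bms_sheet_density i : bms (sheet_density i).
Proof.
split.
- apply: measurable_funM; last exact: measurable_sheet_normal.
  by apply: measurable_indic; exact: measurable_level_domain.
- rewrite /sheet_density /sheet_normal; case: unlift => [j|]; last first.
    by exists 1 => x; rewrite mulr1 indicE normr_nat; case: (_ \in _).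
  have [M hM] := bdG j; exists `|M| => x; rewrite indicE.
  have [|_] := boolP (x \in level_domain); last by rewrite mul0r normr0.
  rewrite inE => -[cx _]; rewrite mul1r normrN.
  exact: le_trans (hM _ cx) (ler_norm _).
- move=> p; rewrite /sheet_density mulf_eq0 negb_or => /andP[+ _].
  rewrite indicE; have [|_] := boolP (p \in level_domain); last by rewrite eqxx.
  by rewrite inE => -[].
Qed.

Section gradient.
Variables (f : 'rV[R]_m.+1 -> R) (df : 'I_m.+1 -> 'rV[R]_m.+1 -> R).
Hypotheses (fd : forall i x, is_derive x (unitv i) f (df i x))
  (cf : continuous f) (cdf : forall i, continuous (df i))
  (bf : bms f) (bdf : forall i, bms (df i)).

(** The level is added as a first coordinate, so that exchanging level and space is Fubini for
    [lam m.+2]. *)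
Let F i (q : 'rV[R]_m.+2) : R := \1_`[0, T] (q ord0 ord0) *
  hv (q ord0 (lift ord0 ord0) - G (rV_cons (q ord0 ord0, tl (tl q)))) * df i (tl q).

Let bF i : bms (F i).
Proof.
have [mdf [M hM] fc] := bdf i; split.
- apply: measurable_funM; last first.
    apply: measurableT_comp => //.
    by apply: (measurableT_comp measurable_snd); exact: measurable_rV_uncons.
  apply: measurable_funM.
    apply: measurableT_comp; last exact: measurable_rV_coord.
    by apply: measurable_indic; exact: measurable_itv.
  apply: measurableT_comp; first exact: measurable_hv.
  apply: measurable_funB; first exact: measurable_rV_coord.
  apply: measurableT_comp => //; apply: measurable_fun_rV => k.
  case: (unliftP ord0 k) => [j ->|->].
    under eq_fun do rewrite rV_consES /= !tlE; exact: measurable_rV_coord.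
  under eq_fun do rewrite rV_consE0; exact: measurable_rV_coord.
- exists M => q; rewrite /F !normrM; apply: le_trans (hM (tl q)).
  rewrite ler_piMl// mulr_ile1//; last by rewrite ger0_norm ?hv_ge0// hv_le1.
  by rewrite indicE normr_nat; case: (_ \in _).
- move=> q; rewrite !mulf_eq0 !negb_or => /andP[/andP[q0 _] /fc tq] k.
  case: (unliftP ord0 k) => [j ->|->]; first by rewrite -tlE; exact: tq.
  move: q0; rewrite indicE.
  have [|_] := boolP (_ \in _); last by rewrite eqxx.
  by rewrite inE/= in_itv/= => /andP[q0 qT] _; rewrite ger0_norm// (le_trans qT).
Qed.

Let Fint1 i : \int[lam m.+2]_q F i q = \int[lam m.+1]_x (layered x * df i x).
Proof.
rewrite fubini_xz//; apply: eq_Rintegral => x _.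
rewrite /F; under eq_Rintegral do rewrite rV_consE0 rV_consES /= tl_cons.
rewrite RintegralZr//.
have mI : measurable (`[0, T]%classic : set (measurableTypeR R)) by exact: measurable_itv.
apply: (@integrable_supp _ _ _ leb `[0, T]%classic _ 1) => //.
- by rewrite /= lebesgue_measure_itv/=; case: ifP => // _; rewrite -EFinB ltry.
- apply: measurable_funM; first exact: measurable_indic.
  apply: measurableT_comp; first exact: measurable_hv.
  apply: measurable_funB => //.
  apply: (@measurableT_comp _ _ _ _ _ _ G) => //.
  apply: (@measurableT_comp _ _ _ _ _ _ (@rV_cons R m)); first exact: measurable_rV_cons.
  exact: pair2_measurable.
- move=> l; rewrite normrM mulr_ile1//; last by rewrite ger0_norm ?hv_ge0// hv_le1.
  by rewrite indicE normr_nat; case: (_ \in _).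
- move=> l; rewrite mulf_eq0 negb_or => /andP[+ _]; rewrite indicE.
  have [|_] := boolP (_ \in _); last by rewrite eqxx.
  by rewrite inE.
Qed.

Let bFp i : bms (fun p : 'rV[R]_m.+1 => f (sheet_point p) * sheet_density i p).
Proof.
have [mf [M hM] fc] := bf.
rewrite (_ : (fun _ => _) = fun p => sheet_density i p * f (sheet_point p)); last first.
  by apply/funext => p; rewrite mulrC.
apply: bmsM; first exact: bms_sheet_density.
  by apply: measurableT_comp => //; exact: measurable_sheet_point.
by exists M => p _; exact: hM.
Qed.

(** A coarea formula: after exchanging level and space, the divergence theorem is applied to the
    region above each single sheet. *)
Lemma layered_gradient i :
  \int[lam m.+1]_x (layered x * df i x) =
  - \int[lam m.+1]_p (f (sheet_point p) * sheet_density i p).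
Proof.
rewrite -Fint1 -mulN1r -bms_RintegralZ//.
have bh : bms (fun p => -1 * (f (sheet_point p) * sheet_density i p)).
  rewrite (_ : (fun _ => _) = fun p => (f (sheet_point p) * sheet_density i p) * -1).
    by apply: bmsMc => //; exact: contC.
  by apply/funext => p; rewrite mulrC.
rewrite fubini_zx// fubini_zx//.
apply: eq_Rintegral => l _; rewrite (bms_RintegralZ _ (bms_slice1 l (bFp i))) mulN1r.
have [lT|lT] := boolP (0 <= l <= T); last first.
  rewrite (@eq_Rintegral _ _ _ _ setT (cst 0)); last first.
    move=> x _; rewrite /F rV_consE0 indicE memNset ?mul0r//.
    by rewrite /= in_itv/=; exact/negP.
  rewrite Rintegral_cst// mul0r.
  rewrite (@eq_Rintegral _ _ _ _ setT (cst 0)); last first.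
    move=> x _; rewrite /sheet_density indicE memNset ?mul0r ?mulr0//.
    by rewrite /level_domain /= rV_consE0 => -[_]; exact/negP.
  by rewrite Rintegral_cst// mul0r oppr0.
have F1 : \int[lam m.+1]_x F i (rV_cons (l, x)) =
    \int[lam m.+1]_x (df i x * hv (x ord0 ord0 - G (rV_cons (l, tl x)))).
  apply: eq_Rintegral => x _; rewrite /F rV_consE0 rV_consES /= tl_cons.
  by rewrite indicE mem_set ?mul1r//= ?in_itv// mulrC.
(* Where [f] does not vanish on the sheet, the base point lies in the cube; since [T <= 1] the whole
   parameter point does, and the indicator of [level_domain] equals [1]. *)
have D1 (w : 'rV[R]_m -> R) : \int[lam m]_x (f (sheet_point (rV_cons (l, x))) *
     (\1_level_domain (rV_cons (l, x)) * w x)) =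
   \int[lam m]_x (f (rV_cons (G (rV_cons (l, x)), x)) * w x).
  apply: eq_Rintegral => x _; rewrite /sheet_point tl_cons.
  have [->|] := eqVneq (f (rV_cons (G (rV_cons (l, x)), x))) 0; first by rewrite !mul0r.
  have [_ _ fc] := bf; move=> /fc /cube_cons[_ cx].
  rewrite indicE mem_set ?mul1r//; split; last by rewrite rV_consE0.
  move=> k; case: (unliftP ord0 k) => [j ->|->]; first by rewrite rV_consES; exact: cx.
  by rewrite rV_consE0 /=; case/andP: lT => l0 lT; rewrite ger0_norm// (le_trans lT).
rewrite F1 /sheet_density /sheet_normal; case: (unliftP ord0 i) => [j ij|i0].
  rewrite ij (@Rintegral_sheetS _ _ f df fd cf cdf bf bdf (fun y => G (rV_cons (l, y)))
    (fun j x => dG j (rV_cons (l, x))) (Gd l) (@cG l) (@cdG l) j).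
  have bs := bms_slice1 l (bFp (lift ord0 j)).
  rewrite -mulN1r -bms_RintegralZ; last first.
    by move: bs; rewrite /sheet_density /sheet_normal liftK.
  rewrite -D1; apply: eq_Rintegral => x _; ring.
rewrite i0 (@eq_Rintegral _ _ _ _ setT (fun x => df ord0 x * hv (x ord0 ord0 - G (rV_cons (l, tl x))) * 1)); last first.
  by move=> x _; rewrite mulr1.
rewrite (@Rintegral_sheet0 _ _ f df fd cf cdf bf bdf (fun y => G (rV_cons (l, y)))
    (@cG l) (fun=> 1)); last exact: contC.
by rewrite (D1 (fun=> 1)).
Qed.

End gradient.
End layered_function.

(** * Vector measures and total variation *)

Section euclidean_norm_complements.
Context {R : realType} {n : nat}.
Implicit Types x y : 'rV[R]_n.

Definition dot x y : R := \sum_i x ord0 i * y ord0 i.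

Lemma sqr_enorm x : enorm x ^+ 2 = sqn x.
Proof. by rewrite sqr_sqrtr// sqn_ge0. Qed.

Lemma dot_le_enorm x y : dot x y <= enorm x * enorm y.
Proof.
have : enorm (x + y) ^+ 2 <= (enorm x + enorm y) ^+ 2.
  by rewrite lerXn2r// ?nnegrE ?enorm_ge0 ?addr_ge0 ?enorm_ge0// enormD.
rewrite sqrrD !sqr_enorm.
rewrite (_ : sqn (x + y) = sqn x + dot x y *+ 2 + sqn y).
  by rewrite lerD2r lerD2l lerMn2r.
rewrite /sqn /dot -sumrMnl -!big_split/=; apply: eq_bigr => i _.
by rewrite mxE sqrrD.
Qed.

Lemma dotxx x : dot x x = enorm x ^+ 2.
Proof. by rewrite sqr_enorm; apply: eq_bigr => i _; rewrite expr2. Qed.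

Lemma enorm_le_sum x : enorm x <= \sum_i `|x ord0 i|.
Proof.
rewrite -(@ler_pXn2r _ 2)// ?nnegrE ?enorm_ge0 ?sumr_ge0// sqr_enorm.
rewrite expr2 mulr_suml /sqn; apply: ler_sum => i _.
rewrite -[leLHS]ger0_norm ?sqr_ge0// normrX expr2 ler_wpM2l//.
by rewrite (bigD1 i)//= lerDl sumr_ge0.
Qed.

Lemma coord_le_enorm x i : `|x ord0 i| <= enorm x.
Proof.
rewrite -(@ler_pXn2r _ 2)// ?nnegrE ?enorm_ge0// sqr_enorm.
by rewrite -normrX ger0_norm ?sqr_ge0// sqn_coord.
Qed.

Lemma enormN x : enorm (- x) = enorm x.
Proof. by congr Num.sqrt; apply: eq_bigr => i _; rewrite mxE sqrrN. Qed.

Lemma enorm_row_ext (f g : 'I_n -> R) : f =1 g ->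
  enorm (\row_i f i) = enorm (\row_i g i).
Proof. by move=> fg; congr enorm; apply/rowP => i; rewrite !mxE. Qed.

End euclidean_norm_complements.

(** * Approximation of integrals by sums over finite partitions *)

Section finite_partition_approximation.
Context {R : realType} d (X : measurableType d) (M : {measure set X -> \bar R}).

Lemma measurable_enorm n (W : 'I_n -> X -> R) :
  (forall i, measurable_fun setT (W i)) ->
  measurable_fun setT (fun x => enorm (\row_i W i x)).
Proof.
move=> mW; apply: (@measurableT_comp _ _ _ _ _ _ (@Num.sqrt R)).
  by apply: continuous_measurable_fun; exact: sqrt_continuous.
under eq_fun do under eq_bigr do rewrite mxE.
by apply: measurable_sum => i; apply: measurable_funX.
Qed.

Lemma Rintegral_sum (D : set X) (mD : measurable D) (I : Type) (r : seq I)
    (h : I -> X -> R) : (forall i, M.-integrable D (EFin \o h i)) ->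
  \int[M]_(x in D) (\sum_(i <- r) h i x) = \sum_(i <- r) \int[M]_(x in D) h i x /\
  M.-integrable D (EFin \o (fun x => \sum_(i <- r) h i x)).
Proof.
move=> ih; elim: r => [|i r [IH1 IH2]].
  rewrite big_nil; split.
    under eq_Rintegral do rewrite big_nil.
    by rewrite Rintegral_cst// mul0r.
  rewrite (_ : _ \o _ = cst 0%E); first exact: integrable0.
  by apply/funext => x /=; rewrite big_nil.
rewrite big_cons -IH1 -RintegralD//; split.
  by under eq_Rintegral do rewrite big_cons.
rewrite (_ : _ \o _ = (EFin \o h i) \+ (EFin \o (fun x => \sum_(i <- r) h i x))).
  exact: integrableD.
by apply/funext => x /=; rewrite big_cons EFinD.
Qed.

Lemma integrable_mul_bounded (D : set X) (mD : measurable D) (h W : X -> R) (K : R) :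
  measurable_fun D h -> (forall x, D x -> `|h x| <= K) ->
  M.-integrable D (EFin \o W) -> M.-integrable D (EFin \o (fun x => h x * W x)).
Proof.
move=> mh hK iW.
have := @integrableMr _ _ _ M D mD h (EFin \o W) mh _ iW.
apply; exists K; split; rewrite ?num_real// => y Ky x Dx.
exact: le_trans (hK _ Dx) (ltW Ky).
Qed.

(** Charges, total variations and images of densities are compared on sets only. Replacing [h] by
    the constant [c j] on each cell carries such comparisons over to integrals. *)
Lemma Rintegral_mul_partition (D : set X) (mD : measurable D) (W h : X -> R)
    (J : finType) (B : J -> set X) (c : J -> R) (e : R) :
  M.-integrable D (EFin \o W) -> measurable_fun setT h ->
  (forall j, measurable (B j)) -> (forall x, D x -> exists j, B j x) ->
  (forall j k x, B j x -> B k x -> j = k) ->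
  (forall j x, D x -> B j x -> `|h x - c j| <= e) ->
  `|\int[M]_(x in D) (h x * W x) - \sum_j c j * \int[M]_(x in D `&` B j) W x| <=
  e * \int[M]_(x in D) `|W x|.
Proof.
move=> iW mh mB cB tB hc.
pose s x := \sum_j c j * \1_(B j) x.
have sE j x : B j x -> s x = c j.
  move=> Bj; rewrite /s (bigD1 j)//= indicE mem_set// mulr1 big1 ?addr0// => k kj.
  rewrite indicE memNset ?mulr0// => Bk; move/eqP: kj; apply; exact: tB Bk Bj.
have ms : measurable_fun setT s.
  by apply: measurable_sum => j; apply: measurable_funM.
have hs x : D x -> `|h x - s x| <= e.
  by move=> Dx; have [j Bj] := cB _ Dx; rewrite (sE _ _ Bj) hc.
have Ej j : \int[M]_(x in D `&` B j) W x = \int[M]_(x in D) (\1_(B j) x * W x).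
  rewrite Rintegral_mkcondr; apply: eq_Rintegral => x _.
  by rewrite patchE indicE; case: ifPn => _; rewrite ?mul1r ?mul0r.
have ij j : M.-integrable D (EFin \o (fun x => \1_(B j) x * W x)).
  apply: (@integrable_mul_bounded D mD _ _ 1) => //.
  by move=> x _; rewrite indicE normr_nat; case: (_ \in _).
have iBj j : M.-integrable D (EFin \o (fun x => c j * (\1_(B j) x * W x))).
  by apply: (@integrable_mul_bounded D mD _ _ (`|c j|)).
have sumE : \sum_j c j * \int[M]_(x in D `&` B j) W x =
    \int[M]_(x in D) (s x * W x).
  rewrite (@eq_Rintegral _ _ _ M D (fun x => \sum_j c j * (\1_(B j) x * W x))); last first.
    by move=> x _; rewrite /s mulr_suml; apply: eq_bigr => j _; rewrite mulrA.
  have [-> _] := Rintegral_sum mD (index_enum J) iBj.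
  by apply: eq_bigr => j _; rewrite RintegralZl// Ej.
have [K sK] : exists K, forall x, `|s x| <= K.
  exists (\sum_j `|c j|) => x; apply: le_trans (ler_norm_sum _ _ _) _.
  apply: ler_sum => j _; rewrite normrM ler_piMr// indicE normr_nat.
  by case: (_ \in _).
have is_ : M.-integrable D (EFin \o (fun x => s x * W x)).
  by apply: (@integrable_mul_bounded D mD _ _ (K)) => //; exact: measurable_funTS.
have ih : M.-integrable D (EFin \o (fun x => h x * W x)).
  apply: (@integrable_mul_bounded D mD _ _ (K + e)) => //; first exact: measurable_funTS.
  move=> x Dx; rewrite -(subrK (s x) (h x)) addrC (le_trans (ler_normD _ _))// lerD//.
  exact: hs.
have ihs : M.-integrable D (EFin \o (fun x => (h x - s x) * W x)).
  apply: (@integrable_mul_bounded D mD _ _ (e)) => //.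
  by apply: measurable_funTS; exact: measurable_funB.
have iN : M.-integrable D (EFin \o (fun x => `|W x|)) by exact: integrable_norm iW.
rewrite sumE -RintegralB//.
rewrite (@eq_Rintegral _ _ _ M D (fun x => (h x - s x) * W x)); last first.
  by move=> x _; rewrite mulrBl.
apply: (le_trans (le_normr_Rintegral mD ihs)).
rewrite -RintegralZl//; apply: le_Rintegral => //.
- exact: integrable_norm ihs.
- by apply: (@integrable_mul_bounded D mD _ _ (`|e|)).
- by move=> x Dx; rewrite normrM ler_wpM2r// hs.
Qed.

(** Pull back by [h] the grid of mesh [e] on the cube [[-K, K]^n]; a cell is a choice of one
    interval for each component, hence the finite functions as index type. *)
Lemma finite_partition_exists n (h : 'I_n -> X -> R) (K e : R) : 0 < e ->
  (forall i, measurable_fun setT (h i)) -> (forall i x, `|h i x| <= K) ->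
  exists (J : finType) (B : J -> set X) (c : J -> 'I_n -> R),
  [/\ forall j, measurable (B j), forall x, exists j, B j x,
      forall j k x, B j x -> B k x -> j = k &
      forall j i x, B j x -> `|h i x - c j i| <= e].
Proof.
move=> e0 mh hK; pose N := Num.truncn (2 * K / e).
pose c (j : {ffun 'I_n -> 'I_N.+1}) i : R := (j i)%:R * e - K.
exists {ffun 'I_n -> 'I_N.+1},
  (fun j => [set x | forall i, c j i <= h i x < c j i + e]), c; split.
- move=> j; rewrite (_ : [set x | _] = ~` \bigcup_(i in [set: 'I_n])
      (~` (h i @^-1` `[c j i, c j i + e[%classic))); last first.
    apply/seteqP; split => [x hx [i _]|x hx i].
      by apply; rewrite /= in_itv/=; exact: hx.
    apply: contrapT => nx; apply: hx; exists i; first by [].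
    by rewrite /setC /= in_itv/=.
  apply: measurableC; apply: fin_bigcup_measurable; first exact: finite_finset.
  move=> i _; apply: measurableC; rewrite -[X in measurable X]setTI.
  exact: mh.
- move=> x.
  have lo i : 0 <= (h i x + K) / e.
    rewrite divr_ge0 ?(ltW e0)//; have := hK i x; rewrite ler_norml => /andP[+ _].
    by rewrite -subr_ge0 opprK.
  have hi i : (Num.truncn ((h i x + K) / e) < N.+1)%N.
    rewrite ltnS /N; apply: le_truncn; rewrite ler_wpM2r ?invr_ge0 ?(ltW e0)//.
    have := hK i x; rewrite ler_norml => /andP[_ h2]; lra.
  exists [ffun i => Ordinal (hi i)] => i; rewrite /c ffunE/=.
  have /andP[h1 h2] := truncn_itv (lo i).
  have E l : (l.+1%:R : R) * e = l%:R * e + e by rewrite -natr1 mulrDl mul1r.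
  move: h1 h2; rewrite ler_pdivlMr// ltr_pdivrMr// E => h1 h2.
  by apply/andP; split; lra.
- move=> j k x hj hk; apply/ffunP => i; apply/val_inj.
  have /andP[a1 a2] := hj i; have /andP[b1 b2] := hk i.
  have lt1 (a b : 'I_N.+1) : (a%:R * e - K < b%:R * e - K + e) -> (a <= b)%N.
    have E l : (l.+1%:R : R) * e = l%:R * e + e by rewrite -natr1 mulrDl mul1r.
    move=> ab; have : a%:R * e < b.+1%:R * e by rewrite E; lra.
    by rewrite ltr_pM2r// ltr_nat ltnS.
  apply/eqP; rewrite eqn_leq; apply/andP; split; apply: lt1.
    exact: le_lt_trans a1 b2.
  exact: le_lt_trans b1 a2.
- move=> j i x /(_ i) /andP[h1 h2]; rewrite ger0_norm; lra.
Qed.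

(** For [v] the vector of integrals, |v|^2 is the integral of the scalar product of [v] with [W],
    hence at most |v| times the integral of |W|. *)
Lemma enorm_Rintegral n (D : set X) (mD : measurable D) (W : 'I_n -> X -> R) :
  (forall i, M.-integrable D (EFin \o W i)) ->
  M.-integrable D (EFin \o (fun x => enorm (\row_i W i x))) ->
  enorm (\row_i \int[M]_(x in D) W i x) <= \int[M]_(x in D) enorm (\row_i W i x).
Proof.
move=> iW iN; set v := \row_i _.
have [v0|v0] := eqVneq (enorm v) 0.
  by rewrite v0; apply: Rintegral_ge0 => x _; exact: enorm_ge0.
have vgt0 : 0 < enorm v by rewrite lt_neqAle eq_sym v0 enorm_ge0.
rewrite -(ler_pM2l vgt0) -expr2 -dotxx /dot.
have iv i : M.-integrable D (EFin \o (fun x => v ord0 i * W i x)).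
  by apply: (@integrable_mul_bounded D mD (fun=> v ord0 i) (W i) `|v ord0 i|).
have -> : \sum_i v ord0 i * v ord0 i = \int[M]_(x in D) (\sum_i v ord0 i * W i x).
  have [-> _] := Rintegral_sum mD (index_enum 'I_n) iv.
  by apply: eq_bigr => i _; rewrite RintegralZl//; congr (_ * _); rewrite /v mxE.
rewrite -RintegralZl//; apply: le_Rintegral => //.
- by have [_] := Rintegral_sum mD (index_enum 'I_n) iv.
- by apply: (@integrable_mul_bounded D mD (fun=> enorm v) _ `|enorm v|).
- move=> x _; apply: le_trans (dot_le_enorm _ _).
  by apply: ler_sum => i _; rewrite [X in _ <= _ * X]mxE.
Qed.

End finite_partition_approximation.

(** * Integrals with respect to charges *)

Section charges.
Context {R : realType} d (T : measurableType d).
Implicit Types (nu : {charge set T -> \bar R}) (D : set T).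

(** Hides the chosen Hahn decomposition: from here on a charge is a difference of two finite
    measures. *)
Lemma charge_integral_decomposition nu :
  exists P Q : {finite_measure set T -> \bar R},
    (forall A, measurable A -> fine (nu A) = fine (P A) - fine (Q A)) /\
    (forall D g, charge_integral nu D g =
       (\int[P]_(x in D) g x - \int[Q]_(x in D) g x)%E).
Proof.
pose h := projT2 (cid (projT2 (cid (Hahn_decomposition nu)))).
exists (jordan_pos h), (jordan_neg h); split; last by [].
move=> A mA; rewrite (jordan_decomp h mA) /cadd /= cscaleN1 fineD.
- by rewrite fineN.
- exact: fin_num_measure.
- by rewrite fin_numN; exact: fin_num_measure.
Qed.

Lemma bounded_finite_integrable (P : {finite_measure set T -> \bar R}) D (h : T -> R) K :
  measurable D -> measurable_fun setT h -> (forall x, `|h x| <= K) ->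
  P.-integrable D (EFin \o h).
Proof.
move=> mD mh hK; apply: measurable_bounded_integrable => //.
- by rewrite -ge0_fin_numE// fin_num_measure.
- exact: measurable_funTS.
- exists K; split; rewrite ?num_real// => y Ky x _; exact: le_trans (hK x) (ltW Ky).
Qed.

Lemma charge_integral_fineE nu (P Q : {finite_measure set T -> \bar R}) D (h : T -> R) K :
  (forall D g, charge_integral nu D g =
       (\int[P]_(x in D) g x - \int[Q]_(x in D) g x)%E) ->
  measurable D -> measurable_fun setT h -> (forall x, `|h x| <= K) ->
  charge_integral nu D (EFin \o h) =
  (\int[P]_(x in D) h x - \int[Q]_(x in D) h x)%:E.
Proof.
move=> nuE mD mh hK; rewrite nuE EFinB; congr (_ - _)%E.
  by rewrite fineK//; apply: integrable_fin_num => //; exact: bounded_finite_integrable hK.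
by rewrite fineK//; apply: integrable_fin_num => //; exact: bounded_finite_integrable hK.
Qed.

Lemma Rintegral_one (P : {finite_measure set T -> \bar R}) D : measurable D ->
  \int[P]_(x in D) (1 : R) = fine (P D).
Proof. by move=> mD; rewrite Rintegral_cst// mul1r. Qed.

(* The constant [C] bounds the mass of the Jordan decomposition on [D]. *)
Lemma charge_integral_partition nu D : measurable D -> exists C : R, 0 <= C /\
  forall (h : T -> R) (K : R) (J : finType) (B : J -> set T) (c : J -> R) (e : R),
  measurable_fun setT h -> (forall x, `|h x| <= K) ->
  (forall j, measurable (B j)) -> (forall x, D x -> exists j, B j x) ->
  (forall j k x, B j x -> B k x -> j = k) ->
  (forall j x, D x -> B j x -> `|h x - c j| <= e) ->
  `|fine (charge_integral nu D (EFin \o h)) -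
    \sum_j c j * fine (nu (D `&` B j))| <= e * C.
Proof.
move=> mD; have [P [Q [nuPQ ciE]]] := charge_integral_decomposition nu.
exists (fine (P D) + fine (Q D)); split; first by rewrite addr_ge0// fine_ge0.
move=> h K J B c e mh hK mB cB tB hc.
rewrite (charge_integral_fineE ciE mD mh hK) /=.
have key (M : {finite_measure set T -> \bar R}) :
    `|\int[M]_(x in D) h x - \sum_j c j * fine (M (D `&` B j))| <= e * fine (M D).
  have i1 : M.-integrable D (EFin \o (fun=> 1)) by exact: finite_measure_integrable_cst.
  have := Rintegral_mul_partition mD i1 mh mB cB tB hc.
  rewrite (@eq_Rintegral _ _ _ M D h); last by move=> x _; rewrite mulr1.
  rewrite [X in _ <= _ * X](@eq_Rintegral _ _ _ M D (fun=> 1)); last by move=> x _ /=; rewrite normr1.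
  rewrite Rintegral_one//; congr (`|_ - _| <= _).
  by apply: eq_bigr => j _; rewrite Rintegral_one//; exact: measurableI.
have E : \sum_j c j * fine (nu (D `&` B j)) =
    \sum_j c j * fine (P (D `&` B j)) - \sum_j c j * fine (Q (D `&` B j)).
  rewrite -sumrB; apply: eq_bigr => j _.
  by rewrite nuPQ ?mulrBr//; exact: measurableI.
rewrite E mulrDr; set a := \int[P]_(x in D) h x; set b := \int[Q]_(x in D) h x.
set a' := \sum_j _ * fine (P _); set b' := \sum_j _ * fine (Q _).
rewrite (_ : a - b - (a' - b') = (a - a') - (b - b')); last by ring.
by rewrite (le_trans (ler_normB _ _))// lerD//; [exact: (key P)|exact: (key Q)].
Qed.

Lemma charge_integral_fin_num nu D (h : T -> R) K :
  measurable D -> measurable_fun setT h -> (forall x, `|h x| <= K) ->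
  charge_integral nu D (EFin \o h) \is a fin_num.
Proof.
move=> mD mh hK; have [P [Q [_ ciE]]] := charge_integral_decomposition nu.
by rewrite (charge_integral_fineE ciE mD mh hK).
Qed.

Lemma ler_addM_eps (x y C : R) : 0 <= C -> (forall e, 0 < e -> x <= y + e * C) -> x <= y.
Proof.
move=> C0 h; apply/ler_addgt0Pr => e e0.
have := h (e / (C + 1)) (divr_gt0 e0 (ltr_wpDl C0 ltr01)).
move=> /le_trans; apply; rewrite lerD2l -mulrA ler_piMr ?(ltW e0)//.
by rewrite mulrC ler_pdivrMr ?mul1r ?lerDl// ltr_wpDl.
Qed.

Section represented.
Context d' (X : measurableType d') (M : {measure set X -> \bar R}) (Phi : X -> T).
Hypothesis mPhi : measurable_fun setT Phi.

Let mpre A : measurable A -> measurable (Phi @^-1` A).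
Proof. by move=> mA; rewrite -[X in measurable X]setTI; exact: mPhi. Qed.

(** The hypothesis speaks of subsets of [D] only, so both integrals are shown to lie within a
    multiple of [e] of the same sum over a partition. *)
Lemma charge_integral_represented nu (W : X -> R) D (h : T -> R) K :
  M.-integrable setT (EFin \o W) -> measurable D ->
  (forall A, measurable A -> A `<=` D -> fine (nu A) = \int[M]_(x in Phi @^-1` A) W x) ->
  measurable_fun setT h -> (forall x, `|h x| <= K) ->
  charge_integral nu D (EFin \o h) = (\int[M]_(x in Phi @^-1` D) (h (Phi x) * W x))%:E.
Proof.
move=> iW mD nuW mh hK.
rewrite -[LHS]fineK ?(charge_integral_fin_num nu mD mh hK)//; congr EFin.
have iWD : M.-integrable (Phi @^-1` D) (EFin \o W).
  by apply: (integrableS measurableT) => //; exact: mpre.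
have [C [C0 hC]] := charge_integral_partition nu mD.
pose I := \int[M]_(x in Phi @^-1` D) `|W x|.
have I0 : 0 <= I by exact: Rintegral_ge0.
apply/eqP; rewrite -subr_eq0 -normr_le0.
apply: (@ler_addM_eps _ _ (C + I)); first exact: addr_ge0.
move=> e e0; rewrite add0r.
have [J [B [c [mB cB tB hc]]]] := @finite_partition_exists _ _ T 1
  (fun=> h) K e e0 (fun=> mh) (fun=> hK).
have h1 := hC h K J B (fun j => c j ord0) e mh hK mB (fun x _ => cB x) tB
  (fun j x _ Bj => hc j ord0 x Bj).
have mhP : measurable_fun setT (h \o Phi) by exact: measurableT_comp.
have h2 := @Rintegral_mul_partition _ _ X M (Phi @^-1` D) (mpre mD) W (h \o Phi) J
  (fun j => Phi @^-1` B j) (fun j => c j ord0) e iWD mhP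
  (fun j => mpre (mB j)) (fun x _ => cB (Phi x)) (fun j k x => tB j k (Phi x))
  (fun j x _ Bj => hc j ord0 (Phi x) Bj).
have E : \sum_j c j ord0 * fine (nu (D `&` B j)) =
   \sum_j c j ord0 * \int[M]_(x in Phi @^-1` D `&` Phi @^-1` B j) W x.
  by apply: eq_bigr => j _; rewrite nuW ?preimage_setI//; exact: measurableI.
rewrite E in h1; move: h1 h2 => /=.
set a := fine _; set b := \int[M]_(_ in _) _; set s := \sum_j _ => h1 h2.
rewrite (_ : a - b = (a - s) - (b - s)); last by ring.
by rewrite (le_trans (ler_normB _ _))// mulrDr lerD.
Qed.

End represented.

Section variation.
Variables (n : nat) (nu : 'I_n -> {charge set T -> \bar R}).

Let tvE D : measurable D -> Defs.total_variation nu D =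
  ereal_sup [set (\sum_(k <oo) vnorm nu (B k))%E | B in countable_partition D].
Proof. by move=> mD; rewrite /Defs.total_variation mem_set. Qed.

Lemma vnorm_le_total_variation D : measurable D ->
  (vnorm nu D <= Defs.total_variation nu D)%E.
Proof.
move=> mD; rewrite tvE//.
pose B k := if k is 0%N then D else set0 : set T.
have v0 k : (0 <= vnorm nu (B k))%E by rewrite lee_fin enorm_ge0.
apply: (@le_trans _ _ (\sum_(k <oo) vnorm nu (B k))%E).
  apply: (@le_trans _ _ (\sum_(0 <= k < 1) vnorm nu (B k))%E).
    by rewrite big_nat1.
  exact: nneseries_lim_ge.
apply: ereal_sup_ubound; exists B => //; split.
- by move=> [|k]; rewrite /B.
- by apply/trivIsetP => -[|i] [|j]//= _ _ _; rewrite ?setI0 ?set0I.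
- by rewrite eqEsubset; split=> [x [[|k]]//|x Dx]; exists 0%N.
Qed.

(** On a cell where [h] is nearly a constant vector, Cauchy-Schwarz bounds its product with the
    vector nu(B) by its norm times the total variation of the cell. *)
Lemma charge_integral_le_variation D (h : 'I_n -> T -> R) (K : R) (a : T -> R) :
  measurable D -> (Defs.total_variation nu D < +oo)%E ->
  (forall i, measurable_fun setT (h i)) -> (forall i x, `|h i x| <= K) ->
  measurable_fun setT a -> (forall x, D x -> enorm (\row_i h i x) <= a x) ->
  ((\sum_i fine (charge_integral (nu i) D (EFin \o h i)))%:E <=
   \int[Defs.total_variation nu]_(x in D) (a x)%:E)%E.
Proof.
move=> mD tvoo mh hK ma ha.
have a0 x : D x -> 0 <= a x by move=> Dx; rewrite (le_trans (enorm_ge0 _) (ha x Dx)).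
have [->|ioo] := eqVneq (\int[Defs.total_variation nu]_(x in D) (a x)%:E)%E +oo%E.
  by rewrite leey.
have ifin : (\int[Defs.total_variation nu]_(x in D) (a x)%:E)%E \is a fin_num.
  by rewrite ge0_fin_numE ?ltey// integral_ge0// => x Dx; rewrite lee_fin a0.
rewrite -(fineK ifin) lee_fin.
have [C CP] := choice (fun i => charge_integral_partition (nu i) mD).
pose V := fine (Defs.total_variation nu D).
have V0 : 0 <= V by rewrite fine_ge0.
have SC0 : 0 <= \sum_i C i by rewrite sumr_ge0// => i _; have [] := CP i.
(* The first term pays for replacing [h i] by constants in the charges, the second for the bound |c
   j| <= a + n e under the total variation. *)
apply: (@ler_addM_eps _ _ (\sum_i C i + n%:R * V)).
  by rewrite addr_ge0// mulr_ge0.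
move=> e e0.
have [J [B [c [mB cB tB hc]]]] := @finite_partition_exists _ _ T n h K e e0 mh hK.
have mDB j : measurable (D `&` B j) by exact: measurableI.
have tvfin j : Defs.total_variation nu (D `&` B j) \is a fin_num.
  rewrite ge0_fin_numE//; apply: le_lt_trans tvoo.
  by apply: le_measure; rewrite ?inE.
have step1 : \sum_i fine (charge_integral (nu i) D (EFin \o h i)) <=
    \sum_j enorm (\row_i c j i) * fine (Defs.total_variation nu (D `&` B j)) +
    e * \sum_i C i.
  apply: (@le_trans _ _ (\sum_i (\sum_j c j i * fine (nu i (D `&` B j)) + e * C i))).
    apply: ler_sum => i _; rewrite -lerBlDl.
    apply: le_trans (ler_norm _) _.
    have [_ hCi] := CP i.
    apply: (hCi _ K J B (fun j => c j i) e) => //.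
    by move=> j x _; exact: hc.
  rewrite big_split/= -mulr_sumr lerD2r exchange_big/=; apply: ler_sum => j _.
  have := vnorm_le_total_variation (mDB j).
  rewrite /vnorm -(fineK (tvfin j)) lee_fin => vt.
  apply: (@le_trans _ _ (enorm (\row_i c j i) * enorm (\row_i fine (nu i (D `&` B j))))).
    apply: le_trans (dot_le_enorm _ _).
    by apply: ler_sum => i _; rewrite !mxE.
  by rewrite ler_wpM2l// enorm_ge0.
apply: (le_trans step1); rewrite mulrDr addrA [leRHS]addrAC lerD2r.
have ia : (Defs.total_variation nu).-integrable D (EFin \o a).
  apply/integrableP; split; first exact/measurable_EFinP/measurable_funTS.
  rewrite (@eq_integral _ _ _ _ _ (EFin \o a)) -?ge0_fin_numE//.
    by rewrite integral_ge0// => x Dx; rewrite lee_fin a0.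
  by move=> x; rewrite inE => Dx /=; rewrite ger0_norm ?a0.
have i1 : (Defs.total_variation nu).-integrable D (EFin \o (fun=> e * n%:R)).
  apply: measurable_bounded_integrable => //.
  by exists `|e * n%:R|; split; rewrite ?num_real// => y h1 x _; exact: ltW.
have iB j : (Defs.total_variation nu).-integrable D (EFin \o (fun x => enorm (\row_i c j i) * \1_(B j) x)).
  apply: measurable_bounded_integrable => //.
    by apply: measurable_funM.
  exists (enorm (\row_i c j i)); split; rewrite ?num_real// => y h1 x _ /=.
  rewrite normrM ger0_norm ?enorm_ge0// (le_trans _ (ltW h1))// ler_piMr ?enorm_ge0//.
  by rewrite indicE normr_nat; case: (_ \in _).
have [S1 S2] := Rintegral_sum mD (index_enum J) iB.
have -> : \sum_j enorm (\row_i c j i) * fine (Defs.total_variation nu (D `&` B j)) =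
   \int[Defs.total_variation nu]_(x in D) (\sum_j enorm (\row_i c j i) * \1_(B j) x).
  rewrite S1; apply: eq_bigr => j _; rewrite RintegralZl//; last first.
    apply: measurable_bounded_integrable => //.
    exists 1; split; rewrite ?num_real// => y h1 x _ /=; rewrite indicE normr_nat.
    by rewrite (le_trans _ (ltW h1))//; case: (_ \in _).
  congr (_ * _); rewrite -[LHS]mul1r -(@Rintegral_cst _ _ _ (Defs.total_variation nu) _ (mDB j)).
  rewrite Rintegral_mkcondr; apply: eq_Rintegral => x _.
  by rewrite patchE indicE; case: ifPn => _.
have -> : \int[Defs.total_variation nu]_(x in D) a x + e * (n%:R * V) =
    \int[Defs.total_variation nu]_(x in D) (a x + e * n%:R).
  by rewrite RintegralD// Rintegral_cst// mulrA.
have i2 : (Defs.total_variation nu).-integrable D (EFin \o (fun x => a x + e * n%:R)).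
  exact: (integrableD mD ia i1).
apply: le_Rintegral => //.
move=> x Dx; have [j Bj] := cB x.
rewrite (bigD1 j)//= indicE mem_set// mulr1 big1 ?addr0; last first.
  move=> k kj; rewrite indicE memNset ?mulr0// => Bk.
  by move/eqP: kj; apply; exact: tB Bk Bj.
apply: (@le_trans _ _ (enorm (\row_i h i x) + enorm (\row_i (c j i - h i x)))).
  apply: le_trans (enormD _ _); rewrite le_eqVlt; apply/orP; left; apply/eqP; congr enorm; apply/rowP => i.
  by rewrite !mxE addrC subrK.
rewrite lerD ?ha//; apply: le_trans (enorm_le_sum _) _.
rewrite (_ : e * n%:R = \sum_(i < n) e); last by rewrite sumr_const card_ord mulr_natr.
by apply: ler_sum => i _; rewrite mxE distrC hc.
Qed.

(** The supremum over partitions is controlled by domination on each piece together with countable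
    superadditivity of [mu]. *)
Lemma total_variation_le D (mu : set T -> R) :
  measurable D ->
  (forall A, measurable A -> A `<=` D -> 0 <= mu A) ->
  (forall A, measurable A -> A `<=` D -> enorm (\row_i fine (nu i A)) <= mu A) ->
  (forall F : (set T)^nat, (forall k, measurable (F k)) -> trivIset setT F ->
     (\bigcup_k F k) `<=` D -> (\sum_(k <oo) (mu (F k))%:E <= (mu (\bigcup_k F k))%:E)%E) ->
  (Defs.total_variation nu D <= (mu D)%:E)%E.
Proof.
move=> mD mu0 numu muD; rewrite tvE//; apply: ge_ereal_sup => _ [B [mB tB UB] <-].
have BD k : B k `<=` D by rewrite -UB => x Bx; exists k.
apply: (@le_trans _ _ (\sum_(k <oo) (mu (B k))%:E)%E).
  apply: lee_nneseries => [k _ _|k _]; first by rewrite lee_fin enorm_ge0.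
  by rewrite /vnorm lee_fin numu.
by rewrite -[in leRHS]UB; apply: muD => //; rewrite UB.
Qed.

End variation.
End charges.

(** * Charges that are images of a density *)

Section represented_charges.
Context {R : realType} d (T : measurableType d) d' (X : measurableType d').
Variables (M : {measure set X -> \bar R}) (Phi : X -> T).
Hypothesis mPhi : measurable_fun setT Phi.

Let mpre A : measurable A -> measurable (Phi @^-1` A).
Proof. by move=> mA; rewrite -[X in measurable X]setTI; exact: mPhi. Qed.

Section pushed_charge.
Variables (w : X -> R) (iw : M.-integrable setT (EFin \o w)).

(** The measurability of [Phi] is an argument so that the charge structure attached to the term can
    depend on it. *)
Definition pushed_charge (_ : measurable_fun setT Phi) (A : set T) : \bar R := induced_charge iw (Phi @^-1` A).

Local Notation pc := (pushed_charge mPhi).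

Let pushed_charge0 : pc set0 = 0%E.
Proof. by rewrite /pushed_charge preimage_set0 charge0. Qed.

Let pushed_charge_fin A : measurable A -> pc A \is a fin_num.
Proof. by move=> mA; apply: fin_num_measure; exact: mpre. Qed.

Let pushed_charge_sigma_additive : semi_sigma_additive pc.
Proof.
move=> F mF tF mUF; rewrite /pushed_charge preimage_bigcup.
apply: charge_semi_sigma_additive.
- by move=> n; exact: mpre.
- apply/trivIsetP => /= i j _ _ ij; rewrite -preimage_setI.
  by move/trivIsetP : tF => /(_ _ _ _ _ ij) ->//; rewrite preimage_set0.
- by rewrite -preimage_bigcup; exact: mpre.
Qed.

HB.instance Definition _ := isCharge.Build _ _ _ pc
  pushed_charge0 pushed_charge_fin pushed_charge_sigma_additive.

End pushed_charge.

Variables (n : nat) (W : 'I_n -> X -> R).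
Hypotheses (iW : forall i, M.-integrable setT (EFin \o W i))
  (iN : M.-integrable setT (EFin \o (fun x => enorm (\row_i W i x)))).
Variables (nu : 'I_n -> {charge set T -> \bar R}) (D : set T).
Hypotheses (mD : measurable D)
  (nuW : forall i A, measurable A -> A `<=` D ->
     fine (nu i A) = \int[M]_(x in Phi @^-1` A) W i x).

Let N x := enorm (\row_i W i x).
Let mu A : R := \int[M]_(x in Phi @^-1` A) N x.

Let iNA A : measurable A -> M.-integrable (Phi @^-1` A) (EFin \o N).
Proof. by move=> mA; apply: (integrableS measurableT) => //; exact: mpre. Qed.

Let muE A : measurable A -> ((mu A)%:E = \int[M]_(x in Phi @^-1` A) (N x)%:E)%E.
Proof.
move=> mA; rewrite fineK//; apply: integrable_fin_num; first exact: mpre.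
exact: iNA.
Qed.

(** Domination on each piece is [enorm_Rintegral]. Since [Phi] may be non-injective, densities can
    cancel at a common image, so in general this is an inequality only. *)
Lemma represented_total_variation_le A : measurable A -> A `<=` D ->
  (Defs.total_variation nu A <= (mu A)%:E)%E.
Proof.
move=> mA AD; apply: total_variation_le => //.
- by move=> B mB _; apply: Rintegral_ge0 => x _; exact: enorm_ge0.
- move=> B mB BA.
  rewrite (@enorm_row_ext _ _ _ (fun i => \int[M]_(x in Phi @^-1` B) W i x)); last first.
    by move=> i; rewrite nuW//; exact: subset_trans BA AD.
  apply: enorm_Rintegral; first exact: mpre.
    by move=> i; apply: (integrableS measurableT) => //; exact: mpre.
  exact: iNA.
- move=> F mF tF _; rewrite muE; last exact: bigcupT_measurable.
  rewrite preimage_bigcup ge0_integral_bigcup//.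
  + by apply: lee_nneseries => k _; rewrite -?muE// ?integral_ge0// lee_fin Rintegral_ge0// => x _; exact: enorm_ge0.
  + by move=> k; exact: mpre.
  + by apply: measurable_funTS; move/measurable_int: iN.
  + by move=> x _; rewrite lee_fin enorm_ge0.
  + apply/trivIsetP => /= i j _ _ ij; rewrite -preimage_setI.
    by move/trivIsetP : tF => /(_ _ _ _ _ ij) ->//; rewrite preimage_set0.
Qed.

Lemma represented_variation_le (a : T -> R) (K : R) :
  measurable_fun setT a -> (forall x, 0 <= a x <= K) ->
  (\int[Defs.total_variation nu]_(x in D) (a x)%:E <=
    (\int[M]_(x in Phi @^-1` D) (a (Phi x) * enorm (\row_i W i x)))%:E)%E.
Proof.
move=> ma aK.
have tvD := represented_total_variation_le mD (@subset_refl _ D).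
have tvoo : (Defs.total_variation nu D < +oo)%E by rewrite (le_lt_trans tvD)// ltry.
have aK' x : `|a x| <= K by have /andP[a0 a1] := aK x; rewrite ger0_norm.
have ia : (Defs.total_variation nu).-integrable D (EFin \o a).
  apply: measurable_bounded_integrable => //; first exact: measurable_funTS.
  by exists K; split; rewrite ?num_real// => y Ky x _; exact: le_trans (aK' x) (ltW Ky).
rewrite -[leLHS]fineK; last exact: integrable_fin_num.
have mu0 : 0 <= mu D by apply: Rintegral_ge0 => x _; exact: enorm_ge0.
rewrite lee_fin; apply: (@ler_addM_eps _ _ _ (mu D + mu D)); first exact: addr_ge0.
move=> e e0.
have [J [B [c [mB cB tB hc]]]] := @finite_partition_exists _ _ T 1
  (fun=> a) K e e0 (fun=> ma) (fun=> aK').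
(* Nonnegative values may multiply the inequality between total variation and [mu]; as [a] is
   nonnegative, truncation at [0] does not increase the error. *)
pose c' j := Num.max (c j ord0) 0.
have hc' j x : B j x -> `|a x - c' j| <= e.
  move=> Bj; apply: le_trans (hc j ord0 x Bj).
  have /andP[a0 _] := aK x; rewrite /c'; case: (leP 0 (c j ord0)) => c0 //.
  rewrite subr0 ger0_norm// ger0_norm ?subr_ge0 ?(le_trans (ltW c0))//.
  by rewrite lerDl oppr_ge0 ltW.
have mDB j : measurable (D `&` B j) by exact: measurableI.
have i1 : (Defs.total_variation nu).-integrable D (EFin \o (fun=> 1)).
  apply: measurable_bounded_integrable => //.
  by exists `|1|; split; rewrite ?num_real// => y h1 x _; exact: ltW.
have h1 := Rintegral_mul_partition mD i1 ma mB (fun x _ => cB x) tB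
  (fun j x _ Bj => hc' j x Bj).
have maP : measurable_fun setT (a \o Phi) by exact: measurableT_comp.
have h2 := @Rintegral_mul_partition _ _ X M (Phi @^-1` D) (mpre mD) N (a \o Phi) J
  (fun j => Phi @^-1` B j) c' e (iNA mD) maP
  (fun j => mpre (mB j)) (fun x _ => cB (Phi x)) (fun j k x => tB j k (Phi x))
  (fun j x _ Bj => hc' j (Phi x) Bj).
have tvfin j : Defs.total_variation nu (D `&` B j) \is a fin_num.
  rewrite ge0_fin_numE//; apply: le_lt_trans tvoo.
  by apply: le_measure; rewrite ?inE.
have S : \sum_j c' j * \int[Defs.total_variation nu]_(x in D `&` B j) 1 <=
    \sum_j c' j * \int[M]_(x in Phi @^-1` D `&` Phi @^-1` B j) N x.
  apply: ler_sum => j _; rewrite ler_wpM2l//; first by rewrite le_max lexx orbT.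
  rewrite Rintegral_cst// mul1r -preimage_setI -lee_fin fineK ?tvfin//.
  by apply: represented_total_variation_le.
have V : \int[Defs.total_variation nu]_(x in D) `|1 : R| <= mu D.
  rewrite (@eq_Rintegral _ _ _ _ D (fun=> 1)); last by move=> x _ /=; rewrite normr1.
  rewrite Rintegral_cst// mul1r -lee_fin fineK// ge0_fin_numE//.
have NN : \int[M]_(x in Phi @^-1` D) `|N x| = mu D.
  by apply: eq_Rintegral => x _; rewrite ger0_norm ?enorm_ge0.
rewrite NN in h2.
rewrite (@eq_Rintegral _ _ _ _ D a) in h1; last by move=> x _; rewrite mulr1.
have h1' := le_trans (le_trans (ler_norm _) h1) (ler_wpM2l (ltW e0) V).
rewrite distrC in h2; have h2' := le_trans (ler_norm _) h2.
rewrite lerBlDl in h1'; rewrite lerBlDl in h2'.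
apply: (le_trans h1'); rewrite mulrDr addrA lerD2r.
exact: le_trans S h2'.
Qed.

End represented_charges.

(** * The unit ball *)

Section unit_ball.
Context {R : realType}.

Lemma mx_norm_le n (x : 'rV[R]_n) (M : R) : 0 <= M ->
  (forall i, `|x ord0 i| <= M) -> `|x| <= M.
Proof.
move=> M0 h; rewrite [leLHS]/Num.norm /= mx_normrE.
by apply: bigmax_le => // -[i j] _; rewrite !ord1.
Qed.

Definition oball n : set 'rV[R]_n := [set x | sqn x < 1].
Arguments oball n _ : clear implicits.

Lemma cont_sqn n : continuous (@sqn R n).
Proof. exact: smooth_continuous smooth_sqn. Qed.

Lemma open_oball n : open (oball n).
Proof. by apply: (@open_comp _ _ (@sqn R n) [set t | t < 1]);
  [move=> x _; exact: cont_sqn|exact: open_lt]. Qed.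

Lemma measurable_oball n : measurable (oball n).
Proof. by apply: open_measurable_rV; exact: open_oball. Qed.

Lemma sqn_le1_coord n (x : 'rV[R]_n) i : sqn x <= 1 -> `|x ord0 i| <= 1.
Proof.
move=> x1; rewrite -(@ler_pXn2r _ 2)// ?nnegrE// expr1n.
by rewrite -normrX ger0_norm ?sqr_ge0// (le_trans (sqn_coord _ _)).
Qed.

Lemma closed_sqn_le n (c : R) : closed [set x : 'rV[R]_n | sqn x <= c].
Proof.
by apply: (@preimage_closed _ _ (@sqn R n) [set t | t <= c]);
  [move=> x _; exact: cont_sqn|exact: closed_le].
Qed.

Lemma bounded_sqn_le1 n (A : set 'rV[R]_n) : (forall x, A x -> sqn x <= 1) ->
  bounded_set A.
Proof.
move=> A1; exists 1; split; rewrite ?num_real// => M M1 x /A1 x1.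
by apply: (le_trans _ (ltW M1)); apply: mx_norm_le => // i; exact: sqn_le1_coord.
Qed.

Lemma compact_sqn_le n (c : R) : c <= 1 -> compact [set x : 'rV[R]_n | sqn x <= c].
Proof.
move=> c1; apply: bounded_closed_compact; last exact: closed_sqn_le.
by apply: bounded_sqn_le1 => x /= xc; exact: le_trans c1.
Qed.

Lemma sqnZ n (t : R) (x : 'rV[R]_n) : sqn (t *: x) = t ^+ 2 * sqn x.
Proof.
by rewrite /sqn mulr_sumr; apply: eq_bigr => i _; rewrite mxE exprMn.
Qed.

Lemma boundary_oball n : boundary (oball n) = [set x : 'rV[R]_n | sqn x = 1].
Proof.
rewrite /boundary (interior_id _).1; last exact: open_oball.
apply/seteqP; split => [x [cx /negP]|x /= x1].
  rewrite /= -leNgt => x1; apply/eqP; rewrite eq_le x1 andbT.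
  have : closure [set x : 'rV[R]_n | sqn x <= 1] x.
    by apply: closureS cx => y; exact: ltW.
  by rewrite -(closure_id _).1//; exact: closed_sqn_le.
split; last by rewrite /oball /= x1 ltxx.
move=> B /nbhs_box[r r0 rB].
pose t := Num.min (r / 2) (1 / 2).
have t0 : 0 < t by rewrite lt_min !divr_gt0.
have t1 : t <= 1 / 2 by rewrite ge_min lexx orbT.
have tr : t < r.
  by rewrite (le_lt_trans (_ : _ <= r / 2))// ?ge_min ?lexx// ltr_pdivrMr// ltr_pMr// ltr1n.
exists ((1 - t) *: x); split.
  by rewrite /oball /= sqnZ x1 mulr1 expr_lt1 //; lra.
apply: rB => i; rewrite mxE (_ : _ - _ = t * x ord0 i); last by ring.
rewrite normrM (gtr0_norm t0) (le_lt_trans _ tr)// ler_piMr ?(ltW t0)//.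
by apply: sqn_le1_coord; rewrite x1.
Qed.

Lemma star_connected n (A : set 'rV[R]_n) : A 0 ->
  (forall x t, A x -> 0 <= t <= 1 -> A (t *: x)) -> connected A.
Proof.
move=> A0 star.
have -> : A = \bigcup_(x in A) ((fun t : R => t *: x) @` `[0, 1]).
  apply/seteqP; split => [x Ax|x [y Ay [t]]].
    by exists x => //; exists 1; rewrite ?scale1r//= in_itv/= ler01 lexx.
  by rewrite /= in_itv/= => t01 <-; exact: star.
apply: bigcup_connected.
  by exists 0 => x Ax; exists 0; rewrite ?scale0r//= in_itv/= lexx ler01.
move=> x Ax; apply: connected_continuous_connected; first exact: segment_connected.
apply: continuous_subspaceT => t.
apply: (@cvg_rV _ _ (nbhs t)) => i.
under eq_fun do rewrite mxE; rewrite mxE.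
by apply: contM; [move=> ?; exact: cvg_id|exact: contC].
Qed.

Lemma connected_oball n : connected (oball n).
Proof.
have s0 : sqn (0 : 'rV[R]_n) = 0.
  by rewrite /sqn big1// => i _; rewrite mxE expr0n.
apply: star_connected; first by rewrite /oball/= s0.
move=> x t x1 /andP[t0 t1]; rewrite /oball /= sqnZ (le_lt_trans _ x1)//.
by rewrite ler_piMl ?sqn_ge0// expr_le1.
Qed.

Lemma sqn_tl n (x : 'rV[R]_n.+1) : sqn x = x ord0 ord0 ^+ 2 + sqn (tl x).
Proof.
by rewrite /sqn big_ord_recl; congr (_ + _); apply: eq_bigr => i _; rewrite tlE.
Qed.

(** The two closed hemispheres are graphs over the closed unit ball of R^(m+1) and meet on the
    equator, which is nonempty because this ball has positive dimension. *)
Lemma connected_sphere m : connected (boundary (oball m.+2)).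
Proof.
rewrite boundary_oball.
pose g (e : R) (x : 'rV[R]_m.+1) : 'rV[R]_m.+2 := rV_cons (e * Num.sqrt (1 - sqn x), x).
pose B := [set x : 'rV[R]_m.+1 | sqn x <= 1].
have cB : connected B.
  have s0 : sqn (0 : 'rV[R]_m.+1) = 0.
    by rewrite /sqn big1// => i _; rewrite mxE expr0n.
  apply: star_connected; first by rewrite /B/= s0.
  move=> x t x1 /andP[t0 t1]; rewrite /B /= sqnZ (le_trans _ x1)//.
  by rewrite ler_piMl ?sqn_ge0// expr_le1.
have cg e : connected (g e @` B).
  apply: connected_continuous_connected => //; apply: continuous_subspaceT => x.
  apply: (@cvg_rV _ _ (nbhs x)) => i; case: (unliftP ord0 i) => [j ->|->].
    under eq_fun do rewrite rV_consES; rewrite rV_consES /=.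
    exact: (@continuous_coord R m.+1 j x).
  under eq_fun do rewrite rV_consE0; rewrite rV_consE0 /=.
  have h : continuous (fun y : 'rV[R]_m.+1 => e * Num.sqrt (1 - sqn y)).
    apply: contM; first exact: contC.
    apply: (cont_comp (F := Num.sqrt)); first exact: sqrt_continuous.
    by apply: contB; [exact: contC|exact: cont_sqn].
  exact: (h x).
have -> : [set x : 'rV[R]_m.+2 | sqn x = 1] = g 1 @` B `|` g (-1) @` B.
  apply/seteqP; split => [x x1|x].
    have tx : sqn (tl x) <= 1.
      by move: x1; rewrite /= sqn_tl => <-; rewrite lerDr sqr_ge0.
    have E : 1 - sqn (tl x) = x ord0 ord0 ^+ 2.
      by move: x1; rewrite /= sqn_tl => <-; rewrite addrK.
    have gE e : e * `|x ord0 ord0| = x ord0 ord0 -> g e (tl x) = x.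
      move=> h; rewrite /g E sqrtr_sqr h -[RHS]rV_unconsK; congr rV_cons.
    have [x0|x0] := leP 0 (x ord0 ord0); [left|right]; exists (tl x) => //; apply: gE.
      by rewrite ger0_norm// mul1r.
    by rewrite ltr0_norm// mulN1r opprK.
  have gs e y : e ^+ 2 = 1 -> B y -> sqn (g e y) = 1.
    move=> e1 By; rewrite sqn_tl /g rV_consE0 tl_cons /= exprMn e1 mul1r.
    by rewrite sqr_sqrtr ?subr_ge0// subrK.
  by move=> [[y By <-]|[y By <-]]; apply: gs => //; rewrite ?expr1n// sqrrN expr1n.
apply: connectedU => //.
pose y : 'rV[R]_m.+1 := unitv ord0.
have y1 : sqn y = 1.
  rewrite /sqn (bigD1 ord0)//= unitvE eqxx expr1n big1 ?addr0// => i i0.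
  by rewrite unitvE (negbTE i0) expr0n.
have By : B y by rewrite /B /= y1.
exists (rV_cons (0, y)); split; exists y => //; rewrite /g y1 subrr sqrtr0 mulr0 //.
Qed.

Lemma smooth_domain_oball n : smooth_domain (oball n.+1).
Proof.
split.
- exact: open_oball.
- exact: connected_oball.
- exists 0; rewrite /oball /= /sqn big1// => i _; by rewrite mxE expr0n.
- move=> x0; rewrite boundary_oball => /= x01.
  (* The gradient 2x of this defining function vanishes only at the origin, which the neighbourhood
     excludes. *)
  exists [set x | 0 < sqn x], (fun x => sqn x - 1); split.
  + split; last by rewrite /= x01.
    by apply: (@open_comp _ _ (@sqn R n.+1) [set t | 0 < t]);
      [move=> x _; exact: cont_sqn|exact: open_gt].
  + have s : smooth (fun x : 'rV[R]_n.+1 => sqn x - 1).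
      by apply: smoothB; [exact: smooth_sqn|exact: smooth_cst].
    have h k (V : set 'rV[R]_n.+1) g : Ck k setT g -> Ck k V g.
      elim: k g => [|k IH] g /= [cg pg]; split => //; first by move=> x _; exact: cg.
        by move=> x _; exact: cg.
      by move=> i; have [p1 p2] := pg i; split; [move=> x _; exact: p1|exact: IH].
    by move=> k; apply: h; exact: s.
  + move=> x /= x0'; apply: contrapT => /forallNP h.
    move: x0'; rewrite /sqn big1 ?ltxx// => i _.
    have := h i; move=> /negP; rewrite negbK.
    have := is_deriveB_fun (is_derive_sqn x i) (is_derive_cst_fun 1 x (unitv i)).
    move=> /partialE ->; rewrite subr0 mulf_eq0 pnatr_eq0/= => /eqP ->.
    by rewrite expr0n.
  + by apply/seteqP; split => x [/= a b]; split => //; move: a; rewrite /oball /= subr_lt0.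
Qed.

(** * Test functions and cutoffs on the ball *)

Section test_functions.
Variable n : nat.
Implicit Types f : 'rV[R]_n -> R.

Lemma test_function_oball f (c : R) : c < 1 -> smooth f ->
  (forall x, f x != 0 -> sqn x <= c) -> test_function (oball n) f.
Proof.
move=> c1 sf fc; split => //; exists [set x | sqn x <= c]; split.
- by apply: compact_sqn_le; exact: ltW.
- by move=> x /= xc; exact: le_lt_trans c1.
- by move=> x xc; apply: contrapT => /eqP /fc.
Qed.

Lemma test_function_supp f : test_function (oball n) f ->
  (forall x, f x != 0 -> sqn x < 1) /\
  (forall i x, partial i f x != 0 -> sqn x < 1).
Proof.
move=> [sf [K [cK KB fK]]]; split.
  move=> x fx; apply: KB; apply: contrapT => /fK /eqP; exact/negP.
move=> i x fx; apply: KB; apply: contrapT => nKx; move/eqP: fx; apply.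
have oK : open (~` K) by apply: closed_openC; apply: compact_closed => //; exact: norm_hausdorff.
have h : \forall y \near x, 0 = f y.
  have : nbhs x (~` K) by apply: open_nbhs_nbhs; split.
  by apply: filterS => y /fK ->.
have := near_eq_is_derive h (is_derive_cst_fun 0 x (unitv i)).
exact: partialE.
Qed.

Lemma bms_compact_supp f : continuous f -> (forall x, f x != 0 -> sqn x < 1) -> bms f.
Proof.
move=> cf fc; have fcube x : f x != 0 -> cube x.
  by move=> /fc /ltW x1 i; exact: sqn_le1_coord.
split => //; first exact: continuous_measurable_rV.
have [M hM] := continuous_bounded_compact (@compact_cube R n) cf.
exists `|M| => x; have [->|/fcube] := eqVneq (f x) 0; first by rewrite normr0.
by move=> /hM h; exact: le_trans (ler_norm _).
Qed.

(** The shift by [e] gives a compact support inside the ball. The value is nowhere [1], but tends to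
    [1] at each point of the ball as [e] tends to [0]. *)
Definition cutoff (e : R) (x : 'rV[R]_n) : R := damped 0 e (1 - e - sqn x).

Lemma cutoff_ge0 e x : 0 <= cutoff e x. Proof. exact: damped_ge0. Qed.

Lemma cutoff_le1 e x : 0 <= e -> cutoff e x <= 1. Proof. exact: damped0_le1. Qed.

Lemma smooth_cutoff e : 0 < e -> smooth (cutoff e).
Proof.
move=> e0; apply: (smooth_comp (F := damped 0 e)).
  by apply: smoothB; [exact: smooth_cst|exact: smooth_sqn].
by move=> k; exact: Ck1_damped.
Qed.

Lemma cutoff_supp e x : cutoff e x != 0 -> sqn x <= 1 - e.
Proof.
apply: contra_neqT; rewrite -ltNge => h; rewrite /cutoff damped_le0//.
by rewrite subr_le0 ltW.
Qed.

Lemma test_function_cutoff e f : 0 < e -> smooth f ->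
  test_function (oball n) (fun x => f x * cutoff e x).
Proof.
move=> e0 sf; apply: (@test_function_oball _ (1 - e)).
- by rewrite ltrBlDr ltrDl.
- by apply: smoothM => //; exact: smooth_cutoff.
- by move=> x; rewrite mulf_eq0 negb_or => /andP[_ /cutoff_supp].
Qed.

Lemma is_derive_cutoff e x i : 0 < e ->
  is_derive x (unitv i) (cutoff e)
    (- (2 * x ord0 i * (e * damped (- 2) e (1 - e - sqn x)))).
Proof.
move=> e0.
have h := is_deriveB_fun (is_derive_cst_fun (1 - e) x (unitv i)) (is_derive_sqn x i).
have := is_derive_comp1 h (is_derive_damped 0 (1 - e - sqn x) e0).
move=> H; refine (is_derive_eq H _); rewrite !sub0r; ring.
Qed.

Lemma cvg_cutoff (u : nat -> R) x : (forall k, 0 < u k) -> u k @[k --> \oo] --> 0 ->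
  sqn x < 1 -> cutoff (u k) x @[k --> \oo] --> (1 : R).
Proof.
move=> u_gt0 u0 x1.
have d : 1 - u k - sqn x @[k --> \oo] --> 1 - sqn x.
  rewrite -[X in _ --> X - _]subr0; apply: cvgB; last exact: cvg_cst.
  by apply: cvgB => //; exact: cvg_cst.
have c : expR (- (u k / (1 - u k - sqn x))) @[k --> \oo] --> (1 : R).
  rewrite -[X in _ --> X](_ : expR (- (0 / (1 - sqn x))) = 1); last first.
    by rewrite mul0r oppr0 expR0.
  apply: continuous_cvg; first exact: continuous_expR.
  apply: cvgN; apply: cvgM => //; apply: cvgV => //.
  by rewrite subr_eq0 gt_eqF.
apply: cvg_trans c; apply: near_eq_cvg; near=> k.
rewrite /cutoff damped_gt0 ?powRr0 ?mul1r//.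
near: k; move/cvgrPdist_lt : d => /(_ (1 - sqn x)); rewrite subr_gt0 => /(_ x1).
by apply: filterS => k; rewrite ltr_norml => /andP[_]; rewrite ltrBlDr ltrDl.
Unshelve. all: by end_near. Qed.

End test_functions.
End unit_ball.
Arguments oball {R} n _.

(** * Uniqueness of the distributional gradient *)

Section uniqueness.
Context {R : realType} {n : nat}.

(** A generating family stable under intersection whose indicators are products of Heaviside
    functions, hence limits of smooth products. *)
Definition orthant (b : 'I_n -> R) : set 'rV[R]_n := [set x | forall i, b i < x ord0 i].

Lemma measurable_orthant b : measurable (orthant b).
Proof.
rewrite (_ : orthant b = ~` \bigcup_(i in [set: 'I_n])
    (~` ((fun x : 'rV[R]_n => x ord0 i) @^-1` `]b i, +oo[%classic))); last first.
  apply/seteqP; split => [x hx [i _]|x hx i].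
    by apply; rewrite /= in_itv/= hx.
  apply: contrapT => nx; apply: hx; exists i; first by [].
  by rewrite /setC /= in_itv/= andbT.
apply: measurableC; apply: fin_bigcup_measurable; first exact: finite_finset.
move=> i _; apply: measurableC; rewrite -[X in measurable X]setTI.
by apply: measurable_rV_coord.
Qed.

Definition orthants : set (set 'rV[R]_n) := [set A | exists b, A = orthant b].

Lemma orthantsI : setI_closed orthants.
Proof.
move=> _ _ [b ->] [c ->]; exists (fun i => Num.max (b i) (c i)).
apply/seteqP; split => [x [hb hc] i|x h]; first by rewrite gt_max hb hc.
by split=> i; have := h i; rewrite gt_max => /andP[].
Qed.

Lemma measurable_rVE : @measurable _ 'rV[R]_n = <<s orthants >>.
Proof.
apply/seteqP; split; last first.
  apply: smallest_sub; first exact: sigma_algebra_measurable.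
  by move=> _ [b ->]; exact: measurable_orthant.
apply: smallest_sub; first exact: smallest_sigma_algebra.
move=> A; rewrite -bigcup_seq => -[i _] mA.
have : <<s preimage_set_system setT (fun x : 'rV[R]_n => x ord0 i)
     (@RGenOInfty.G R) >> A.
  rewrite g_sigma_preimageE.
  by move: mA => [B mB <-]; exists B => //; rewrite -RGenOInfty.measurableE.
apply: smallest_sub; first exact: smallest_sigma_algebra.
move=> _ [_ [t ->] <-]; rewrite setTI.
have -> : (fun x : 'rV[R]_n => x ord0 i) @^-1` `]t, +oo[%classic =
    \bigcup_k orthant (fun j => if j == i then t else - k%:R).
  apply/seteqP; split => [x|x [k _ /(_ i)]]; last by rewrite eqxx /= in_itv/= => ->.
  rewrite /= in_itv/= andbT => tx.
  exists (Num.truncn `|x|).+1 => // j; case: eqP => [->//|_].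
  rewrite ltrNl; apply: le_lt_trans (truncnS_gt _).
  apply: le_trans (ler_norm _) _; rewrite normrN.
  by rewrite [leRHS]/Num.norm /= mx_normrE; exact: (le_bigmax _ (fun ij : 'I_1 * 'I_n => `|x ij.1 ij.2|) (ord0, j)).
apply: (sigma_algebra_bigcup (G := orthants)) => k.
by apply: sub_sigma_algebra; eexists.
Qed.

Lemma cvg_prod_seq (I : Type) (r : seq I) (h : nat -> I -> R) (l : I -> R) :
  (forall i, h k i @[k --> \oo] --> l i) ->
  \prod_(i <- r) h k i @[k --> \oo] --> \prod_(i <- r) l i.
Proof.
move=> hl; elim: r => [|i r IH].
  by under eq_fun do rewrite big_nil; rewrite big_nil; exact: cvg_cst.
under eq_fun do rewrite big_cons; rewrite big_cons.
exact: cvgM.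
Qed.

Lemma smooth_prod (I : Type) (r : seq I) (h : I -> 'rV[R]_n -> R) :
  (forall i, smooth (h i)) -> smooth (fun x => \prod_(i <- r) h i x).
Proof.
move=> sh; elim: r => [|i r IH].
  by under eq_fun do rewrite big_nil; exact: smooth_cst.
by under eq_fun do rewrite big_cons; exact: smoothM.
Qed.

(** By dominated convergence the charges agree on the traces of orthants on the ball, since these
    indicators are bounded limits of test functions; uniqueness of measures does the rest. *)
Lemma gradient_unique (nu1 nu2 : {charge set 'rV[R]_n -> \bar R}) :
  (forall f, test_function (oball n) f ->
     charge_integral nu1 (oball n) (EFin \o f) =
     charge_integral nu2 (oball n) (EFin \o f)) ->
  forall A, measurable A -> A `<=` oball n -> fine (nu1 A) = fine (nu2 A).
Proof.
move=> nu12.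
have [P1 [Q1 [E1 I1]]] := charge_integral_decomposition nu1.
have [P2 [Q2 [E2 I2]]] := charge_integral_decomposition nu2.
have mO := @measurable_oball R n.
pose u k : R := k.+1%:R^-1.
have u_gt0 k : 0 < u k by rewrite invr_gt0.
have u0 : u k @[k --> \oo] --> 0 by exact: cvg_harmonic.
have key b : fine (P1 (oball n `&` orthant b)) - fine (Q1 (oball n `&` orthant b)) =
    fine (P2 (oball n `&` orthant b)) - fine (Q2 (oball n `&` orthant b)).
  pose p k (x : 'rV[R]_n) := \prod_i damped 0 (u k) (x ord0 i - b i).
  have sp k : smooth (p k).
    apply: smooth_prod => i; apply: (smooth_comp (F := damped 0 (u k))).
      by apply: smoothB; [exact: smooth_coord|exact: smooth_cst].
    by move=> l; exact: Ck1_damped.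
  have p01 k x : 0 <= p k x <= 1.
    rewrite /p; elim/big_rec : _ => [|i y _ /andP[y0 y1]]; first by rewrite ler01 lexx.
    rewrite mulr_ge0 ?damped_ge0//= mulr_ile1 ?damped_ge0//.
    by rewrite damped0_le1// ltW.
  pose f k x := p k x * cutoff (u k) x.
  have tf k : test_function (oball n) (f k) by exact: test_function_cutoff.
  have f1 k x : `|f k x| <= 1.
    have /andP[p0 p1] := p01 k x.
    rewrite ger0_norm; last by rewrite mulr_ge0// cutoff_ge0.
    by rewrite mulr_ile1// ?cutoff_ge0// cutoff_le1// ltW.
  have mf k : measurable_fun setT (f k).
    by apply: continuous_measurable_rV; apply: smooth_continuous; have [] := tf k.
  have lim (M : {finite_measure set 'rV[R]_n -> \bar R}) :
     \int[M]_(x in oball n) f k x @[k --> \oo] --> fine (M (oball n `&` orthant b)).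
    have -> : fine (M (oball n `&` orthant b)) = \int[M]_(x in oball n) \prod_i hv (x ord0 i - b i).
      rewrite -(@Rintegral_one _ _ _ M); last exact: measurableI (measurable_orthant b).
      rewrite Rintegral_mkcondr; apply: eq_Rintegral => x _; rewrite patchE.
      case: ifPn => xb.
        rewrite inE in xb; rewrite big1// => i _.
        by rewrite /hv subr_gt0 xb.
      apply/esym/eqP/prodf_eq0.
      have : exists i, ~~ (b i < x ord0 i).
        apply: contrapT => /forallNP h; move/negP: xb; apply; rewrite inE => i.
        by apply/negPn/negP; exact: h.
      by move=> [i bi]; exists i => //; rewrite /hv subr_gt0 (negbTE bi).
    apply: (@Rintegral_dct _ _ _ _ _ mO _ _ (fun=> 1)).
    - by move=> k; exact: measurable_funTS.
    - apply: measurable_funTS; apply: measurable_prod => i _.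
      apply: measurableT_comp; first exact: measurable_hv.
      by apply: measurable_funB => //; exact: measurable_rV_coord.
    - move=> x x1; rewrite -[X in _ --> X]mulr1; apply: cvgM; last exact: cvg_cutoff.
      by apply: cvg_prod_seq => i; exact: cvg_damped0.
    - exact: finite_measure_integrable_cst.
    - by move=> k x _; exact: f1.
  have L1 := cvgB (lim P1) (lim Q1); have L2 := cvgB (lim P2) (lim Q2).
  have E k : \int[P1]_(x in oball n) f k x - \int[Q1]_(x in oball n) f k x =
      \int[P2]_(x in oball n) f k x - \int[Q2]_(x in oball n) f k x.
    have := nu12 _ (tf k).
    rewrite (charge_integral_fineE I1 mO (mf k) (f1 k)).
    by rewrite (charge_integral_fineE I2 mO (mf k) (f1 k)) => -[].
  have F : (fun k => \int[P1]_(x in oball n) f k x - \int[Q1]_(x in oball n) f k x) =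
      (fun k => \int[P2]_(x in oball n) f k x - \int[Q2]_(x in oball n) f k x).
    exact/funext.
  have L1' : (fun k => \int[P1]_(x in oball n) f k x - \int[Q1]_(x in oball n) f k x) @ \oo -->
     fine (P1 (oball n `&` orthant b)) - fine (Q1 (oball n `&` orthant b)) by exact: L1.
  have L2' : (fun k => \int[P2]_(x in oball n) f k x - \int[Q2]_(x in oball n) f k x) @ \oo -->
     fine (P2 (oball n `&` orthant b)) - fine (Q2 (oball n `&` orthant b)) by exact: L2.
  rewrite F in L1'; exact: (cvg_unique _ L1' L2').
(* Uniqueness on a generating family concerns nonnegative measures, so the equality P1 - Q1 = P2 -
   Q2 is restated as P1 + Q2 = P2 + Q1. *)
pose m1 := mrestr (measure_add P1 Q2) mO.
pose m2 := mrestr (measure_add P2 Q1) mO.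
have m1E A : m1 A = (P1 (A `&` oball n) + Q2 (A `&` oball n))%E by rewrite /m1 /mrestr measure_addE.
have m2E A : m2 A = (P2 (A `&` oball n) + Q1 (A `&` oball n))%E by rewrite /m2 /mrestr measure_addE.
have fin (M : {finite_measure set 'rV[R]_n -> \bar R}) A : measurable A ->
   M (A `&` oball n) \is a fin_num.
  by move=> mA; apply: fin_num_measure; exact: measurableI.
have m12 A : measurable A -> m1 A = m2 A.
  apply: (measure_unique orthants (fun k => orthant (fun=> - k%:R))).
  - exact: measurable_rVE.
  - exact: orthantsI.
  - by move=> k; eexists.
  - apply/seteqP; split => // x _; exists (Num.truncn `|x|).+1 => // j.
    rewrite ltrNl; apply: le_lt_trans (truncnS_gt _).
    apply: le_trans (ler_norm _) _; rewrite normrN.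
    by rewrite [leRHS]/Num.norm /= mx_normrE; exact: (le_bigmax _ (fun ij : 'I_1 * 'I_n => `|x ij.1 ij.2|) (ord0, j)).
  - move=> _ [b ->]; have mb := measurable_orthant b.
    rewrite [LHS]m1E [RHS]m2E -(fineK (fin P1 _ mb)) -(fineK (fin Q2 _ mb)).
    rewrite -(fineK (fin P2 _ mb)) -(fineK (fin Q1 _ mb)) -!EFinD; congr EFin.
    rewrite setIC; have := key b; lra.
  - move=> k; have mb := measurable_orthant (fun=> - k%:R).
    rewrite [ltLHS]m1E -(fineK (fin P1 _ mb)) -(fineK (fin Q2 _ mb)) -EFinD.
    by rewrite ltry.
move=> A mA AO; rewrite E1// E2//.
have := m12 _ mA; rewrite m1E m2E => E.
have : (fine (P1 (A `&` oball n)) + fine (Q2 (A `&` oball n)) =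
  fine (P2 (A `&` oball n)) + fine (Q1 (A `&` oball n))).
  by rewrite -!fineD ?fin// E.
rewrite (setIidl AO); lra.
Qed.

End uniqueness.

(** * Minimality of calibrated functions *)

Section calibration.
Context {R : realType} {n : nat}.
Local Notation "'lam' n" := (@lebesgue_rV R n) (at level 10, n at level 8).
Local Notation Omega := (@oball R n).
Implicit Types (u v f a w : 'rV[R]_n -> R).

Let mO : measurable Omega := @measurable_oball R n.

Lemma lebesgue_oball_lty : (lam n Omega < +oo)%E.
Proof.
apply: (@le_lt_trans _ _ (lam n (box 0 2))); last exact: lebesgue_rV_box_lty.
apply: le_measure; rewrite ?inE//; first exact: measurable_box.
move=> x x1 i; rewrite mxE sub0r normrN (le_lt_trans (sqn_le1_coord i (ltW x1)))//.
by rewrite ltr1n.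
Qed.

Lemma trace_ae f v x (e : R) : 0 < e ->
  ess_sup_on (Omega `&` [set y | enorm (x - y) < r])
      (fun y => `|f x - v y|%:E) @[r --> 0^'+] --> 0%E ->
  exists2 r : R, 0 < r & {ae lam n, forall y, Omega y -> enorm (x - y) < r -> `|f x - v y| <= e}.
Proof.
move=> e0 tr.
have : \forall r \near 0^'+, (ess_sup_on (Omega `&` [set y | (enorm (x - y) < r)%R])
      (fun y => `|f x - v y|%:E) < e%:E)%E.
  have N : nbhs (0%E : \bar R) [set z | (z < e%:E)%E].
    by apply: open_ereal_lt'; rewrite lte_fin.
  exact: (tr _ N).
move=> h; have : \forall r \near (0 : R)^'+, (0 < r) /\
   (ess_sup_on (Omega `&` [set y | (enorm (x - y) < r)%R])
      (fun y => `|f x - v y|%:E) < e%:E)%E.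
  by apply: filterS2 (nbhs_right_gt 0) h => r r0; split.
move=> /(@filter_ex _ _ _)[r [r0 /ereal_inf_lt[y ay ye]]].
exists r => //; apply: filterS ay => z h1 Oz zr.
by rewrite -lee_fin (le_trans (h1 _) (ltW ye)).
Qed.

Lemma continuous_enormB (x : 'rV[R]_n) : continuous (fun y : 'rV[R]_n => enorm (x - y)).
Proof.
apply: (cont_comp (F := Num.sqrt)); first exact: sqrt_continuous.
apply: cont_sum => i; under eq_fun do rewrite !mxE.
by apply: contX; apply: contB; [exact: contC|exact: continuous_coord].
Qed.

(** The trace condition is local at each boundary point; compactness of the closed ball makes it
    uniform in a shell. Interior points are harmless, since a thin enough shell avoids a
    neighbourhood of them. *)
Lemma trace_difference f u v (e : R) : 0 < e ->
  BV_with_trace Omega f u -> BV_with_trace Omega f v ->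
  exists2 t : R, 0 < t & {ae lam n, forall y, Omega y -> 1 - t < sqn y -> `|u y - v y| <= e}.
Proof.
move=> e0 [_ tu] [_ tv].
(* Each boundary point has its own null set and only finitely many of them may be united. The
   product with the almost-everywhere filter lets the compactness principle do this; the equation
   [i.2 = x] in [P] ties the generic point to the covered one. *)
pose F := filter_prod (0 : R)^'+ (almost_everywhere (lam n)).
have FF : Filter F by exact: filter_prod_filter.
pose P (i : R * 'rV[R]_n) (x : 'rV[R]_n) :=
  Omega i.2 -> i.2 = x -> 1 - i.1 < sqn i.2 -> `|u i.2 - v i.2| <= e.
have cB : compact [set x : 'rV[R]_n | sqn x <= 1] by exact: compact_sqn_le.
have : \forall i \near F, [set x : 'rV[R]_n | sqn x <= 1] `<=` P i.
  move/compact_near_coveringP : cB => /(_ _ F P FF); apply=> x /= x1.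
  have [xlt|xge] := ltP (sqn x) 1.
    have hx : nbhs x [set y | sqn y < (1 + sqn x) / 2].
      apply: open_nbhs_nbhs; split; last by rewrite /=; lra.
      by apply: (@open_comp _ _ (@sqn R n) [set t | t < (1 + sqn x) / 2]);
        [move=> y _; exact: cont_sqn|exact: open_lt].
    exists ([set y | sqn y < (1 + sqn x) / 2], [set i | i.1 < (1 - sqn x) / 2]) => /=.
      split => //; exists ([set t | t < (1 - sqn x) / 2], setT) => /=.
        by split; [apply: nbhs_right_lt; lra|exact: filterT].
      by move=> [t y] [].
    move=> [y [t z]] /= [hy ht] _ zy; rewrite zy => h.
    by exfalso; move: hy ht h => /=; lra.
  have sx : sqn x = 1 by apply/eqP; rewrite eq_le x1.
  have bx : boundary Omega x by rewrite boundary_oball.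
  have e2 : 0 < e / 2 by rewrite divr_gt0.
  have [r1 r10 A1] := trace_ae e2 (tu x bx).
  have [r2 r20 A2] := trace_ae e2 (tv x bx).
  have hx (r : R) : 0 < r -> nbhs x [set y : 'rV[R]_n | enorm (x - y) < r].
    move=> r0; apply: open_nbhs_nbhs; split; last by rewrite /= subrr enorm0.
    by apply: (@open_comp _ _ (fun y : 'rV[R]_n => enorm (x - y)) [set t | t < r]);
      [move=> y _; exact: continuous_enormB|exact: open_lt].
  exists ([set y | enorm (x - y) < r1] `&` [set y | enorm (x - y) < r2],
    [set i | Omega i.2 -> enorm (x - i.2) < r1 -> enorm (x - i.2) < r2 ->
       `|u i.2 - v i.2| <= e]) => /=.
    split; first by apply: filterI; exact: hx.
    exists (setT, [set y | Omega y -> enorm (x - y) < r1 -> enorm (x - y) < r2 ->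
       `|u y - v y| <= e]) => /=; last by move=> [t y] [].
    split; first exact: filterT.
    apply: filterS2 A1 A2 => y h1 h2 Oy y1 y2.
    rewrite (_ : u y - v y = (f x - v y) - (f x - u y)); last by ring.
    rewrite (le_trans (ler_normB _ _))// (splitr e) lerD ?h1 ?h2//.
  by move=> [y [t z]] /= [[hy1 hy2] h] Oz /= zy _; subst z; exact: h.
move=> [[A B] /= [hA hB] AB].
have [t [t0 At]] : exists t, 0 < t /\ A t.
  by apply: (@filter_ex _ (0 : R)^'+); apply: filterI => //; exact: nbhs_right_gt.
exists t => //; apply: filterS hB => y By Oy hy.
by apply: (AB (t, y)) => //=; exact: ltW.
Qed.

(** The gradient of [cutoff e] at [x] is - 2 [rho e x] times [x]. *)
Let rho (e : R) (x : 'rV[R]_n) : R := e * damped (- 2) e (1 - e - sqn x).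

Let rho_ge0 e x : 0 < e -> 0 <= rho e x.
Proof. by move=> e0; rewrite mulr_ge0 ?(ltW e0) ?damped_ge0. Qed.

Let cont_rho e : 0 < e -> continuous (rho e).
Proof.
move=> e0; apply: contM; first exact: contC.
apply: (cont_comp (F := damped (- 2) e)); first by move=> t; exact: derivable_continuous (is_derive_damped _ _ e0).
by apply: contB; [exact: contC|exact: cont_sqn].
Qed.

Let rho_supp e x : 0 < e -> rho e x != 0 -> sqn x < 1.
Proof.
move=> e0; apply: contra_neqT; rewrite -leNgt => x1.
by rewrite /rho damped_le0 ?mulr0//; lra.
Qed.

Let bms_rho e : 0 < e -> bms (rho e).
Proof. by move=> e0; apply: bms_compact_supp; [exact: cont_rho|move=> x; exact: rho_supp]. Qed.

(* Integrating the divergence of [x |-> cutoff e x * x] bounds the mass of the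
   gradient of [cutoff e]. *)
Lemma Rintegral_rho e : 0 < e ->
  \int[lam n]_x (2 * sqn x * rho e x) = n%:R * \int[lam n]_x cutoff e x.
Proof.
move=> e0.
have cc : continuous (cutoff (n := n) e).
  exact: (smooth_continuous (smooth_cutoff n e0)).
have bc : bms (cutoff (n := n) e).
  apply: bms_compact_supp => //.
  by move=> x /cutoff_supp /le_lt_trans; apply; lra.
pose d (i : 'I_n) (x : 'rV[R]_n) := x ord0 i * - (2 * x ord0 i * rho e x) + cutoff e x * 1.
have cx (i : 'I_n) : continuous (fun x : 'rV[R]_n => x ord0 i) by exact: continuous_coord.
have b1 (i : 'I_n) : bms (fun x : 'rV[R]_n => rho e x * - (2 * (x ord0 i) ^+ 2)).
  by apply: bmsMc; [exact: bms_rho|apply: contN; apply: contM; [exact: contC|exact: contX]].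
have dE (i : 'I_n) : d i = fun x : 'rV[R]_n => rho e x * - (2 * (x ord0 i) ^+ 2) + cutoff e x.
  by apply/funext => x; rewrite /d; ring.
have bd i : bms (d i) by rewrite dE; apply: bmsD.
have dd i x : is_derive x (unitv i) (fun y : 'rV[R]_n => y ord0 i * cutoff e y) (d i x).
  have h1 : is_derive x (unitv i) (fun y : 'rV[R]_n => y ord0 i) 1.
    by have := is_derive_coord i x (unitv i); rewrite unitvE eqxx.
  exact: is_deriveM_fun h1 (is_derive_cutoff x i e0).
have cd i : continuous (d i).
  rewrite dE; apply: contD => //.
  by apply: contM; [exact: cont_rho|apply: contN; apply: contM; [exact: contC|exact: contX]].
have I0 i : \int[lam n]_x d i x = 0.
  apply: (@Rintegral_partial _ _ (fun y : 'rV[R]_n => y ord0 i * cutoff e y) _ i) => //.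
  move=> x; rewrite mulf_eq0 negb_or => /andP[_ cx0] j; apply: sqn_le1_coord.
  by move/cutoff_supp : cx0 => /le_trans; apply; lra.
have I1 i : \int[lam n]_x (rho e x * - (2 * (x ord0 i) ^+ 2)) = - \int[lam n]_x cutoff e x.
  by apply/eqP; rewrite -subr_eq0 opprK -bms_RintegralD// -dE I0.
have : \sum_(i < n) \int[lam n]_x (rho e x * - (2 * (x ord0 i) ^+ 2)) =
   - (n%:R * \int[lam n]_x cutoff e x).
  under eq_bigr do rewrite I1.
  by rewrite sumr_const card_ord mulNrn mulr_natl.
have ib (i : 'I_n) := bms_integrable (b1 i).
have [<- _] := Rintegral_sum measurableT (index_enum 'I_n) ib.
move=> /eqP; rewrite -eqr_oppLR => /eqP <-.
have bs : bms (fun x => rho e x * (2 * sqn x)).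
  by apply: bmsMc; [exact: bms_rho|apply: contM; [exact: contC|exact: cont_sqn]].
rewrite -mulN1r -RintegralZl//; last first.
  by have [_] := Rintegral_sum measurableT (index_enum 'I_n) ib.
apply: eq_Rintegral => x _; rewrite -mulr_sumr sumrN -mulr_sumr /sqn; ring.
Qed.

Lemma Rintegral_oball (h : 'rV[R]_n -> R) : (forall x, h x != 0 -> sqn x < 1) ->
  \int[lam n]_(x in Omega) h x = \int[lam n]_x h x.
Proof.
move=> h0; rewrite Rintegral_mkcond; apply: eq_Rintegral => x _; rewrite patchE.
case: ifPn => //; apply: contraNeq; rewrite eq_sym => /h0 x1.
by rewrite inE.
Qed.

Lemma Rintegral_rho_le e : 0 < e ->
  \int[lam n]_(x in Omega) (2 * sqn x * rho e x) <= n%:R * fine (lam n Omega).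
Proof.
move=> e0; rewrite Rintegral_oball; last first.
  by move=> x; rewrite mulf_eq0 negb_or => /andP[_]; exact: rho_supp.
rewrite Rintegral_rho// ler_wpM2l//.
rewrite -(@Rintegral_oball (cutoff e)); last first.
  by move=> x /cutoff_supp /le_lt_trans; apply; lra.
rewrite -[leRHS]mul1r -Rintegral_cst//; apply: le_Rintegral => //.
- apply: (integrableS measurableT) => //; apply: bms_integrable.
  apply: bms_compact_supp; first exact: (smooth_continuous (smooth_cutoff n e0)).
  by move=> x /cutoff_supp /le_lt_trans; apply; lra.
- apply: measurable_bounded_integrable => //; first exact: lebesgue_oball_lty.
  by exists `|1|; split; rewrite ?num_real// => y h1 x _; exact: ltW.
- by move=> x _; rewrite cutoff_le1// ltW.
Qed.

Let u_ k : R := k.+1%:R^-1.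
Let u_gt0 k : 0 < u_ k. Proof. by rewrite invr_gt0. Qed.
Let u_cvg : u_ k @[k --> \oo] --> 0. Proof. exact: cvg_harmonic. Qed.

(** [g k] is dominated by the gradient of the cutoff, whose mass is bounded uniformly in [k]. Near
    the sphere [w] is small; away from it [rho] tends to [0] uniformly and [w] is integrable. *)
Lemma cvg_boundary_term w (g : nat -> 'rV[R]_n -> R) (K : R) :
  (lam n).-integrable Omega (EFin \o w) ->
  (forall e, 0 < e -> exists2 t, 0 < t &
     {ae lam n, forall y, Omega y -> 1 - t < sqn y -> `|w y| <= e}) ->
  (forall k, measurable_fun setT (g k)) ->
  (forall k x, Omega x -> `|g k x| <= K * rho (u_ k) x) ->
  \int[lam n]_(x in Omega) (w x * g k x) @[k --> \oo] --> 0.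
Proof.
move=> iw we mg gK.
have K0 : 0 <= Num.max K 0 by rewrite le_max lexx orbT.
pose C := Num.max K 0 * (n%:R * fine (lam n Omega)).
have C0 : 0 <= C by rewrite mulr_ge0// mulr_ge0// fine_ge0.
pose I := \int[lam n]_(x in Omega) `|w x|.
have I0 : 0 <= I by exact: Rintegral_ge0.
apply/cvgrPdist_le => e e0.
pose e1 := e / (2 * (C + 1)).
have C1 : 0 < C + 1 by rewrite ltr_wpDl.
have e10 : 0 < e1 by rewrite divr_gt0// mulr_gt0.
have [t t0 wt] := we e1 e10.
(* With [s <= 1 / 2] the shell satisfies [1 <= 2 * sqn x], so there [rho] is below the integrand
   whose mass [Rintegral_rho_le] bounds. *)
pose s := Num.min t (1 / 2).
have s0 : 0 < s by rewrite lt_min t0 divr_gt0.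
have s12 : s <= 1 / 2 by rewrite ge_min lexx orbT.
have st : s <= t by rewrite ge_min lexx.
have lim : Num.max K 0 * (u_ k / (s - u_ k) ^+ 2) * I @[k --> \oo] --> (0 : R).
  rewrite -[X in _ --> X](_ : Num.max K 0 * (0 / (s - 0) ^+ 2) * I = 0); last first.
    by rewrite mul0r mulr0 mul0r.
  apply: cvgM; last exact: cvg_cst.
  apply: cvgM; first exact: cvg_cst.
  apply: cvgM => //; apply: cvgV; first by rewrite subr0 expf_neq0// gt_eqF.
  under eq_fun do rewrite expr2; rewrite expr2.
  by apply: cvgM; (apply: cvgB => //; exact: cvg_cst).
near=> k.
have uk : u_ k < s.
  near: k; move/cvgrPdist_lt : u_cvg => /(_ s s0); apply: filterS => k.
  by rewrite sub0r normrN gtr0_norm.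
have small : Num.max K 0 * (u_ k / (s - u_ k) ^+ 2) * I <= e / 2.
  near: k; move/cvgrPdist_le : lim => /(_ (e / 2)); rewrite divr_gt0// => /(_ isT).
  by apply: filterS => k; rewrite sub0r normrN; exact: le_trans (ler_norm _).
set dl := Num.max K 0 * (u_ k / (s - u_ k) ^+ 2) in small.
rewrite sub0r normrN.
have rk x : Omega x -> sqn x <= 1 - s -> rho (u_ k) x <= u_ k / (s - u_ k) ^+ 2.
  move=> Ox xs; rewrite /rho ler_wpM2l ?(ltW (u_gt0 k))//.
  have p0 : 0 < 1 - u_ k - sqn x by lra.
  have q0 : 0 < s - u_ k by lra.
  rewrite damped_gt0// powR_invn ?(ltW p0)//.
  apply: (@le_trans _ _ ((1 - u_ k - sqn x) ^- 2)).
    rewrite ler_piMr ?invr_ge0 ?exprn_ge0 ?(ltW p0)// expRN_le1// divr_ge0 ?(ltW p0)//.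
    exact: ltW.
  rewrite lef_pV2 ?posrE ?exprn_gt0// lerXn2r ?nnegrE ?(ltW p0) ?(ltW q0)//.
  lra.
have dl0 : 0 <= dl.
  by rewrite mulr_ge0// mulr_ge0 ?(ltW (u_gt0 k))// invr_ge0 exprn_ge0//; lra.
have bd : {ae lam n, forall x, Omega x ->
    `|w x * g k x| <= e1 * Num.max K 0 * (2 * sqn x * rho (u_ k) x) + dl * `|w x|}.
  apply: filterS wt => x hx Ox; rewrite normrM.
  have gk : `|g k x| <= Num.max K 0 * rho (u_ k) x.
    apply: le_trans (gK k x Ox) _; rewrite ler_wpM2r ?rho_ge0//.
    by rewrite le_max lexx.
  have r0 := rho_ge0 x (u_gt0 k).
  have [xs|xs] := ltP (1 - s) (sqn x).
    have wx : `|w x| <= e1 by apply: hx => //; lra.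
    rewrite -[leLHS]addr0 lerD ?(mulr_ge0 dl0)//.
    apply: (@le_trans _ _ (e1 * (Num.max K 0 * rho (u_ k) x))); first by rewrite ler_pM.
    rewrite -mulrA ler_wpM2l ?(ltW e10)// ler_wpM2l//.
    rewrite ler_peMl//; lra.
  apply: (@le_trans _ _ (dl * `|w x|)); last first.
    by rewrite lerDr mulr_ge0 ?(mulr_ge0 (ltW e10))// mulr_ge0// mulr_ge0 ?sqn_ge0.
  rewrite mulrC ler_wpM2r// (le_trans gk)// ler_wpM2l//.
  exact: rk.
have mR : measurable_fun setT (fun x => 2 * sqn x * rho (u_ k) x).
  apply: continuous_measurable_rV; apply: contM; last exact: cont_rho.
  by apply: contM; [exact: contC|exact: cont_sqn].
have bR : bms (fun x => 2 * sqn x * rho (u_ k) x).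
  rewrite (_ : (fun x => _) = fun x => rho (u_ k) x * (2 * sqn x)).
    by apply: bmsMc; [exact: bms_rho|apply: contM; [exact: contC|exact: cont_sqn]].
  by apply/funext => x; rewrite mulrC.
have iR : (lam n).-integrable Omega (EFin \o (fun x => 2 * sqn x * rho (u_ k) x)).
  by apply: (integrableS measurableT) => //; exact: bms_integrable.
have iW : (lam n).-integrable Omega (EFin \o (fun x => `|w x|)) by exact: integrable_norm iw.
have i1 : (lam n).-integrable Omega (EFin \o (fun x => e1 * Num.max K 0 * (2 * sqn x * rho (u_ k) x))).
  exact: (@integrable_mul_bounded _ _ _ (lam n) Omega mO (fun=> e1 * Num.max K 0) _ `|e1 * Num.max K 0|).
have i2 : (lam n).-integrable Omega (EFin \o (fun x => dl * `|w x|)).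
  exact: (@integrable_mul_bounded _ _ _ (lam n) Omega mO (fun=> dl) _ `|dl|).
have i3 : (lam n).-integrable Omega (EFin \o
   (fun x => e1 * Num.max K 0 * (2 * sqn x * rho (u_ k) x) + dl * `|w x|)).
  exact: (integrableD mO i1 i2).
have mwg : measurable_fun Omega (fun x => w x * g k x).
  apply: measurable_funM; last exact: measurable_funTS.
  by move/measurable_int : iw => /measurable_EFinP.
have ae1 : (\int[lam n]_(x in Omega) `|(w x * g k x)|%:E <=
   \int[lam n]_(x in Omega) (e1 * Num.max K 0 * (2 * sqn x * rho (u_ k) x) + dl * `|w x|)%:E)%E.
  apply: ae_ge0_le_integral => //.
  - by apply/measurable_EFinP; exact: measurableT_comp.
  - move=> x _; rewrite lee_fin addr_ge0 ?(mulr_ge0 dl0)//.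
    by rewrite mulr_ge0 ?(mulr_ge0 (ltW e10))// mulr_ge0 ?rho_ge0// mulr_ge0 ?sqn_ge0.
  - by have /measurable_int := i3.
have iwg : (lam n).-integrable Omega (EFin \o (fun x => w x * g k x)).
  apply/integrableP; split; first exact/measurable_EFinP.
  by apply: (le_lt_trans ae1); rewrite -ge0_fin_numE ?(integrable_fin_num mO i3)//; exact: le_trans (integral_ge0 _ _) ae1.
apply: (le_trans (le_normr_Rintegral mO iwg)).
apply: (@le_trans _ _ (\int[lam n]_(x in Omega) (e1 * Num.max K 0 * (2 * sqn x * rho (u_ k) x) + dl * `|w x|))).
  apply: fine_le => //; last exact: (integrable_fin_num mO i3).
  by have := integrable_fin_num mO (integrable_norm iwg).
rewrite RintegralD// RintegralZl// RintegralZl//.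
rewrite (splitr e) lerD//.
rewrite -mulrA; apply: (@le_trans _ _ (e1 * C)).
  rewrite ler_wpM2l ?(ltW e10)// ler_wpM2l//; exact: Rintegral_rho_le.
rewrite (_ : e1 * C = e / 2 * (C / (C + 1))); last by rewrite /e1 invfM; ring.
rewrite ler_piMr ?divr_ge0 ?(ltW e0)//.
by rewrite ler_pdivrMr// mul1r lerDl.
Unshelve. all: by end_near. Qed.

End calibration.

(** * Gradients given by a density on a parameter space *)

Section representation.
Context {R : realType} {n : nat} d (X : measurableType d) (M : {measure set X -> \bar R}).
Variables (Phi : X -> 'rV[R]_n) (W : 'I_n -> X -> R) (u : 'rV[R]_n -> R).
Local Notation lam := (@lebesgue_rV R n).
Local Notation Omega := (@oball R n).
Hypotheses (mPhi : measurable_fun setT Phi)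
  (iW : forall i, M.-integrable setT (EFin \o W i))
  (iu : lam.-integrable Omega (EFin \o u))
  (uW : forall phi, test_function Omega phi -> forall i,
    \int[lam]_(x in Omega) (u x * partial i phi x) = - \int[M]_p (phi (Phi p) * W i p)).

Let mO : measurable Omega := @measurable_oball R n.

Let mpre A : measurable A -> measurable (Phi @^-1` A).
Proof. by move=> mA; rewrite -[X in measurable X]setTI; exact: mPhi. Qed.

Lemma test_function_bms phi : test_function Omega phi -> bms phi.
Proof.
move=> tphi; have [s0 _] := test_function_supp tphi.
by apply: bms_compact_supp s0; have [sphi _] := tphi; exact: smooth_continuous sphi.
Qed.

Lemma test_function_partial_bms phi i : test_function Omega phi -> bms (partial i phi).
Proof.
move=> tphi; have [_ /(_ i) s1] := test_function_supp tphi.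
apply: bms_compact_supp s1; have [sphi _] := tphi.
exact: smooth_continuous (smooth_partial i sphi).
Qed.

Lemma integrable_mul_bms w h : lam.-integrable Omega (EFin \o w) -> bms h ->
  lam.-integrable Omega (EFin \o (fun x => w x * h x)).
Proof.
move=> iw [mh [K hK] _].
rewrite (_ : (fun x => w x * h x) = fun x => h x * w x); last first.
  by apply/funext => x; rewrite mulrC.
apply: (@integrable_mul_bounded _ _ _ lam Omega mO h w K) => //.
exact: measurable_funTS.
Qed.

Lemma is_gradient_Rintegral w nu : lam.-integrable Omega (EFin \o w) ->
  is_gradient Omega w nu <-> forall phi, test_function Omega phi -> forall i,
    \int[lam]_(x in Omega) (w x * partial i phi x) =
    - fine (charge_integral (nu i) Omega (EFin \o phi)).
Proof.
move=> iw; split=> H phi tphi i.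
  by rewrite /Rintegral (H phi tphi i) fineN.
have [mp [K pK] _] := test_function_bms tphi.
have iwp := integrable_mul_bms iw (test_function_partial_bms i tphi).
rewrite -[LHS]fineK ?(integrable_fin_num mO iwp)//.
rewrite -[X in (- X)%E]fineK; last exact: (charge_integral_fin_num (nu i) mO mp pK).
by rewrite -EFinN; congr EFin; exact: H.
Qed.

Let nu i : {charge set 'rV[R]_n -> \bar R} := pushed_charge (iW i) mPhi.

Let ci_pushed (nu0 : {charge set 'rV[R]_n -> \bar R}) i phi : test_function Omega phi ->
  (forall A, measurable A -> A `<=` Omega -> fine (nu0 A) = \int[M]_(p in Phi @^-1` A) W i p) ->
  fine (charge_integral nu0 Omega (EFin \o phi)) = \int[M]_p (phi (Phi p) * W i p).
Proof.
move=> tphi nuW.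
have [mp [K pK] _] := test_function_bms tphi.
rewrite (charge_integral_represented mPhi (iW i) mO nuW mp pK)/=.
rewrite Rintegral_mkcond; apply: eq_Rintegral => p _; rewrite patchE.
case: ifPn => // h; apply/esym/eqP; rewrite mulf_eq0; apply/orP; left.
apply: contraNT h => h; rewrite inE.
by have [+ _] := test_function_supp tphi; apply.
Qed.

Lemma represented_BV : BV Omega u.
Proof.
split=> //; exists nu; apply/is_gradient_Rintegral => // phi tphi i.
by rewrite uW// (@ci_pushed (nu i) i).
Qed.

Lemma gradientP w : BV Omega w -> is_gradient Omega w (gradient Omega w).
Proof.
by move=> [_ h]; rewrite /gradient; case: pselect => // h'; exact: projT2 (cid h').
Qed.

(** [gradient] is an arbitrary choice among the representing charges; [gradient_unique] identifies
    it with the image of the density on subsets of the ball. *)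
Lemma represented_gradient i A : measurable A -> A `<=` Omega ->
  fine (gradient Omega u i A) = \int[M]_(p in Phi @^-1` A) W i p.
Proof.
move=> mA AO; rewrite -[RHS]/(fine (nu i A)).
apply: gradient_unique mA AO => phi tphi.
have [mp [K pK] _] := test_function_bms tphi.
rewrite -[LHS]fineK; last exact: (charge_integral_fin_num _ mO mp pK).
rewrite -[RHS]fineK; last exact: (charge_integral_fin_num _ mO mp pK).
congr EFin; rewrite (@ci_pushed (nu i) i)//.
apply: oppr_inj; rewrite -uW//; apply/esym.
by have /(is_gradient_Rintegral _ iu) := gradientP represented_BV; apply.
Qed.

End representation.

(** * The calibration inequality *)

Section minimality.
Context {R : realType} {n : nat} d (X : measurableType d) (M : {measure set X -> \bar R}).
Variables (Phi : X -> 'rV[R]_n) (W : 'I_n -> X -> R) (u f a : 'rV[R]_n -> R).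
Variables (V : nat -> 'I_n -> 'rV[R]_n -> R) (eps : nat -> R) (a0 K : R).
Local Notation lam := (@lebesgue_rV R n).
Local Notation Omega := (@oball R n).
Local Notation N := (fun p => enorm (\row_i W i p)).
Hypotheses (mPhi : measurable_fun setT Phi)
  (iW : forall i, M.-integrable setT (EFin \o W i))
  (iN : M.-integrable setT (EFin \o N))
  (uW : forall phi, test_function Omega phi -> forall i,
    \int[lam]_(x in Omega) (u x * partial i phi x) = - \int[M]_p (phi (Phi p) * W i p))
  (ma : measurable_fun setT a) (a0_gt0 : 0 < a0)
  (aK : forall x, Omega x -> a0 <= a x <= K)
  (sV : forall k i, smooth (V k i))
  (divV : forall k x, \sum_i partial i (V k i) x = 0)
  (Va : forall k x, Omega x -> enorm (\row_i V k i x) <= a x + eps k)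
  (aV : forall k p, Omega (Phi p) ->
    a (Phi p) * N p <= \sum_i V k i (Phi p) * W i p + eps k * N p)
  (eps_ge0 : forall k, 0 <= eps k)
  (eps_cvg : eps k @[k --> \oo] --> 0)
  (tu : BV_with_trace Omega f u).

Let mO : measurable Omega := @measurable_oball R n.
Let iu : lam.-integrable Omega (EFin \o u). Proof. by case: tu => -[]. Qed.

Let mpre A : measurable A -> measurable (Phi @^-1` A).
Proof. by move=> mA; rewrite -[X in measurable X]setTI; exact: mPhi. Qed.

Let u_ k : R := k.+1%:R^-1.
Let u_gt0 k : 0 < u_ k. Proof. by rewrite invr_gt0. Qed.
Let u_cvg : u_ k @[k --> \oo] --> 0. Proof. exact: cvg_harmonic. Qed.

Let variation_le : (weighted_variation Omega a u <=
  (\int[M]_(p in Phi @^-1` Omega) (a (Phi p) * N p))%:E)%E.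
Proof.
(* [a] is controlled on the ball only; the truncation is bounded and nonnegative everywhere and
   agrees with [a] there. *)
pose a' x := Num.max (Num.min (a x) K) 0.
have aa' x : Omega x -> a x = a' x.
  move=> Ox; have /andP[h1 h2] := aK Ox.
  by rewrite /a' min_l// max_l// (le_trans (ltW a0_gt0)).
have ma' : measurable_fun setT a'.
  by apply: measurable_maxr => //; apply: measurable_minr.
have a'K x : 0 <= a' x <= Num.max K 0.
  by rewrite /a' le_max lexx orbT/= ge_max !le_max lexx orbT ge_min lexx !orbT.
have nuW i A : measurable A -> A `<=` Omega ->
    fine (gradient Omega u i A) = \int[M]_(p in Phi @^-1` A) W i p.
  by move=> mA AO; exact: (represented_gradient mPhi iW iu uW).
have -> : \int[M]_(p in Phi @^-1` Omega) (a (Phi p) * N p) =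
    \int[M]_(p in Phi @^-1` Omega) (a' (Phi p) * N p).
  by apply: eq_Rintegral => p; rewrite inE => Op; rewrite aa'.
have := represented_variation_le mPhi iW iN mO nuW ma' a'K.
apply: le_trans; rewrite /weighted_variation le_eqVlt; apply/orP; left; apply/eqP.
by apply: eq_integral => x; rewrite inE => Ox; rewrite aa'.
Qed.

(** [H k j] is the field [V k] times a cutoff, and [G k j] its divergence: as [V k] is
    divergence-free, only the gradient of the cutoff is left. *)
Let H k j i x : R := V k i x * cutoff (u_ j) x.
Let G k j (x : 'rV[R]_n) : R :=
  \sum_i V k i x * - (2 * x ord0 i * (u_ j * damped (- 2) (u_ j) (1 - u_ j - sqn x))).

Let tH k j i : test_function Omega (H k j i).
Proof. exact: test_function_cutoff. Qed.

Let divH k j x : \sum_i partial i (H k j i) x = G k j x.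
Proof.
transitivity (\sum_i (V k i x * - (2 * x ord0 i *
    (u_ j * damped (- 2) (u_ j) (1 - u_ j - sqn x))) +
    cutoff (u_ j) x * partial i (V k i) x)).
  apply: eq_bigr => i _; apply: partialE.
  exact: is_deriveM_fun (smooth_is_derive x i (sV k i)) (is_derive_cutoff x i (u_gt0 j)).
by rewrite big_split/= -mulr_sumr divV mulr0 addr0.
Qed.

Let sum_partial k j w : lam.-integrable Omega (EFin \o w) ->
  \sum_i \int[lam]_(x in Omega) (w x * partial i (H k j i) x) =
    \int[lam]_(x in Omega) (w x * G k j x) /\
  lam.-integrable Omega (EFin \o (fun x => w x * G k j x)).
Proof.
move=> iw.
have ih i : lam.-integrable Omega (EFin \o (fun x => w x * partial i (H k j i) x)).
  by apply: integrable_mul_bms => //; exact: test_function_partial_bms.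
have [h1 h2] := Rintegral_sum mO (index_enum 'I_n) ih.
have E x : \sum_i w x * partial i (H k j i) x = w x * G k j x.
  by rewrite -mulr_sumr divH.
split.
  by rewrite -h1; apply: eq_Rintegral => x _; rewrite E.
by move: h2; apply: eq_integrable => // x _ /=; rewrite E.
Qed.

Let V_bounded k i : exists C, forall x, sqn x <= 1 -> `|V k i x| <= C.
Proof.
have c : compact [set x : 'rV[R]_n | sqn x <= 1] by exact: compact_sqn_le.
exact: continuous_bounded_compact c (smooth_continuous (sV k i)).
Qed.

(** Equality of traces enters here, through [trace_difference]: [u - v] is small almost everywhere
    in the region where the gradient of the cutoff concentrates. *)
Let cvg_G k v : BV_with_trace Omega f v ->
  \int[lam]_(x in Omega) ((u x - v x) * G k j x) @[j --> \oo] --> (0 : R).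
Proof.
move=> tv; have iv : lam.-integrable Omega (EFin \o v) by case: tv => -[].
have /choice[C hC] := V_bounded k.
apply: (@cvg_boundary_term _ _ _ _ (\sum_i C i * 2)).
- rewrite (_ : EFin \o _ = (EFin \o u) \- (EFin \o v))%E; last by apply/funext.
  exact: integrableB.
- move=> e e0; exact: trace_difference e0 tu tv.
- move=> j; rewrite (_ : G k j = fun x => \sum_i partial i (H k j i) x); last first.
    by apply/funext => x; rewrite divH.
  apply: measurable_sum => i.
  by have [] := test_function_partial_bms i (tH k j i).
- move=> j x Ox.
  have d0 : 0 <= u_ j * damped (- 2) (u_ j) (1 - u_ j - sqn x).
    by rewrite mulr_ge0 ?damped_ge0 ?(ltW (u_gt0 j)).
  rewrite mulr_suml (le_trans (ler_norm_sum _ _ _))//; apply: ler_sum => i _.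
  rewrite normrM normrN normrM (ger0_norm d0) normrM normr_nat -!mulrA.
  apply: ler_pM => //; first by rewrite mulr_ge0// mulr_ge0.
    by apply: hC; exact: ltW.
  rewrite ler_wpM2l// ler_piMl//.
  exact: sqn_le1_coord (ltW Ox).
Qed.

Let enorm_H k j x : enorm (\row_i H k j i x) <= enorm (\row_i V k i x).
Proof.
apply: ler_wsqrtr; apply: ler_sum => i _; rewrite !mxE exprMn ler_piMr ?sqr_ge0//.
by rewrite expr_le1 ?cutoff_ge0// cutoff_le1// ltW.
Qed.

(** [S j] and [T j] test the gradients of [v] and [u] with the same cut-off field. They differ by a
    boundary term tending to [0], so [S j] tends to the flux of [V k] through the sheets of [u],
    while |V k| <= a + eps k bounds every [S j] by the right-hand side. *)
Let calibration_le k v : BV_with_trace Omega f v ->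
  (weighted_variation Omega a v < +oo)%E ->
  (Defs.total_variation (gradient Omega v) Omega < +oo)%E ->
  \int[M]_(p in Phi @^-1` Omega) (\sum_i V k i (Phi p) * W i p) <=
  fine (weighted_variation Omega a v) +
  eps k * fine (Defs.total_variation (gradient Omega v) Omega).
Proof.
move=> tv wvoo tvoo.
have iv : lam.-integrable Omega (EFin \o v) by case: tv => -[].
pose S j := \sum_i fine (charge_integral (gradient Omega v i) Omega (EFin \o H k j i)).
pose T j := \int[M]_(p in Phi @^-1` Omega) \sum_i H k j i (Phi p) * W i p.
have SE j : S j = - \int[lam]_(x in Omega) (v x * G k j x).
  have [<- _] := sum_partial k j iv; rewrite -sumrN; apply: eq_bigr => i _.
  have /(is_gradient_Rintegral _ iv)gv := gradientP tv.1.
  by rewrite gv// opprK.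
have iHW j i : M.-integrable setT (EFin \o (fun p => H k j i (Phi p) * W i p)).
  have [mH [C hC] _] := test_function_bms (tH k j i).
  apply: (@integrable_mul_bounded _ _ _ M setT measurableT (H k j i \o Phi) (W i) C) => //.
    exact: measurableT_comp.
  by move=> p _; exact: hC.
have TE j : T j = - \int[lam]_(x in Omega) (u x * G k j x).
  have [<- _] := sum_partial k j iu; rewrite -sumrN.
  rewrite /T Rintegral_mkcond.
  have [h _] := Rintegral_sum measurableT (index_enum 'I_n) (iHW j).
  transitivity (\int[M]_p (\sum_i H k j i (Phi p) * W i p)).
    apply: eq_Rintegral => p _; rewrite patchE; case: ifPn => // hp.
    rewrite big1// => i _; apply/eqP; rewrite mulf_eq0; apply/orP; left.
    apply: contraNT hp => hp; rewrite inE.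
    by have [+ _] := test_function_supp (tH k j i); apply.
  by rewrite h; apply: eq_bigr => i _; rewrite uW// opprK.
have ST : S j @[j --> \oo] --> \int[M]_(p in Phi @^-1` Omega) \sum_i V k i (Phi p) * W i p.
  have -> : S = fun j => T j + \int[lam]_(x in Omega) ((u x - v x) * G k j x).
    apply/funext => j; rewrite SE TE.
    have [_ iuG] := sum_partial k j iu; have [_ ivG] := sum_partial k j iv.
    rewrite (_ : \int[lam]_(x in Omega) ((u x - v x) * G k j x) =
      \int[lam]_(x in Omega) (u x * G k j x - v x * G k j x)); last first.
      by apply: eq_Rintegral => x _; rewrite mulrBl.
    by rewrite RintegralB// addKr.
  rewrite -[X in _ --> X]addr0; apply: cvgD; last exact: cvg_G.
  have /choice[C hC] := V_bounded k.
  have mV i : measurable_fun setT (V k i).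
    by apply: continuous_measurable_rV; exact: smooth_continuous.
  have mW i : measurable_fun setT (W i).
    by have /measurable_int/measurable_EFinP := iW i.
  apply: (@Rintegral_dct _ _ _ M _ (mpre mO) _ _ (fun p => \sum_i C i * `|W i p|)).
  - move=> j; apply: measurable_funTS; apply: measurable_sum => i.
    by have /measurable_int/measurable_EFinP := iHW j i.
  - apply: measurable_funTS; apply: measurable_sum => i.
    by apply: measurable_funM => //; exact: measurableT_comp.
  - move=> p Op; apply: cvg_big => [|i _]; first exact: add_continuous.
    apply: cvgM; last exact: cvg_cst.
    rewrite -[X in _ --> X]mulr1; apply: cvgM; first exact: cvg_cst.
    exact: cvg_cutoff.
  - have iC i : M.-integrable (Phi @^-1` Omega) (EFin \o (fun p => C i * `|W i p|)).
      apply: (@integrable_mul_bounded _ _ _ M _ (mpre mO) (fun=> C i) _ `|C i|) => //.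
      apply: integrable_norm; apply: (integrableS measurableT) => //; exact: mpre.
    by have [] := Rintegral_sum (mpre mO) (index_enum 'I_n) iC.
  - move=> j p Op; rewrite (le_trans (ler_norm_sum _ _ _))//; apply: ler_sum => i _.
    rewrite normrM ler_wpM2r// /H normrM.
    rewrite (le_trans _ (hC i (Phi p) (ltW Op)))// ler_piMr//.
    by rewrite ger0_norm ?cutoff_ge0// cutoff_le1// ltW.
apply: (cvgr_to_le ST); apply: nearW => j.
have iwv : (0 <= weighted_variation Omega a v)%E.
  apply: integral_ge0 => x Ox; rewrite lee_fin.
  by have /andP[h _] := aK Ox; rewrite (le_trans (ltW a0_gt0)).
rewrite -lee_fin EFinD EFinM !fineK ?ge0_fin_numE//.
have mH i : measurable_fun setT (H k j i) by have [] := test_function_bms (tH k j i).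
have /choice[C hC] : forall i, exists C, forall x, `|H k j i x| <= C.
  by move=> i; have [] := test_function_bms (tH k j i).
have HC i x : `|H k j i x| <= \sum_i `|C i|.
  apply: (le_trans (hC i x)); apply: (le_trans (ler_norm _)).
  by rewrite (bigD1 i)//= lerDl sumr_ge0.
have mae : measurable_fun setT (fun x => a x + eps k) by exact: measurable_funD.
have := charge_integral_le_variation mO tvoo mH HC mae.
move=> /(_ (fun x Ox => le_trans (enorm_H k j x) (Va k Ox))) h.
apply: (le_trans h); under eq_integral do rewrite EFinD.
rewrite ge0_integralD//=.
- by rewrite integral_cst// muleC lee_add2l.
- move=> x Ox; rewrite lee_fin.
  by have /andP[h1 _] := aK Ox; rewrite (le_trans (ltW a0_gt0)).
- by apply/measurable_EFinP; exact: measurable_funTS.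
- by move=> x _; rewrite lee_fin.
Qed.

(** The variation of [u] is at most the integral of [a * N], which [aV] compares with the flux of
    [V k], which in turn [calibration_le] compares with the variation of [v]; then [k] tends to
    infinity. The lower bound [a0] makes the total variation of [v] finite, so that its product with
    [eps k] vanishes. *)
Theorem calibrated_minimizer v : BV_with_trace Omega f v ->
  (weighted_variation Omega a u <= weighted_variation Omega a v)%E.
Proof.
move=> tv; have [wvoo|] := ltP (weighted_variation Omega a v) +oo%E; last first.
  by rewrite leye_eq => /eqP ->; exact: leey.
have wv0 : (0 <= weighted_variation Omega a v)%E.
  apply: integral_ge0 => x Ox; rewrite lee_fin.
  by have /andP[h _] := aK Ox; rewrite (le_trans (ltW a0_gt0)).
have tvoo : (Defs.total_variation (gradient Omega v) Omega < +oo)%E.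
  have h : (a0%:E * Defs.total_variation (gradient Omega v) Omega <=
      weighted_variation Omega a v)%E.
    rewrite -integral_cst//; apply: ge0_le_integral => //.
    - by move=> x _; rewrite lee_fin ltW.
    - by apply/measurable_EFinP; exact: measurable_funTS.
    - by move=> x Ox; rewrite lee_fin; have /andP[] := aK Ox.
  rewrite ltey; apply/eqP => tE; move: (le_lt_trans h wvoo).
  by rewrite tE gt0_muley ?lte_fin// ltxx.
apply: (le_trans variation_le).
rewrite -[leRHS]fineK ?ge0_fin_numE// lee_fin.
set I := \int[M]_(p in _) _.
pose IN := \int[M]_(p in Phi @^-1` Omega) N p.
set w := fine (weighted_variation _ _ _); set t := fine (Defs.total_variation (gradient Omega v) Omega).
have mW i : measurable_fun setT (W i).
  by have /measurable_int/measurable_EFinP := iW i.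
have iNO : M.-integrable (Phi @^-1` Omega) (EFin \o N).
  by apply: (integrableS measurableT) => //; exact: mpre.
have key k : I <= w + eps k * (t + IN).
  have iVW i : M.-integrable (Phi @^-1` Omega) (EFin \o (fun p => V k i (Phi p) * W i p)).
    have [C hC] := V_bounded k i.
    apply: (@integrable_mul_bounded _ _ _ M _ (mpre mO) (V k i \o Phi) (W i) C) => //.
    - apply: measurable_funTS; apply: measurableT_comp => //.
      by apply: continuous_measurable_rV; exact: smooth_continuous.
    - by move=> p Op; apply: hC; exact: ltW.
    - by apply: (integrableS measurableT) => //; exact: mpre.
  have [_ iS] := Rintegral_sum (mpre mO) (index_enum 'I_n) iVW.
  have ieN : M.-integrable (Phi @^-1` Omega) (EFin \o (fun p => eps k * N p)).
    exact: (@integrable_mul_bounded _ _ _ M _ (mpre mO) (fun=> eps k) _ `|eps k|).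
  apply: (@le_trans _ _ (\int[M]_(p in Phi @^-1` Omega)
      (\sum_i V k i (Phi p) * W i p + eps k * N p))).
    apply: le_Rintegral.
    - exact: mpre.
    - apply: (@integrable_mul_bounded _ _ _ M _ (mpre mO) (a \o Phi) N K) => //.
        by apply: measurable_funTS; exact: measurableT_comp.
      move=> p Op; have /andP[h1 h2] := aK Op.
      by rewrite ger0_norm// (le_trans (ltW a0_gt0)).
    - exact: (integrableD (mpre mO) iS ieN).
    - by move=> p; exact: aV.
  rewrite RintegralD//; last exact: mpre.
  rewrite RintegralZl//; last exact: mpre.
  by rewrite mulrDr addrA lerD2r calibration_le.
have lim : w + eps k * (t + IN) @[k --> \oo] --> w.
  rewrite -[X in _ --> X]addr0; apply: cvgD; first exact: cvg_cst.
  by rewrite -[X in _ --> X](mul0r (t + IN)); apply: cvgM => //; exact: cvg_cst.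
by apply: (cvgr_to_ge lim); exact: nearW.
Qed.

End minimality.

(** * Functions of class C^(1,alpha) *)

Section hoelder_powers.
Context {R : realType}.
Implicit Types (s t e B : R).

Lemma ger_powR_unit t (a b : R) : 0 < a -> a <= b -> 0 <= t <= 1 -> t `^ b <= t `^ a.
Proof.
move=> a0 ab /andP[t0 t1]; have [->|tn0] := eqVneq t 0.
  by rewrite !powR0// gt_eqF// (lt_le_trans a0).
by apply: ger_powR => //; rewrite lt_neqAle eq_sym tn0 t0.
Qed.

(** After rescaling by [B] to the unit interval, the larger exponent gives the smaller power. *)
Lemma powR_hoelder (a b : R) e B : 0 < a -> a <= b -> 1 <= B -> 0 <= e <= B ->
  e `^ b <= B `^ b * e `^ a.
Proof.
move=> a0 ab B1 /andP[e0 eB]; have B0 : 0 < B by exact: lt_le_trans B1.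
have t1 : 0 <= e / B <= 1 by rewrite divr_ge0 ?(ltW B0)//= ler_pdivrMr// mul1r.
have -> : e = B * (e / B) by rewrite mulrC divfK// gt_eqF.
have /andP[t0 _] := t1.
rewrite [in leLHS]powRM ?(ltW B0)// ler_wpM2l ?powR_ge0//.
apply: (le_trans (ger_powR_unit a0 ab t1)).
apply: ge0_ler_powR; rewrite ?nnegrE ?(ltW a0)//.
  by rewrite mulr_ge0// ltW.
by rewrite ler_peMl.
Qed.

Lemma ppow_subadditive (a : R) s t : 0 < a -> a <= 1 ->
  `|ppow a s - ppow a t| <= `|s - t| `^ a.
Proof.
move=> a0 a1; wlog ts : s t / t <= s.
  move=> H; have [/H//|/ltW/H] := leP t s.
  by rewrite distrC [in X in _ -> _ <= X]distrC.
have pts : ppow a t <= ppow a s by apply: ppow_mono => //; exact: ltW.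
rewrite ger0_norm ?subr_ge0// ger0_norm ?subr_ge0//.
rewrite /ppow; set x := Num.max s 0; set y := Num.max t 0.
have y0 : 0 <= y by rewrite le_max lexx orbT.
have yx : y <= x by rewrite ge_max !le_max ts lexx orbT.
have xy : x - y <= s - t.
  rewrite /x /y; have [] := leP s 0; have [] := leP t 0 => *; lra.
apply: (@le_trans _ _ ((x - y) `^ a)); last first.
  by apply: ge0_ler_powR; rewrite ?nnegrE ?(ltW a0)// subr_ge0.
have [x0|x0] := eqVneq x 0.
  by rewrite x0 powR0 ?gt_eqF// sub0r (le_trans _ (powR_ge0 _ _))// oppr_le0 powR_ge0.
have xp : 0 < x by rewrite lt_neqAle eq_sym x0 (le_trans y0).
(* By homogeneity the claim becomes 1 <= r^a + (1 - r)^a, which follows from t <= t^a on the unit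
   interval. *)
set r := y / x.
have r01 : 0 <= r <= 1 by rewrite divr_ge0 ?(ltW xp)//= ler_pdivrMr// mul1r.
have r01' : 0 <= 1 - r <= 1 by move: r01 => /andP[h1 h2]; apply/andP; split; lra.
have yE : y = x * r by rewrite mulrC divfK.
clearbody r.
have /andP[r0 _] := r01; have /andP[r0' _] := r01'.
have -> : x - y = x * (1 - r) by rewrite yE mulrBr mulr1.
rewrite yE !powRM ?(ltW xp)// lerBlDr -mulrDr ler_peMr ?powR_ge0//.
have h1 := ger_powR_unit a0 a1 r01; have h2 := ger_powR_unit a0 a1 r01'.
rewrite !powRr1// in h1 h2; lra.
Qed.

Lemma lipschitz_derive (F F' : R -> R) (lo hi C : R) :
  (forall t, lo <= t <= hi -> is_derive t 1 F (F' t)) ->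
  (forall t, lo <= t <= hi -> `|F' t| <= C) ->
  forall s t, lo <= s <= hi -> lo <= t <= hi -> `|F s - F t| <= C * `|s - t|.
Proof.
move=> dF bF; suff H s t : lo <= s <= hi -> lo <= t <= hi -> s <= t -> `|F s - F t| <= C * `|s - t|.
  move=> s t hs ht; have [/H|/ltW/H] := leP s t; first exact.
  by rewrite distrC [in X in _ -> _ <= X]distrC; apply.
move=> /andP[s1 s2] /andP[t1 t2] st.
have inl x : x \in `[s, t] -> lo <= x <= hi.
  by rewrite in_itv/= => /andP[h1 h2]; rewrite (le_trans s1 h1) (le_trans h2 t2).
have [x xst E] := @MVT_segment R F F' s t st
  (fun x (hx : x \in `]s, t[) => dF x (inl x (subset_itv_oo_cc hx)))
  (derivable_within_continuous (fun x hx => @ex_derive _ _ _ _ _ _ _ (dF x (inl x hx)))).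
by rewrite distrC E normrM [in leRHS]distrC ler_wpM2r// bF// inl.
Qed.

Lemma ppow_hoelder (a b : R) B : 0 < a -> a <= 1 -> a <= b -> 1 <= B ->
  exists C, forall s t, -B <= s <= B -> - B <= t <= B ->
    `|ppow b s - ppow b t| <= C * `|s - t| `^ a.
Proof.
move=> a0 a1 ab B1.
have B2 : 1 <= 2 * B by lra.
have st s t : - B <= s <= B -> - B <= t <= B -> 0 <= `|s - t| <= 2 * B.
  by move=> /andP[s1 s2] /andP[t1 t2]; rewrite normr_ge0/= ler_norml; apply/andP; split; lra.
have [b1|b1] := leP b 1.
  exists ((2 * B) `^ b) => s t hs ht.
  apply: (le_trans (ppow_subadditive s t (lt_le_trans a0 ab) b1)).
  by apply: powR_hoelder => //; exact: st.
exists (b * ppow (b - 1) B * (2 * B) `^ 1) => s t hs ht.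
have := @lipschitz_derive (ppow b) (fun t => b * ppow (b - 1) t) (- B) B
  (b * ppow (b - 1) B).
move=> /(_ (fun t _ => is_derive_ppow t b1)) H.
apply: le_trans (H _ s t hs ht) _.
  move=> x /andP[_ xB]; have b0 : 0 <= b by rewrite (le_trans _ (ltW b1)).
  rewrite ger0_norm ?mulr_ge0 ?ppow_ge0// ler_wpM2l//.
  by apply: ppow_mono => //; lra.
rewrite -[leRHS]mulrA ler_wpM2l ?mulr_ge0 ?ppow_ge0//.
  by rewrite (le_trans _ (ltW b1)).
rewrite -[leLHS]powRr1//; apply: powR_hoelder => //; exact: st.
Qed.

End hoelder_powers.

(** * The algebra of C^(1,alpha) functions on the ball *)

Section C1_hoelder_class.
Context {R : realType} {n : nat}.
Local Notation Omega := (@oball R n).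
Implicit Types (g h : 'rV[R]_n -> R).

Lemma enormB_le2 x y : Omega x -> Omega y -> enorm (x - y) <= 2.
Proof.
have e1 (z : 'rV[R]_n) : Omega z -> enorm z <= 1.
  by move=> z1; rewrite -(@ler_pXn2r _ 2)// ?nnegrE ?enorm_ge0// expr1n sqr_enorm ltW.
move=> /e1 hx /e1 hy; rewrite (le_trans (enormD _ _))// enormN; lra.
Qed.

Definition bounded_hoelder (a : R) g := bounded_on Omega g /\ hoelder_on a Omega g.

Lemma hoelder_onP (a : R) g : hoelder_on a Omega g <-> exists2 C, 0 <= C &
  forall x y, Omega x -> Omega y -> `|g x - g y| <= C * enorm (x - y) `^ a.
Proof.
split=> [[C hC]|[C _ hC]]; last by exists C.
exists `|C| => // x y Ox Oy; apply: (le_trans (hC x y Ox Oy)).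
by rewrite ler_wpM2r ?powR_ge0// ler_norm.
Qed.

Lemma bounded_onP g : bounded_on Omega g <-> exists2 C, 0 <= C &
  forall x, Omega x -> `|g x| <= C.
Proof.
split=> [[C hC]|[C _ hC]]; last by exists C.
by exists `|C| => // x Ox; apply: (le_trans (hC x Ox)); exact: ler_norm.
Qed.

Lemma bounded_hoelderD (a : R) g h : bounded_hoelder a g -> bounded_hoelder a h ->
  bounded_hoelder a (fun x => g x + h x).
Proof.
move=> [[B1 b1] [C1 c1]] [[B2 b2] [C2 c2]]; split.
  by exists (B1 + B2) => x Ox; rewrite (le_trans (ler_normD _ _))// lerD ?b1 ?b2.
exists (C1 + C2) => x y Ox Oy; rewrite opprD addrACA mulrDl.
by rewrite (le_trans (ler_normD _ _))// lerD ?c1 ?c2.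
Qed.

Lemma bounded_hoelderM (a : R) g h : bounded_hoelder a g -> bounded_hoelder a h ->
  bounded_hoelder a (fun x => g x * h x).
Proof.
move=> [/bounded_onP[B1 B10 b1] /hoelder_onP[C1 C10 c1]].
move=> [/bounded_onP[B2 B20 b2] /hoelder_onP[C2 C20 c2]]; split.
  by exists (B1 * B2) => x Ox; rewrite normrM ler_pM ?b1 ?b2.
exists (B1 * C2 + B2 * C1) => x y Ox Oy.
have -> : g x * h x - g y * h y = g x * (h x - h y) + h y * (g x - g y) by ring.
rewrite (le_trans (ler_normD _ _))// !normrM mulrDl -!mulrA.
by apply: lerD; apply: ler_pM; rewrite ?b1 ?b2 ?c1 ?c2.
Qed.

Lemma lipschitz_hoelder (a : R) g : 0 < a -> a <= 1 -> hoelder_on 1 Omega g ->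
  hoelder_on a Omega g.
Proof.
move=> a0 a1 /hoelder_onP[C C0 hC]; exists (C * 2 `^ 1) => x y Ox Oy.
apply: (le_trans (hC x y Ox Oy)); rewrite -mulrA ler_wpM2l//.
by apply: powR_hoelder; rewrite ?enorm_ge0 ?enormB_le2// ler1n.
Qed.

Lemma hoelder_continuous (a : R) g x : 0 < a -> hoelder_on a Omega g -> Omega x ->
  {for x, continuous g}.
Proof.
move=> a0 [C hC] Ox; apply/(@cvgrPdist_le _ _ _ (nbhs x)) => e e0.
have c : continuous (fun y : 'rV[R]_n => C * ppow a (enorm (x - y))).
  apply: contM; first exact: contC.
  by apply: (cont_comp (F := ppow a)); [exact: continuous_ppow|exact: continuous_enormB].
have := c x; rewrite /continuous_at subrr enorm0 ppow_le0 ?gt_eqF// mulr0.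
move/(@cvgrPdist_le _ _ _ (nbhs x)) => /(_ e e0) h.
have hO : \forall y \near x, Omega y.
  by apply: open_nbhs_nbhs; split => //; exact: open_oball.
near=> y; have Oy : Omega y by near: y.
apply: (le_trans (hC x y Ox Oy)); apply: (le_trans (ler_norm _)).
rewrite -(ppow_ge0E a) ?enorm_ge0//.
have : `|0 - C * ppow a (enorm (x - y))| <= e by near: y.
by rewrite sub0r normrN.
Unshelve. all: by end_near. Qed.

Variable alpha : R.
Hypotheses (alpha0 : 0 < alpha) (alpha1 : alpha <= 1).

(** The derivatives are named and the Lipschitz bound on [g] is carried along instead of being
    recovered from the gradient; stability under products and compositions is then direct. *)
Definition C1_hoelder_fun g := bounded_hoelder 1 g /\ exists dg,
  (forall x i, Omega x -> is_derive x (unitv i) g (dg i x)) /\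
  forall i, bounded_hoelder alpha (dg i).

Lemma C1_hoelder_funP g : C1_hoelder_fun g -> C1_hoelder alpha Omega g.
Proof.
move=> [[bg hg] [dg [dgE hdg]]].
have pE i x : Omega x -> partial i g x = dg i x by move=> Ox; apply: partialE; exact: dgE.
have hp i : hoelder_on alpha Omega (partial i g).
  by have [_ [C hC]] := hdg i; exists C => x y Ox Oy; rewrite !pE//; exact: hC.
split=> //.
- split; first by move=> x; exact: hoelder_continuous hg.
  move=> i; split.
    by move=> x Ox; have [] := dgE x i Ox.
  by split=> // x; exact: hoelder_continuous (hp i).
- by move=> i; have [[C hC] _] := hdg i; exists C => x Ox; rewrite pE//; exact: hC.
Qed.

Let bh_lip g : bounded_hoelder 1 g -> bounded_hoelder alpha g.
Proof. by move=> [bg hg]; split => //; exact: lipschitz_hoelder. Qed.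

Let bh_cst a (c : R) : bounded_hoelder a (fun=> c).
Proof.
split; first by exists `|c|.
by exists 0 => x y _ _; rewrite subrr normr0 mul0r.
Qed.

Lemma C1_hoelder_cst (c : R) : C1_hoelder_fun (fun=> c).
Proof.
split; first exact: bh_cst.
exists (fun _ _ => 0); split; last by move=> i; exact: bh_cst.
by move=> x i _; exact: is_derive_cst_fun.
Qed.

Lemma C1_hoelder_coord j : C1_hoelder_fun (fun x => x ord0 j).
Proof.
split.
  split; first by exists 1 => x Ox; rewrite sqn_le1_coord// ltW.
  exists 1 => x y _ _; rewrite mul1r powRr1 ?enorm_ge0//.
  by have := coord_le_enorm (x - y) j; rewrite !mxE.
exists (fun i _ => unitv i ord0 j); split; last by move=> i; exact: bh_cst.
by move=> x i _; exact: is_derive_coord.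
Qed.

Lemma C1_hoelderD g h : C1_hoelder_fun g -> C1_hoelder_fun h ->
  C1_hoelder_fun (fun x => g x + h x).
Proof.
move=> [g1 [dg [gE gd]]] [h1 [dh [hE hd]]].
split; first exact: bounded_hoelderD.
exists (fun i x => dg i x + dh i x); split; last by move=> i; exact: bounded_hoelderD.
by move=> x i Ox; exact: is_deriveD_fun (gE x i Ox) (hE x i Ox).
Qed.

Lemma C1_hoelderM g h : C1_hoelder_fun g -> C1_hoelder_fun h ->
  C1_hoelder_fun (fun x => g x * h x).
Proof.
move=> [g1 [dg [gE gd]]] [h1 [dh [hE hd]]].
split; first exact: bounded_hoelderM.
exists (fun i x => g x * dh i x + h x * dg i x); split.
  by move=> x i Ox; exact: is_deriveM_fun (gE x i Ox) (hE x i Ox).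
by move=> i; apply: bounded_hoelderD; apply: bounded_hoelderM => //; exact: bh_lip.
Qed.

Lemma C1_hoelder_sum (I : Type) (r : seq I) (g : I -> 'rV[R]_n -> R) :
  (forall i, C1_hoelder_fun (g i)) -> C1_hoelder_fun (fun x => \sum_(i <- r) g i x).
Proof.
move=> hg; elim: r => [|i r IH].
  by under eq_fun do rewrite big_nil; exact: C1_hoelder_cst.
by under eq_fun do rewrite big_cons; exact: C1_hoelderD.
Qed.

Lemma C1_hoelder_comp g (F F' : R -> R) (lo hi : R) : C1_hoelder_fun g ->
  (forall x, Omega x -> lo <= g x <= hi) ->
  (forall t, lo <= t <= hi -> is_derive t 1 F (F' t)) ->
  (exists C, forall s t, lo <= s <= hi -> lo <= t <= hi ->
     `|F' s - F' t| <= C * `|s - t| `^ alpha) ->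
  C1_hoelder_fun (fun x => F (g x)).
Proof.
move=> [[bg /hoelder_onP[L L0 hL]] [dg [gE gd]]] gJ dF [C hC].
have F'b : exists B, forall t, lo <= t <= hi -> `|F' t| <= B.
  exists (`|F' lo| + `|C| * `|hi - lo| `^ alpha) => t /andP[t1 t2].
  have lohi : lo <= hi by exact: le_trans t2.
  have -> : F' t = F' lo + (F' t - F' lo) by ring.
  rewrite (le_trans (ler_normD _ _))// lerD2l.
  apply: (le_trans (hC t lo _ _)); rewrite ?t1 ?t2 ?lexx//.
  apply: (@le_trans _ _ (`|C| * `|t - lo| `^ alpha)).
    by rewrite ler_wpM2r ?powR_ge0// ler_norm.
  rewrite ler_wpM2l//; apply: ge0_ler_powR; rewrite ?nnegrE ?(ltW alpha0)//.
  by rewrite !ger0_norm ?subr_ge0// lerD2r.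
have [B hB] := F'b.
have Flip := lipschitz_derive dF hB.
have dist x y : Omega x -> Omega y -> `|g x - g y| <= L * enorm (x - y).
  by move=> Ox Oy; have := hL x y Ox Oy; rewrite powRr1 ?enorm_ge0.
have FH : bounded_hoelder 1 (fun x => F (g x)).
  have hF : hoelder_on 1 Omega (fun x => F (g x)).
    exists (`|B| * L) => x y Ox Oy; rewrite powRr1 ?enorm_ge0//.
    apply: (le_trans (Flip _ _ (gJ x Ox) (gJ y Oy))).
    apply: (@le_trans _ _ (`|B| * `|g x - g y|)); first by rewrite ler_wpM2r ?ler_norm.
    by rewrite -mulrA ler_wpM2l// dist.
  split=> //; have [C1 hC1] := hF; exists (`|F (g 0)| + `|C1| * 2) => x Ox.
  have O0 : Omega 0 by rewrite /oball/= /sqn big1// => i _; rewrite mxE expr0n.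
  have -> : F (g x) = F (g 0) + (F (g x) - F (g 0)) by ring.
  rewrite (le_trans (ler_normD _ _))// lerD2l.
  apply: (le_trans (hC1 x 0 Ox O0)); rewrite powRr1 ?enorm_ge0//.
  apply: (@le_trans _ _ (`|C1| * enorm (x - 0))).
    by rewrite ler_wpM2r ?enorm_ge0// ler_norm.
  by rewrite ler_wpM2l// enormB_le2.
split=> //; exists (fun i x => F' (g x) * dg i x); split.
  move=> x i Ox; have H := is_derive_comp1 (gE x i Ox) (dF _ (gJ x Ox)).
  by refine (is_derive_eq H _); rewrite mulrC.
move=> i; apply: bounded_hoelderM => //; split; first by exists B => x Ox; exact/hB/gJ.
exists (`|C| * L `^ alpha) => x y Ox Oy.
apply: (le_trans (hC _ _ (gJ x Ox) (gJ y Oy))).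
apply: (@le_trans _ _ (`|C| * `|g x - g y| `^ alpha)).
  by rewrite ler_wpM2r ?powR_ge0// ler_norm.
rewrite -mulrA ler_wpM2l// -powRM ?enorm_ge0//.
apply: ge0_ler_powR; rewrite ?nnegrE ?(ltW alpha0) ?mulr_ge0 ?enorm_ge0//.
exact: dist.
Qed.

Lemma C1_hoelder_comp2 g (F F' F'' : R -> R) (lo hi C : R) : C1_hoelder_fun g ->
  (forall x, Omega x -> lo <= g x <= hi) ->
  (forall t, lo <= t <= hi -> is_derive t 1 F (F' t)) ->
  (forall t, lo <= t <= hi -> is_derive t 1 F' (F'' t)) ->
  (forall t, lo <= t <= hi -> `|F'' t| <= C) ->
  C1_hoelder_fun (fun x => F (g x)).
Proof.
move=> Cg gJ dF dF' F''C; apply: (C1_hoelder_comp Cg gJ dF).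
pose B := 1 + `|hi - lo|; have B1 : 1 <= B by rewrite lerDl.
exists (`|C| * B `^ 1) => s t hs ht.
apply: (le_trans (lipschitz_derive dF' F''C hs ht)).
apply: (@le_trans _ _ (`|C| * `|s - t|)); first by rewrite ler_wpM2r ?ler_norm.
rewrite -mulrA ler_wpM2l// -[leLHS]powRr1//; apply: powR_hoelder => //.
rewrite normr_ge0/= /B ler_wpDl//.
move: hs ht => /andP[s1 s2] /andP[t1 t2].
rewrite [leRHS]ger0_norm ?subr_ge0 ?(le_trans s1)// ler_norml; apply/andP; split; lra.
Qed.

Lemma C1_hoelder_expR g : C1_hoelder_fun g -> C1_hoelder_fun (fun x => expR (g x)).
Proof.
move=> Cg; have [[/bounded_onP[B B0 hB] _] _] := Cg.
apply: (@C1_hoelder_comp2 g expR expR expR (- B) B (expR B)) => //.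
- by move=> x Ox; rewrite -ler_norml hB.
- by move=> t /andP[_ tB]; rewrite ger0_norm ?expR_ge0// ler_expR.
Qed.

Lemma C1_hoelder_ppow g (b : R) : 1 + alpha <= b -> C1_hoelder_fun g ->
  C1_hoelder_fun (fun x => ppow b (g x)).
Proof.
move=> ab Cg; have [[/bounded_onP[B B0 hB] _] _] := Cg.
have b1 : 1 < b by rewrite (lt_le_trans _ ab)// ltrDl.
apply: (@C1_hoelder_comp g (ppow b) (fun t => b * ppow (b - 1) t) (- (1 + B)) (1 + B)) => //.
- move=> x Ox; rewrite -ler_norml (le_trans (hB x Ox))// lerDr//.
- by move=> t _; exact: is_derive_ppow.
- have [||C hC] := @ppow_hoelder _ alpha (b - 1) (1 + B) alpha0 alpha1.
  + lra.
  + by rewrite lerDl.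
  exists (b * C) => s t hs ht; rewrite -mulrBr normrM ger0_norm ?(ltW (lt_trans _ b1))//.
  by rewrite -mulrA ler_wpM2l ?hC// ltW// (lt_trans _ b1).
Qed.

(** Away from [0] the second derivative of the square root is bounded, so its first derivative is
    Lipschitz on the range of [g]. *)
Lemma C1_hoelder_sqrt g (c : R) : 0 < c -> (forall x, Omega x -> c <= g x) ->
  C1_hoelder_fun g -> C1_hoelder_fun (fun x => Num.sqrt (g x)).
Proof.
move=> c0 cg Cg; have [[/bounded_onP[B B0 hB] _] _] := Cg.
pose h : R := 2^-1.
rewrite (_ : (fun x => _) = fun x => ppow h (g x)); last first.
  apply/funext => x; rewrite /ppow powR12_sqrt ?le_max ?lexx ?orbT//.
  by have [g0|//] := leP (g x) 0; rewrite ler0_sqrtr// sqrtr0.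
apply: (@C1_hoelder_comp2 g (ppow h) (fun t => h * ppow (h - 1) t)
  (fun t => h * ((h - 1) * ppow (h - 1 - 1) t)) c B (c `^ (h - 1 - 1))) => //.
- by move=> x Ox; rewrite cg//= (le_trans (ler_norm _))// hB.
- by move=> t /andP[ct _]; apply: is_derive_ppow_gt0; exact: lt_le_trans ct.
- move=> t /andP[ct _].
  have H := is_deriveZ h (is_derive_ppow_gt0 (h - 1) (lt_le_trans c0 ct)).
  exact: H.
- move=> t /andP[ct tB]; have t0 := lt_le_trans c0 ct.
  rewrite (ppow_ge0E _ (ltW t0)) mulrA normrM (ger0_norm (powR_ge0 _ _)).
  apply: (@le_trans _ _ (1 * t `^ (h - 1 - 1))).
    by rewrite ler_wpM2r ?powR_ge0// ler_norml /h; apply/andP; split; lra.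
  rewrite mul1r (_ : h - 1 - 1 = - (3 / 2)); last by rewrite /h; lra.
  rewrite !powRN lef_pV2 ?posrE ?powR_gt0//.
  apply: ge0_ler_powR; rewrite ?nnegrE ?(ltW c0) ?(ltW t0)//; lra.
Qed.

End C1_hoelder_class.

(** * The calibrating field *)

Section divergence_free_field.
Context {R : realType} {m : nat}.
Implicit Types (x : 'rV[R]_m.+1) (d s z : R).
Variable sg : R.

(** The divergence in R^m of the radial field (2 / sg) q(|y|^2) y, as a function of s = |y|^2. *)
Definition multiplier (q q1 : R -> R) s : R := (2 * m%:R * q s + 4 * s * q1 s) / sg.

(** The horizontal part is minus that radial field times [E1]. The vertical part is a primitive in z
    of the resulting divergence with opposite sign, normalized to equal H(s) where E(z) = H(s). *)
Definition field (E E1 H q q1 : R -> R) (i : 'I_m.+1) x : R :=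
  if unlift ord0 i is Some j
  then - (2 / sg) * (tl x ord0 j * q (sqn (tl x))) * E1 (x ord0 ord0)
  else H (sqn (tl x)) + multiplier q q1 (sqn (tl x)) * (E (x ord0 ord0) - H (sqn (tl x))).

Lemma field0E E E1 H q q1 x : field E E1 H q q1 ord0 x =
  H (sqn (tl x)) + multiplier q q1 (sqn (tl x)) * (E (x ord0 ord0) - H (sqn (tl x))).
Proof. by rewrite /field unlift_none. Qed.

Lemma fieldSE E E1 H q q1 j x : field E E1 H q q1 (lift ord0 j) x =
  - (2 / sg) * (tl x ord0 j * q (sqn (tl x))) * E1 (x ord0 ord0).
Proof. by rewrite /field liftK. Qed.

Lemma smooth_sqn_tl : smooth (fun x => sqn (tl x)).
Proof.
rewrite /sqn; apply: smooth_sum => i; apply: smooth_sqr.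
by under eq_fun do rewrite tlE; exact: smooth_coord.
Qed.

Section divergence.
Variables (E E1 H q q1 : R -> R).
Hypotheses (dE : forall z, is_derive z 1 E (E1 z)) (dq : forall s, is_derive s 1 q (q1 s))
  (sE : smooth (fun x => E (x ord0 ord0))) (sE1 : smooth (fun x => E1 (x ord0 ord0)))
  (sH : smooth (fun x => H (sqn (tl x)))) (sq : smooth (fun x => q (sqn (tl x))))
  (sq1 : smooth (fun x => q1 (sqn (tl x)))).
Local Notation V := (field E E1 H q q1).

Lemma smooth_field i : smooth (V i).
Proof.
rewrite /field; case: unlift => [j|].
  apply: smoothM => //; apply: smoothM; first exact: smooth_cst.
  by apply: smoothM => //; under eq_fun do rewrite tlE; exact: smooth_coord.
apply: smoothD => //; apply: smoothM; last exact: smoothB.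
rewrite /multiplier; apply: smoothM; last exact: smooth_cst.
apply: smoothD; apply: smoothM => //; first exact: smooth_cst.
by apply: smoothM; [exact: smooth_cst|exact: smooth_sqn_tl].
Qed.

(* The multiplier is chosen so that the vertical derivative
   [multiplier * E1] cancels the horizontal divergence. *)
Lemma divergence_field x : \sum_i partial i (V i) x = 0.
Proof.
have c0 : is_derive x (unitv ord0) (fun y : 'rV[R]_m.+1 => y ord0 ord0) 1.
  by have := is_derive_coord ord0 x (unitv ord0); rewrite unitvE eqxx.
have p0 : partial ord0 (V ord0) x = multiplier q q1 (sqn (tl x)) * E1 (x ord0 ord0).
  apply: partialE; rewrite (_ : V ord0 = fun y => H (sqn (tl y)) +
      multiplier q q1 (sqn (tl y)) * (E (y ord0 ord0) - H (sqn (tl y)))); last first.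
    by apply/funext => y; rewrite field0E.
  have h1 := is_derive_tl0 (fun y => H (sqn y)) x.
  have h2 := is_derive_tl0 (fun y => multiplier q q1 (sqn y)) x.
  have h3 := is_deriveB_fun (is_derive_comp1 c0 (dE _)) h1.
  have H' := is_deriveD_fun h1 (is_deriveM_fun h2 h3).
  by refine (is_derive_eq H' _); ring.
have pS j : partial (lift ord0 j) (V (lift ord0 j)) x =
    - (2 / sg) * (q (sqn (tl x)) + 2 * (tl x ord0 j) ^+ 2 * q1 (sqn (tl x))) *
      E1 (x ord0 ord0).
  apply: partialE; rewrite (_ : V (lift ord0 j) = fun y =>
      - (2 / sg) * (tl y ord0 j * q (sqn (tl y))) * E1 (y ord0 ord0)); last first.
    by apply/funext => y; rewrite fieldSE.
  have h1 : is_derive x (unitv (lift ord0 j)) (fun y => tl y ord0 j * q (sqn (tl y)))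
      (tl x ord0 j * (q1 (sqn (tl x)) * (2 * tl x ord0 j)) + q (sqn (tl x)) * 1).
    apply: (is_derive_tl (g := fun y => y ord0 j * q (sqn y))); rewrite tl_unitvS.
    have c1 : is_derive (tl x) (unitv j) (fun y : 'rV[R]_m => y ord0 j) 1.
      by have := is_derive_coord j (tl x) (unitv j); rewrite unitvE eqxx.
    exact: is_deriveM_fun c1 (is_derive_comp1 (is_derive_sqn (tl x) j) (dq _)).
  have h2 : is_derive x (unitv (lift ord0 j)) (fun y : 'rV[R]_m.+1 => E1 (y ord0 ord0)) 0.
    apply/is_derive_lineE; rewrite (_ : (fun _ => _) = fun=> E1 (x ord0 ord0)).
      exact: is_derive_cst.
    by apply/funext => t; rewrite !mxE eqxx/= mulr0 add0r.
  have H' := is_deriveM_fun (is_deriveZ_fun (- (2 / sg)) h1) h2.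
  by refine (is_derive_eq H' _); ring.
rewrite big_ord_recl p0; under eq_bigr do rewrite pS.
rewrite -mulr_suml -mulr_sumr big_split/= sumr_const card_ord -mulr_suml -mulr_sumr.
by rewrite -/(sqn (tl x)) /multiplier -[_ *+ m]mulr_natl; ring.
Qed.

End divergence.
End divergence_free_field.

(** * The field Z and its damped approximations *)

Section calibrating_field.
Context {R : realType} {m : nat}.
Implicit Types (x : 'rV[R]_m.+1) (d s z : R).
Variables (k p nu ep sg : R).
Hypotheses (k1 : 1 < k) (p0 : 0 < p).

(** The exponential makes [Eprof1 / Eprof] the pure power [nu * (p + 1) * ppow p z]; wherever the
    vertical component is [Eprof z], the slope equation of the sheets has explicit power
    solutions. *)
Definition Eprof z : R := expR (nu * ppow (p + 1) z).
Definition Eprof1 z : R := nu * ((p + 1) * ppow p z) * Eprof z.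
(** Affine for 1/2 <= s, negative just below 1/2, and ep/2 at s = 0: the lens stands around the
    axis, separated from s = 1/2 by a flat region. The exponent 4 leaves in [Gprof2], which enters
    the weight, the exponent 2 > 1 + alpha. *)
Definition Gprof s : R := ep * (s - 1 / 2 + 16 * ppow 4 (1 / 2 - s)).
Definition Gprof1 s : R := ep * (1 - 64 * ppow 3 (1 / 2 - s)).
Definition Gprof2 s : R := ep * (192 * ppow 2 (1 / 2 - s)).
(** [Eprof] on the lens top. There the vertical component of Z equals [Eprof z] whatever the value
    of the multiplier. *)
Definition Hprof s : R := Eprof (ppow k (Gprof s)).

Definition Zfield : 'I_m.+1 -> 'rV[R]_m.+1 -> R :=
  field sg Eprof Eprof1 Hprof Gprof1 Gprof2.

(** Each power is damped separately, and [Edamped1] and [Gdamped2] are the exact derivatives of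
    [Edamped] and [Gdamped1]; these two relations are what the divergence identity rests on. *)
Definition Edamped d z : R := expR (nu * damped (p + 1) d z).
Definition Edamped1 d z : R :=
  nu * ((p + 1) * damped p d z + d * damped (p - 1) d z) * Edamped d z.
Definition Gdamped d s : R := ep * (s - 1 / 2 + 16 * damped 4 d (1 / 2 - s)).
Definition Gdamped1 d s : R :=
  ep * (1 - 16 * (4 * damped 3 d (1 / 2 - s) + d * damped 2 d (1 / 2 - s))).
Definition Gdamped2 d s : R :=
  ep * (16 * (4 * (3 * damped 2 d (1 / 2 - s) + d * damped 1 d (1 / 2 - s)) +
              d * (2 * damped 1 d (1 / 2 - s) + d * damped 0 d (1 / 2 - s)))).
Definition Hdamped d s : R := Edamped d (damped k d (Gdamped d s)).

Definition Zdamped d : 'I_m.+1 -> 'rV[R]_m.+1 -> R :=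
  field sg (Edamped d) (Edamped1 d) (Hdamped d) (Gdamped1 d) (Gdamped2 d).

Lemma is_derive_dampedE (q q' q'' d t : R) : 0 < d -> q - 1 = q' -> q - 2 = q'' ->
  is_derive t 1 (damped q d) (q * damped q' d t + d * damped q'' d t).
Proof. by move=> d0 <- <-; exact: is_derive_damped. Qed.

Let dE d z : 0 < d -> is_derive z 1 (Edamped d) (Edamped1 d z).
Proof.
move=> d0.
have h := @is_derive_dampedE (p + 1) p (p - 1) d z d0 ltac:(ring) ltac:(ring).
have h1 := is_deriveZ nu h.
have h2 := @is_derive1_comp _ expR (nu \*: damped (p + 1) d) z _ _ (is_derive_expR _) h1.
by refine (is_derive_eq h2 _); rewrite /Edamped1 /Edamped mulrC.
Qed.

Let dq d s : 0 < d -> is_derive s 1 (Gdamped1 d) (Gdamped2 d s).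
Proof.
move=> d0.
have D (q q' q'' : R) : q - 1 = q' -> q - 2 = q'' -> is_derive s 1 (fun s => damped q d (1 / 2 - s))
    (- (q * damped q' d (1 / 2 - s) + d * damped q'' d (1 / 2 - s))).
  move=> hq' hq''.
  have h1 : is_derive s 1 (fun s : R => 1 / 2 - s) (- 1).
    have h := is_deriveB (is_derive_cst (1 / 2 : R) s 1) (is_derive_id s 1).
    by refine (is_derive_eq h _); rewrite sub0r.
  have h2 := @is_derive1_comp _ (damped q d) (fun s : R => 1 / 2 - s) s _ _
    (is_derive_dampedE (1 / 2 - s) d0 hq' hq'') h1.
  by refine (is_derive_eq h2 _); rewrite mulrN1.
have D3 := D 3 2 1 ltac:(ring) ltac:(ring).
have D2 := D 2 1 0 ltac:(ring) ltac:(ring).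
have S := is_deriveD (is_deriveZ 4 D3) (is_deriveZ d D2).
have B := is_deriveZ ep (is_deriveB (is_derive_cst (1 : R) s 1) (is_deriveZ 16 S)).
by refine (is_derive_eq B _); rewrite /GRing.scale/= /Gdamped2; ring.
Qed.

Let smooth_z q d : 0 < d -> smooth (fun x => damped q d (x ord0 ord0)).
Proof.
move=> d0; apply: (smooth_comp (F := damped q d)); first exact: smooth_coord.
by move=> j; exact: Ck1_damped.
Qed.

Let smooth_s q d : 0 < d -> smooth (fun x => damped q d (1 / 2 - sqn (tl x))).
Proof.
move=> d0; apply: (smooth_comp (F := damped q d)); last by move=> j; exact: Ck1_damped.
by apply: smoothB; [exact: smooth_cst|exact: smooth_sqn_tl].
Qed.

Let smooth_E d : 0 < d -> smooth (fun x => Edamped d (x ord0 ord0)).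
Proof.
move=> d0; apply: (smooth_comp (F := expR)); last by move=> j; exact: Ck1_expR.
by apply: smoothM; [exact: smooth_cst|exact: smooth_z].
Qed.

Let smooth_E1 d : 0 < d -> smooth (fun x => Edamped1 d (x ord0 ord0)).
Proof.
move=> d0; apply: smoothM; last exact: smooth_E.
apply: smoothM; first exact: smooth_cst.
by apply: smoothD; (apply: smoothM; [exact: smooth_cst|exact: smooth_z]).
Qed.

Let smooth_q d : 0 < d -> smooth (fun x => Gdamped1 d (sqn (tl x))).
Proof.
move=> d0; apply: smoothM; first exact: smooth_cst.
apply: smoothB; first exact: smooth_cst.
apply: smoothM; first exact: smooth_cst.
by apply: smoothD; (apply: smoothM; [exact: smooth_cst|exact: smooth_s]).
Qed.

Let smooth_q1 d : 0 < d -> smooth (fun x => Gdamped2 d (sqn (tl x))).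
Proof.
move=> d0; apply: smoothM; first exact: smooth_cst.
apply: smoothM; first exact: smooth_cst.
by apply: smoothD; (apply: smoothM; first exact: smooth_cst);
  apply: smoothD; (apply: smoothM; [exact: smooth_cst|exact: smooth_s]).
Qed.

Let smooth_H d : 0 < d -> smooth (fun x => Hdamped d (sqn (tl x))).
Proof.
move=> d0; apply: (smooth_comp (F := expR)); last by move=> j; exact: Ck1_expR.
apply: smoothM; first exact: smooth_cst.
apply: (smooth_comp (F := damped (p + 1) d)); last by move=> j; exact: Ck1_damped.
apply: (smooth_comp (F := damped k d)); last by move=> j; exact: Ck1_damped.
apply: smoothM; first exact: smooth_cst.
apply: smoothD; first by apply: smoothB; [exact: smooth_sqn_tl|exact: smooth_cst].
by apply: smoothM; [exact: smooth_cst|exact: smooth_s].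
Qed.

Lemma smooth_Zdamped d i : 0 < d -> smooth (Zdamped d i).
Proof.
move=> d0; apply: smooth_field.
- exact: smooth_E.
- exact: smooth_E1.
- exact: smooth_H.
- exact: smooth_q.
- exact: smooth_q1.
Qed.

Lemma divergence_Zdamped d x : 0 < d -> \sum_i partial i (Zdamped d i) x = 0.
Proof.
move=> d0; apply: divergence_field.
- by move=> z; exact: dE.
- by move=> s; exact: dq.
Qed.

Section cvg.
Context {T : Type} {F : set_system T} {FF : ProperFilter F}.
Variables (f : T -> R) (y : T -> 'rV[R]_m.+1) (y0 : 'rV[R]_m.+1).
Hypotheses (f0 : f t @[t --> F] --> 0) (fgt0 : \forall t \near F, 0 < f t)
  (yy0 : y t @[t --> F] --> y0).

Let cc (c : R) : (fun=> c) @ F --> c. Proof. exact: cvg_cst. Qed.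

Let cz : y t ord0 ord0 @[t --> F] --> y0 ord0 ord0.
Proof.
apply: (@cvg_comp _ _ _ y (fun x : 'rV[R]_m.+1 => x ord0 ord0) F _ _ yy0).
exact: continuous_coord. Qed.

Let cs : sqn (tl (y t)) @[t --> F] --> sqn (tl y0).
Proof.
apply: (@cvg_comp _ _ _ y (fun x : 'rV[R]_m.+1 => sqn (tl x)) F _ _ yy0).
exact: (smooth_continuous smooth_sqn_tl).
Qed.

Let cr : 1 / 2 - sqn (tl (y t)) @[t --> F] --> 1 / 2 - sqn (tl y0).
Proof. exact: cvgB. Qed.

Let cd q : 0 < q -> damped q (f t) (1 / 2 - sqn (tl (y t))) @[t --> F] -->
  ppow q (1 / 2 - sqn (tl y0)).
Proof. by move=> q0; exact: cvg_damped. Qed.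

Let cd1 q q' : 0 < q -> q - 1 = q' ->
  f t * damped q' (f t) (1 / 2 - sqn (tl (y t))) @[t --> F] --> (0 : R).
Proof. by move=> q0 <-; exact: (cvg_damped_subr1 q0 f0 fgt0 cr). Qed.

Let cE (g : T -> R) (t0 : R) : g t @[t --> F] --> t0 -> Edamped (f t) (g t) @[t --> F] --> Eprof t0.
Proof.
move=> gt; apply: continuous_cvg; first exact: continuous_expR.
by apply: cvgM => //; apply: cvg_damped => //; rewrite addr_gt0.
Qed.

Let cE1 : Edamped1 (f t) (y t ord0 ord0) @[t --> F] --> Eprof1 (y0 ord0 ord0).
Proof.
apply: cvgM; last exact: cE.
apply: cvgM => //; rewrite -[X in _ --> X]addr0; apply: cvgD.
  by apply: cvgM => //; exact: cvg_damped.
exact: (cvg_damped_subr1 p0 f0 fgt0 cz).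
Qed.

Let cq : Gdamped1 (f t) (sqn (tl (y t))) @[t --> F] --> Gprof1 (sqn (tl y0)).
Proof.
rewrite /Gprof1 (_ : 64 * _ = 16 * (4 * ppow 3 (1 / 2 - sqn (tl y0)) + 0)); last by ring.
apply: cvgM => //; apply: cvgB => //; apply: cvgM => //; apply: cvgD.
  by apply: cvgM => //; exact: cd.
by apply: (@cd1 3) => //; ring.
Qed.

Let cq1 : Gdamped2 (f t) (sqn (tl (y t))) @[t --> F] --> Gprof2 (sqn (tl y0)).
Proof.
rewrite /Gprof2 (_ : 192 * _ = 16 * (4 * (3 * ppow 2 (1 / 2 - sqn (tl y0)) + 0) +
  (2 * 0 + 0 * 0))); last by ring.
apply: cvgM => //; apply: cvgM => //; apply: cvgD.
  apply: cvgM => //; apply: cvgD; first by apply: cvgM => //; exact: cd.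
  by apply: (@cd1 2) => //; ring.
under eq_fun do rewrite mulrDr mulrCA; apply: cvgD.
  by apply: cvgM => //; apply: (@cd1 2) => //; ring.
by apply: cvgM => //; apply: (@cd1 1) => //; ring.
Qed.

Let cH : Hdamped (f t) (sqn (tl (y t))) @[t --> F] --> Hprof (sqn (tl y0)).
Proof.
apply: cE; apply: cvg_damped => //; first by rewrite (lt_trans _ k1).
apply: cvgM => //; apply: cvgD; first exact: cvgB.
by apply: cvgM => //; exact: cd.
Qed.

Lemma cvg_Zdamped i : Zdamped (f t) i (y t) @[t --> F] --> Zfield i y0.
Proof.
case: (unliftP ord0 i) => [j ->|->].
  under eq_fun do rewrite /Zdamped fieldSE; rewrite /Zfield fieldSE.
  apply: cvgM => //; apply: cvgM => //; apply: cvgM => //.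
  apply: (@cvg_comp _ _ _ y (fun x : 'rV[R]_m.+1 => tl x ord0 j) F _ _ yy0).
  by under eq_fun do rewrite tlE; rewrite tlE; exact: continuous_coord.
under eq_fun do rewrite /Zdamped field0E; rewrite /Zfield field0E.
apply: cvgD; first exact: cH.
apply: cvgM; last by apply: cvgB; [exact: (cE cz)|exact: cH].
apply: cvgM; last exact: cc.
apply: cvgD; first by apply: cvgM; [exact: cc|exact: cq].
by apply: cvgM; [apply: cvgM; [exact: cc|exact: cs]|exact: cq1].
Qed.

End cvg.

Lemma continuous_Zfield i : continuous (Zfield i).
Proof.
have cppow q (g : 'rV[R]_m.+1 -> R) : 0 < q -> continuous g -> continuous (fun x => ppow q (g x)).
  by move=> q0 cg; apply: (cont_comp (F := ppow q)) => //; exact: continuous_ppow.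
have cexp (g : 'rV[R]_m.+1 -> R) : continuous g -> continuous (fun x => expR (g x)).
  by move=> cg; apply: (cont_comp (F := expR)) => //; exact: continuous_expR.
have cz : continuous (fun x : 'rV[R]_m.+1 => x ord0 ord0) by exact: continuous_coord.
have cs : continuous (fun x => sqn (tl x)) by exact: (smooth_continuous smooth_sqn_tl).
have cr : continuous (fun x => 1 / 2 - sqn (tl x)) by apply: contB => //; exact: contC.
have cE (g : 'rV[R]_m.+1 -> R) : continuous g -> continuous (fun x => Eprof (g x)).
  move=> cg; apply: cexp; apply: contM; first exact: contC.
  by apply: cppow => //; rewrite addr_gt0.
have cq : continuous (fun x => Gprof1 (sqn (tl x))).
  apply: contM; first exact: contC.
  apply: contB; first exact: contC.
  by apply: contM; [exact: contC|exact: cppow].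
case: (unliftP ord0 i) => [j ->|->].
  rewrite (_ : Zfield _ = fun x => - (2 / sg) * (tl x ord0 j * Gprof1 (sqn (tl x))) *
    Eprof1 (x ord0 ord0)); last by apply/funext => x; rewrite /Zfield fieldSE.
  apply: contM.
    apply: contM; first exact: contC.
    apply: contM => //; under eq_fun do rewrite tlE; exact: continuous_coord.
  apply: contM; last exact: cE.
  apply: contM; first exact: contC.
  by apply: contM; [exact: contC|exact: cppow].
rewrite (_ : Zfield _ = fun x => Hprof (sqn (tl x)) +
    multiplier (m := m) sg Gprof1 Gprof2 (sqn (tl x)) *
    (Eprof (x ord0 ord0) - Hprof (sqn (tl x)))); last first.
  by apply/funext => x; rewrite /Zfield field0E.
have cH : continuous (fun x => Hprof (sqn (tl x))).
  apply: cE; apply: (cppow _ _ _); first by rewrite (lt_trans _ k1).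
  apply: contM; first exact: contC.
  apply: contD; first by apply: contB => //; exact: contC.
  by apply: contM; [exact: contC|exact: cppow].
apply: contD; first exact: cH.
apply: contM; last by apply: contB; [exact: (cE (fun x => _) cz)|exact: cH].
apply: contM; last exact: contC.
apply: contD; first by apply: contM; [exact: contC|exact: cq].
apply: contM; first by apply: contM; [exact: contC|exact: cs].
by apply: contM; [exact: contC|apply: contM; [exact: contC|exact: (cppow _ (fun x => _) _ cr)]].
Qed.

(** Compactness applied to joint convergence: for points near [x] and small [d], both [Zdamped d i]
    and [Zfield i] are close to [Zfield i x]. *)
Lemma Zdamped_uniform (e : R) : 0 < e -> exists2 d, 0 < d &
  forall i x, sqn x <= 1 -> `|Zdamped d i x - Zfield i x| <= e.
Proof.
move=> e0.
pose P d x := forall i, `|Zdamped d i x - Zfield i x| <= e.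
have cB : compact [set x : 'rV[R]_m.+1 | sqn x <= 1] by exact: compact_sqn_le.
have : \forall d \near (0 : R)^'+, [set x : 'rV[R]_m.+1 | sqn x <= 1] `<=` P d.
  move/compact_near_coveringP : cB => /(_ _ (0 : R)^'+ P _); apply=> x _.
  pose FF := filter_prod (nbhs x) (0 : R)^'+.
  have c2 : t.2 @[t --> FF] --> (0 : R).
    by apply: cvg_trans (@cvg_snd _ _ (nbhs x) (0 : R)^'+ _) _; exact: cvg_within.
  have p2 : \forall t \near FF, 0 < t.2.
    exists (setT, [set t | 0 < t]) => /=; last by move=> [a b] [].
    by split; [exact: filterT|exact: nbhs_right_gt].
  have c1 : t.1 @[t --> FF] --> x by exact: cvg_fst.
  have e2 : 0 < e / 2 by rewrite divr_gt0.
  have PF : ProperFilter FF by exact: filter_prod_proper.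
  have H1 i := @cvg_Zdamped _ _ PF _ _ _ c2 p2 c1 i.
  have H2 i : Zfield i t.1 @[t --> FF] --> Zfield i x.
    by apply: (@cvg_comp _ _ _ fst (Zfield i) FF _ _ c1); exact: continuous_Zfield.
  have A1 : \forall t \near FF, forall i, `|Zfield i x - Zdamped t.2 i t.1| <= e / 2.
    apply: filter_forall => i; by have /cvgrPdist_le := H1 i; apply.
  have A2 : \forall t \near FF, forall i, `|Zfield i x - Zfield i t.1| <= e / 2.
    apply: filter_forall => i; by have /cvgrPdist_le := H2 i; apply.
  apply: filterS2 A1 A2 => -[a b] /= h1 h2 i.
  have E (t u v : R) : t - u = (v - u) - (v - t) by ring.
  rewrite (E _ _ (Zfield i x)); apply: (le_trans (ler_normB _ _)).
  by rewrite (splitr e); apply: lerD; [exact: h2|exact: h1].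
move=> h.
have [d [d0 hd]] : exists d, 0 < d /\ [set x : 'rV[R]_m.+1 | sqn x <= 1] `<=` P d.
  by apply: (@filter_ex _ (0 : R)^'+); apply: filterI => //; exact: nbhs_right_gt.
by exists d => // i x x1; exact: hd.
Qed.

End calibrating_field.

(** * Profiles of the sheets *)

Section sheet_profile.
Context {R : realType}.
Implicit Types (s l c : R).
Variables (k ep : R).
Hypotheses (k0 : 0 < k) (ep0 : 0 < ep).
Local Notation Gprof := (Gprof ep).
Local Notation Gprof1 := (Gprof1 ep).

Let kn0 : k != 0. Proof. by rewrite gt_eqF. Qed.

Lemma Gprof_ge s : 1 / 2 <= s -> Gprof s = ep * (s - 1 / 2).
Proof. by move=> s12; rewrite /Gprof ppow_le0 ?mulr0 ?addr0//; lra. Qed.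

(* For [s < 1 / 2] this is the flat sheet when [c <= l] and the top of the lens
   when [l < c]; for [1 / 2 <= s] the correction is [0]. *)
Definition sheet c l s : R := ppow k (ep * (s - 1 / 2) - l) +
  (l < c)%R%:R * (ppow k (Gprof s) - ppow k (ep * (s - 1 / 2))).

Definition sheet1 c l s : R := k * ppow (k - 1) (ep * (s - 1 / 2) - l) * ep +
  (l < c)%R%:R * (k * ppow (k - 1) (Gprof s) * Gprof1 s -
    k * ppow (k - 1) (ep * (s - 1 / 2)) * ep).

Lemma sheet_lens c l s : 0 <= l -> s <= 1 / 2 ->
  sheet c l s = (l < c)%R%:R * ppow k (Gprof s).
Proof.
move=> l0 s12; have h : ep * (s - 1 / 2) <= 0 by rewrite pmulr_rle0// subr_le0.
have h' : ep * (s - 1 / 2) - l <= 0 by lra.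
by rewrite /sheet (ppow_le0 kn0 h) (ppow_le0 kn0 h') add0r subr0.
Qed.

Lemma sheet_outer c l s : 1 / 2 <= s -> sheet c l s = ppow k (ep * (s - 1 / 2) - l).
Proof. by move=> s12; rewrite /sheet Gprof_ge// subrr mulr0 addr0. Qed.

End sheet_profile.

(** * Alignment of the field with the normals of the sheets, and regularity of its norm *)

Section calibration_identity.
Context {R : realType} {m : nat}.
Implicit Types (x : 'rV[R]_m.+1) (s z l c : R).
Variables (alpha k p nu ep sg : R).
Hypotheses (m0 : (0 < m)%N) (alpha0 : 0 < alpha) (alpha1 : alpha < 1)
  (pE : p = (1 + alpha) / 2) (kE : k * (1 - alpha) = 2)
  (nu0 : 0 < nu) (nuE : expR nu = 1 + 1 / 300)
  (ep0 : 0 < ep) (ep1 : ep <= 1) (sgE : sg = 2 * m%:R * ep) (cal : nu * (p + 1) = sg * k).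
Local Notation Eprof := (Eprof p nu).
Local Notation Eprof1 := (Eprof1 p nu).
Local Notation Gprof := (Gprof ep).
Local Notation Gprof1 := (Gprof1 ep).
Local Notation Gprof2 := (Gprof2 ep).
Local Notation Hprof := (Hprof k p nu ep).
Local Notation Z := (@Zfield R m k p nu ep sg).
Local Notation sheet := (sheet k ep).
Local Notation sheet1 := (sheet1 k ep).
Local Notation mult := (multiplier (m := m) sg Gprof1 Gprof2).
Local Notation Omega := (@oball R m.+1).

Let p0 : 0 < p. Proof. by rewrite pE divr_gt0// addr_gt0. Qed.
Let k2 : 2 < k.
Proof.
have h : 0 < 1 - alpha by rewrite subr_gt0.
rewrite -(ltr_pM2r h) kE; move: alpha0 => ?; lra.
Qed.
Let k0 : 0 < k. Proof. exact: lt_trans k2. Qed.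
Let k1 : 1 < k. Proof. by apply: lt_trans k2; rewrite ltr1n. Qed.
Let kn0 : k != 0. Proof. by rewrite gt_eqF. Qed.
Let kp : k * p = k - 1.
Proof. by rewrite pE; have := kE; rewrite mulrBr mulr1 => h; lra. Qed.
Let mR : 1 <= m%:R :> R. Proof. by rewrite ler1n. Qed.
Let sg0 : 0 < sg. Proof. by rewrite sgE !mulr_gt0// (lt_le_trans ltr01 mR). Qed.

Lemma Gprof1_ge s : 1 / 2 <= s -> Gprof1 s = ep.
Proof. by move=> s12; rewrite /Gprof1 ppow_le0 ?mulr0 ?subr0 ?mulr1//; lra. Qed.

Lemma Gprof_le s : 0 <= s <= 1 -> Gprof s <= ep / 2.
Proof.
move=> /andP[s0 s1]; rewrite ler_wpM2l ?(ltW ep0)//.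
have [h|h] := leP (1 / 2) s; first by rewrite ppow_le0//; lra.
have r0 : 0 <= 1 / 2 - s by lra.
rewrite ppow_ge0E// powR_mulrn//; set r := 1 / 2 - s in r0 *.
have r3 : r ^+ 3 <= (1 / 2) ^+ 3 by rewrite lerXn2r ?nnegrE// /r; lra.
have r4 : r ^+ 4 <= r * (1 / 2) ^+ 3 by rewrite exprS ler_wpM2l.
have E : (1 / 2 : R) ^+ 3 = 1 / 8 by rewrite !exprS expr0; field.
rewrite E in r4; rewrite /r in r4 r0 *; lra.
Qed.

Lemma Eprof_bounds z : z <= 1 -> 1 <= Eprof z <= 1 + 1 / 300.
Proof.
move=> z1; have h0 := ppow_ge0 (p + 1) z.
have h1 : ppow (p + 1) z <= 1.
  rewrite -[leRHS](_ : ppow (p + 1) 1 = 1); last by rewrite ppow_ge0E// powR1.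
  by apply: ppow_mono => //; rewrite addr_ge0// ltW.
rewrite -nuE -[X in X <= _ <= _]expR0 !ler_expR mulr_ge0 ?(ltW nu0)//=.
by rewrite ler_piMr// ltW.
Qed.

Lemma Hprof_bounds s : 0 <= s <= 1 -> 1 <= Hprof s <= 1 + 1 / 300.
Proof.
move=> /Gprof_le h; apply: Eprof_bounds.
rewrite -[leRHS](_ : ppow k 1 = 1); last by rewrite ppow_ge0E// powR1.
apply: ppow_mono; first exact: ltW.
by apply: (le_trans h); have := ep1; lra.
Qed.

Lemma mult_ge s : 1 / 2 <= s -> mult s = 1.
Proof.
move=> s12; rewrite /multiplier Gprof1_ge// /Gprof2 ppow_le0 ?mulr0 ?addr0 -?sgE ?divff ?gt_eqF//.
lra.
Qed.

(** Below 1/2, with r = 1/2 - s, one has |1 - 64 r^3| <= 7 and 384 s r^2 <= 48, and 7 m + 48 <= 55 m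
    because 1 <= m. *)
Lemma mult_le s : 0 <= s <= 1 -> `|mult s| <= 55.
Proof.
move=> /andP[s0 s1]; have [h|h] := leP (1 / 2) s.
  by rewrite mult_ge// normr1 ler1n.
have r0 : 0 <= 1 / 2 - s by lra.
rewrite /multiplier normrM normfV (gtr0_norm sg0) ler_pdivrMr// sgE.
rewrite /Gprof1 /Gprof2 !ppow_ge0E// !powR_mulrn//; set r := 1 / 2 - s in r0 *.
have r12 : r <= 1 / 2 by rewrite /r; lra.
have q0 : 0 <= r ^+ 2 by exact: exprn_ge0.
have c0 : 0 <= r ^+ 3 by exact: exprn_ge0.
have q1 : r ^+ 2 <= (1 / 2) ^+ 2 by rewrite lerXn2r ?nnegrE//; lra.
have c1 : r ^+ 3 <= (1 / 2) ^+ 3 by rewrite lerXn2r ?nnegrE//; lra.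
rewrite (_ : (1 / 2 : R) ^+ 2 = 1 / 4) in q1; last by rewrite !exprS expr0; field.
rewrite (_ : (1 / 2 : R) ^+ 3 = 1 / 8) in c1; last by rewrite !exprS expr0; field.
have -> : 2 * m%:R * (ep * (1 - 64 * r ^+ 3)) + 4 * s * (ep * (192 * r ^+ 2)) =
  (2 * ep) * (m%:R * (1 - 64 * r ^+ 3) + 384 * (s * r ^+ 2)) by ring.
rewrite normrM ger0_norm ?mulr_ge0 ?(ltW ep0)//.
rewrite (_ : 55 * _ = (2 * ep) * (55 * m%:R)); last by ring.
rewrite ler_wpM2l ?mulr_ge0 ?(ltW ep0)//.
have b1 : s * r ^+ 2 <= 1 / 2 * (1 / 4) by apply: ler_pM => //; lra.
have b2 : 0 <= s * r ^+ 2 by exact: mulr_ge0.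
have b3 : `|m%:R * (1 - 64 * r ^+ 3)| <= m%:R * 7.
  rewrite normrM normr_nat ler_wpM2l// ler_norml; apply/andP; split; lra.
rewrite (le_trans (ler_normD _ _))// [X in _ + X]ger0_norm ?mulr_ge0//.
move: mR b1 b3; lra.
Qed.

(** [Eprof] and [Hprof] both lie in [1, 1 + 1/300], so the vertical component is at least 1 -
    55/300. This bounds the weight from below and makes Z point to the same side as the upward
    normals. *)
Lemma Zfield0_ge x : sqn x <= 1 -> 1 / 2 <= Z ord0 x.
Proof.
move=> x1; rewrite /Zfield field0E; set s := sqn (tl x); set z := x ord0 ord0.
have s01 : 0 <= s <= 1.
  rewrite sqn_ge0/=; apply: le_trans x1; rewrite sqn_tl lerDr sqr_ge0//.
have z1 : z <= 1 by apply: le_trans (ler_norm _) _; exact: sqn_le1_coord.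
have /andP[h1 h2] := Hprof_bounds s01; have /andP[e1 e2] := Eprof_bounds z1.
have : `|mult s * (Eprof z - Hprof s)| <= 55 * (1 / 300).
  rewrite normrM ler_pM// ?mult_le// ler_norml; apply/andP; split; lra.
rewrite ler_norml => /andP[h3 _]; lra.
Qed.

Definition weight x : R := enorm (\row_i Z i x).

Lemma weight_ge x : sqn x <= 1 -> 1 / 2 <= weight x.
Proof.
move=> x1; apply: le_trans (Zfield0_ge x1) _; apply: le_trans (ler_norm _) _.
by have := coord_le_enorm (\row_i Z i x) ord0; rewrite mxE.
Qed.

Lemma measurable_weight : measurable_fun setT weight.
Proof.
apply: (measurable_enorm (W := Z)) => i; apply: continuous_measurable_rV.
exact: continuous_Zfield.
Qed.

Lemma weight_bounded : exists K, forall x, sqn x <= 1 -> weight x <= K.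
Proof.
have c : compact [set x : 'rV[R]_m.+1 | sqn x <= 1] by exact: compact_sqn_le.
have /choice[C hC] : forall i, exists M, forall x, sqn x <= 1 -> `|Z i x| <= M.
  move=> i; apply: continuous_bounded_compact c _.
  exact: (@continuous_Zfield R m k p nu ep sg k1 p0 i).
exists (\sum_i C i) => x x1; apply: le_trans (enorm_le_sum _) _.
by apply: ler_sum => i _; rewrite mxE; exact: hC.
Qed.

(* The horizontal components of [Z] behave like [ppow p z] with [p < 1], but
   [p + p = 1 + alpha]. *)
Lemma weight_sqr x : weight x ^+ 2 =
  Z ord0 x ^+ 2 + (2 / sg) ^+ 2 * (sqn (tl x) * Gprof1 (sqn (tl x)) ^+ 2) *
    ((nu * (p + 1)) ^+ 2 * ppow (1 + alpha) (x ord0 ord0) * Eprof (x ord0 ord0) ^+ 2).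
Proof.
rewrite sqr_enorm /sqn big_ord_recl mxE; congr (_ + _).
have pp z : ppow p z ^+ 2 = ppow (1 + alpha) z.
  rewrite /ppow -powR_mulrn ?powR_ge0// -powRrM; congr (_ `^ _); rewrite pE; lra.
under eq_bigr do rewrite mxE /Zfield fieldSE.
rewrite -pp mulr_suml mulr_sumr mulr_suml; apply: eq_bigr => j _.
by rewrite /Eprof1 /sqn; ring.
Qed.

(** The square of the weight involves no truncated power of exponent below 1 + alpha, and the lower
    bound 1/2 on the weight lets the square root through. *)
Lemma C1_hoelder_weight : C1_hoelder alpha Omega weight.
Proof.
apply: (C1_hoelder_funP alpha0); have a1 := ltW alpha1.
rewrite (_ : weight = fun x => Num.sqrt (weight x ^+ 2)); last first.
  by apply/funext => x; rewrite sqrtr_sqr ger0_norm// enorm_ge0.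
apply: (@C1_hoelder_sqrt _ _ alpha alpha0 a1 _ ((1 / 2) ^+ 2)).
- by rewrite exprn_gt0// divr_gt0.
- move=> x Ox; rewrite lerXn2r ?nnegrE ?enorm_ge0 ?divr_ge0// weight_ge//; exact: ltW.
pose C := @C1_hoelder_fun R m.+1 alpha.
have cc (c : R) : C (fun=> c) by exact: C1_hoelder_cst.
have cM g h : C g -> C h -> C (fun x => g x * h x) by exact: C1_hoelderM.
have cD g h : C g -> C h -> C (fun x => g x + h x) by exact: C1_hoelderD.
have cB g h : C g -> C h -> C (fun x => g x - h x).
  by move=> Cg Ch; under eq_fun do rewrite -mulN1r; apply: (cD _ _) => //; exact: (cM _ _).
have cP b g : 1 + alpha <= b -> C g -> C (fun x => ppow b (g x)) by exact: C1_hoelder_ppow.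
have cX g : C g -> C (fun x => g x ^+ 2) by move=> Cg; exact: (cM _ _ Cg Cg).
have cE g : C g -> C (fun x => expR (g x)) by exact: C1_hoelder_expR.
have cz : C (fun x => x ord0 ord0) by exact: C1_hoelder_coord.
have cs : C (fun x => sqn (tl x)).
  rewrite /sqn; apply: C1_hoelder_sum => // i; apply: (cX (fun x => tl x ord0 i)).
  by under eq_fun do rewrite tlE; exact: C1_hoelder_coord.
have cr : C (fun x => 1 / 2 - sqn (tl x)) by exact: (cB _ _).
have cEz : C (fun x => Eprof (x ord0 ord0)).
  by apply: (cE (fun x => _)); apply: (cM (fun=> nu)) => //; apply: (cP (p + 1)) => //; rewrite pE; move: alpha1; lra.
have cq : C (fun x => Gprof1 (sqn (tl x))).
  apply: (cM (fun=> ep)) => //; apply: (cB (fun=> 1)) => //; apply: (cM (fun=> 64)) => //.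
  by apply: (cP 3) => //; move: alpha1; lra.
have cq1 : C (fun x => Gprof2 (sqn (tl x))).
  apply: (cM (fun=> ep)) => //; apply: (cM (fun=> 192)) => //.
  by apply: (cP 2) => //; move: alpha1; lra.
have cG : C (fun x => Gprof (sqn (tl x))).
  apply: (cM (fun=> ep)) => //; apply: (cD _ _); first exact: (cB _ _).
  by apply: (cM (fun=> 16)) => //; apply: (cP 4) => //; move: alpha1; lra.
have cH : C (fun x => Hprof (sqn (tl x))).
  apply: (cE (fun x => _)); apply: (cM (fun=> nu)) => //.
  (* The two powers compose into one of exponent k (p + 1) = 2 k - 1, above 1 + alpha because 2 <
     k. *)
  under eq_fun do rewrite ppow_comp; apply: (cP _ _) => //.
  by rewrite mulrDr kp; move: alpha1 k2; lra.
have cL : C (fun x => mult (sqn (tl x))).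
  apply: (cM _ (fun=> sg^-1)) => //; apply: (cD _ _).
    by apply: (cM (fun=> _)).
  by apply: (cM _ _) => //; exact: (cM (fun=> 4)).
have cZ0 : C (Z ord0).
  rewrite (_ : Z ord0 = fun x => Hprof (sqn (tl x)) + mult (sqn (tl x)) *
    (Eprof (x ord0 ord0) - Hprof (sqn (tl x)))); last first.
    by apply/funext => x; rewrite /Zfield field0E.
  by apply: (cD _ _) => //; apply: (cM _ _) => //; exact: (cB _ _).
rewrite (funext weight_sqr); apply: (cD _ _); first exact: (cX _).
apply: (cM _ _); first by apply: (cM (fun=> _)) => //; apply: (cM _ _) => //; exact: (cX _).
apply: (cM _ _); last exact: (cX _).
by apply: (cM (fun=> _)) => //; exact: (cP _ _).
Qed.

(** Z is [Z ord0] times the normal of the sheet, for three reasons: for 1/2 <= s the multiplier is 1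
    and the vertical part is [Eprof z]; on the lens top [Eprof z] equals [Hprof s]; on the flat
    piece the slope is 0 and [Eprof1] vanishes at 0. *)
Lemma Zfield_sheet c l (y : 'rV[R]_m) j : 0 <= l ->
  sqn (rV_cons (sheet c l (sqn y), y)) <= 1 ->
  Z (lift ord0 j) (rV_cons (sheet c l (sqn y), y)) =
  Z ord0 (rV_cons (sheet c l (sqn y), y)) * - (2 * y ord0 j * sheet1 c l (sqn y)).
Proof.
move=> l0 x1; rewrite /Zfield fieldSE field0E tl_cons rV_consE0 /=; set s := sqn y.
have K0 : k - 1 != 0 by rewrite subr_eq0 gt_eqF.
have nusg : nu * (p + 1) / sg = k by rewrite cal mulrC mulKf// gt_eqF.
(* The relation k p = k - 1 turns [ppow p] of a k-th power into a power k - 1, and [cal] matches the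
   constants. *)
have E1 w : Eprof1 (ppow k w) / sg = k * ppow (k - 1) w * Eprof (ppow k w).
  by rewrite /Eprof1 ppow_comp kp -nusg; ring.
have E2 q w : - (2 / sg) * (y ord0 j * q) * Eprof1 (ppow k w) =
  - (2 * y ord0 j * (k * ppow (k - 1) w * q)) * Eprof (ppow k w).
  transitivity (- 2 * y ord0 j * q * (Eprof1 (ppow k w) / sg)); first by ring.
  by rewrite E1; ring.
have [s12|s12] := leP (1 / 2) s.
  rewrite sheet_outer// mult_ge// [1 * (_ - Hprof s)]mul1r (addrC (Hprof s)) subrK Gprof1_ge// E2 /sheet1.
  by rewrite Gprof_ge// Gprof1_ge// subrr mulr0 addr0; ring.
have h : ep * (s - 1 / 2) <= 0 by rewrite pmulr_rle0// subr_le0 ltW.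
have h' : ep * (s - 1 / 2) - l <= 0 by lra.
rewrite (sheet_lens k0 ep0)// ?(ltW s12)// /sheet1 (ppow_le0 K0 h) (ppow_le0 K0 h').
rewrite !mulr0 !mul0r add0r subr0.
have [lc|lc] := ltP l c; last first.
  rewrite !mul0r !mulr0 oppr0 mulr0; have := E2 (Gprof1 s) 0.
  by rewrite (ppow_le0 kn0)// (ppow_le0 K0)// !(mulr0, mul0r, oppr0).
by rewrite !mul1r E2 /Hprof; ring.
Qed.

End calibration_identity.

(** * Sheets and minimizers *)

Section level_intervals.
Context {R : realType}.
Local Notation leb := (@lebesgue_measure R).
Implicit Types (T c l s z b : R).

Lemma lebesgue_between_itv T b (A : set R) : b <= T -> measurable A ->
  `]b, T[ `<=` A -> A `<=` `[b, T] -> leb A = (T - b)%:E.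
Proof.
move=> bT mA bA Ab; apply/eqP; rewrite eq_le; apply/andP; split.
  have -> : (T - b)%:E = leb `[b, T]%classic.
    rewrite lebesgue_measure_itv/= lte_fin; case: ltP => // Tb.
    by rewrite (@le_anti _ _ b T) ?subrr// bT.
  by apply: le_measure; rewrite ?inE//; exact: measurable_itv.
have -> : (T - b)%:E = leb `]b, T[%classic.
  rewrite lebesgue_measure_itv/= lte_fin; case: ltP => // Tb.
  by rewrite (@le_anti _ _ b T) ?subrr// bT.
by apply: le_measure; rewrite ?inE//; exact: measurable_itv.
Qed.

(** The value of [h] at the threshold [b] is left free: it varies with the case at hand and does not
    affect the length. *)
Lemma Rintegral_level_interval T b (h : R -> R) : 0 <= b <= T -> measurable_fun setT h ->
  (forall l, 0 <= l <= T -> b < l -> h l = 1) ->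
  (forall l, 0 <= l <= T -> l < b -> h l = 0) ->
  (forall l, h l = 0 \/ h l = 1) ->
  \int[leb]_l (\1_`[0, T]%classic l * h l) = T - b.
Proof.
move=> /andP[b0 bT] mh h1 h0 h01.
pose A := `[0, T]%classic `&` (h @^-1` [set 1]).
have mA : measurable A.
  apply: measurableI; first exact: measurable_itv.
  by rewrite -[X in measurable X]setTI; exact: mh.
have -> : (fun l => \1_`[0, T]%classic l * h l) = \1_A.
  apply/funext => l; rewrite /A !indicE in_setI.
  have [lT|lT] := boolP (l \in `[0, T]%classic); last by rewrite mul0r.
  rewrite mul1r /=; case: (h01 l) => hl; rewrite hl.
    by rewrite memNset//= hl; apply/eqP; rewrite eq_sym oner_eq0.
  by rewrite mem_set.
rewrite /Rintegral integral_indic// setIT.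
rewrite [X in fine X](_ : _ = (T - b)%:E)//; apply: lebesgue_between_itv => //.
- move=> l /=; rewrite in_itv/= => /andP[bl lT].
  have l0T : 0 <= l <= T by rewrite (le_trans b0 (ltW bl)) (ltW lT).
  by split; [rewrite /= in_itv|exact: h1].
- move=> l [/=]; rewrite !in_itv/= => l0T hl; have /andP[_ ->] := l0T; rewrite andbT leNgt.
  by apply/negP => /(h0 _ l0T); rewrite hl => /eqP; rewrite oner_eq0.
Qed.

End level_intervals.

(** * The stacked function in closed form and its boundary values *)

Section sheets.
Context {R : realType} {m : nat}.
Implicit Types (x p : 'rV[R]_m.+1) (y : 'rV[R]_m) (c l s z b : R).
Variables (k ep : R).
Hypotheses (k2 : 2 < k) (ep0 : 0 < ep) (ep1 : ep <= 1).
Local Notation T := (ep / 4).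
Local Notation sheet := (sheet k ep).
Local Notation sheet1 := (sheet1 k ep).

Let k0 : 0 < k. Proof. exact: lt_trans k2. Qed.
Let k1 : 1 < k. Proof. by apply: lt_trans k2; rewrite ltr1n. Qed.
Let k10 : 0 < k - 1. Proof. by rewrite subr_gt0. Qed.
Let T0 : 0 < T. Proof. by rewrite divr_gt0. Qed.

Definition sheet_graph c p : R := sheet c (p ord0 ord0) (sqn (tl p)).

Definition sheet_slope c (j : 'I_m) p : R :=
  2 * tl p ord0 j * sheet1 c (p ord0 ord0) (sqn (tl p)).

Lemma is_derive_sheet c l s : is_derive s 1 (sheet c l) (sheet1 c l s).
Proof.
have aff b : is_derive s 1 (fun s : R => ep * (s - 1 / 2) - b) ep.
  have h := is_deriveB (is_deriveZ ep (is_deriveB (is_derive_id s 1)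
    (is_derive_cst (1 / 2 : R) s 1))) (is_derive_cst b s 1).
  by refine (is_derive_eq h _); rewrite /GRing.scale/= !subr0 mulr1.
have D b : is_derive s 1 (fun s : R => ppow k (ep * (s - 1 / 2) - b))
    (k * ppow (k - 1) (ep * (s - 1 / 2) - b) * ep).
  exact: (@is_derive1_comp _ (ppow k) _ s _ _ (is_derive_ppow _ k1) (aff b)).
have D0 : is_derive s 1 (fun s : R => ppow k (ep * (s - 1 / 2)))
    (k * ppow (k - 1) (ep * (s - 1 / 2)) * ep).
  by have := D 0; rewrite subr0; congr (is_derive _ _ _ _); apply/funext => t; rewrite subr0.
have dG : is_derive s 1 (Gprof ep) (Gprof1 ep s).
  have r : is_derive s 1 (fun s : R => 1 / 2 - s) (- 1).
    have h := is_deriveB (is_derive_cst (1 / 2 : R) s 1) (is_derive_id s 1).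
    by refine (is_derive_eq h _); rewrite sub0r.
  have four : 1 < 4 :> R by rewrite ltr1n.
  have h := @is_derive1_comp _ (ppow 4) (fun s : R => 1 / 2 - s) s _ _ (is_derive_ppow (1 / 2 - s) four) r.
  have h1 := is_deriveZ ep (is_deriveD (is_deriveB (is_derive_id s 1)
    (is_derive_cst (1 / 2 : R) s 1)) (is_deriveZ 16 h)).
  refine (is_derive_eq h1 _); rewrite /GRing.scale/= /Gprof1 (_ : 4 - 1 = 3); last by ring.
  by rewrite subr0; ring.
have DG := @is_derive1_comp _ (ppow k) (Gprof ep) s _ _ (is_derive_ppow _ k1) dG.
have h := is_deriveD (D l) (is_deriveZ ((l < c)%R%:R : R) (is_deriveB DG D0)).
exact: h.
Qed.

Lemma is_derive_sheet_graph c l j y :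
  is_derive y (unitv j) (fun y => sheet_graph c (rV_cons (l, y))) (sheet_slope c j (rV_cons (l, y))).
Proof.
have H := is_derive_comp1 (is_derive_sqn y j) (is_derive_sheet c l (sqn y)).
rewrite (_ : (fun _ => _) = fun y : 'rV[R]_m => sheet c l (sqn y)); last first.
  by apply/funext => w; rewrite /sheet_graph rV_consE0 tl_cons.
by refine (is_derive_eq H _); rewrite /sheet_slope rV_consE0 tl_cons mulrC.
Qed.

Lemma continuous_sheet_graph c l : continuous (fun y => sheet_graph c (rV_cons (l, y))).
Proof.
rewrite (_ : (fun _ => _) = fun y : 'rV[R]_m => sheet c l (sqn y)); last first.
  by apply/funext => w; rewrite /sheet_graph rV_consE0 tl_cons.
apply: (cont_comp (F := sheet c l)); last exact: cont_sqn.
by move=> s; exact: derivable_continuous (is_derive_sheet c l s).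
Qed.

Let cpow q (g : 'rV[R]_m.+1 -> R) : 0 < q -> continuous g -> continuous (fun x => ppow q (g x)).
Proof. by move=> q0 cg; apply: (cont_comp (F := ppow q)) => //; exact: continuous_ppow. Qed.

Let cz : continuous (fun x : 'rV[R]_m.+1 => x ord0 ord0). Proof. exact: continuous_coord. Qed.
Let cs : continuous (fun x : 'rV[R]_m.+1 => sqn (tl x)).
Proof. exact: (smooth_continuous smooth_sqn_tl). Qed.
Let cw : continuous (fun x : 'rV[R]_m.+1 => ep * (sqn (tl x) - 1 / 2)).
Proof. by apply: contM; [exact: contC|apply: contB; [exact: cs|exact: contC]]. Qed.
Let cr : continuous (fun x : 'rV[R]_m.+1 => 1 / 2 - sqn (tl x)).
Proof. by apply: contB; [exact: contC|exact: cs]. Qed.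
Let cwl : continuous (fun x : 'rV[R]_m.+1 => ep * (sqn (tl x) - 1 / 2) - x ord0 ord0).
Proof. by apply: contB; [exact: cw|exact: cz]. Qed.
Let cG : continuous (fun x : 'rV[R]_m.+1 => Gprof ep (sqn (tl x))).
Proof.
apply: contM; first exact: contC.
apply: contD; first by apply: contB; [exact: cs|exact: contC].
by apply: contM; [exact: contC|exact: (cpow (q := 4) _ cr)].
Qed.
Let cG1 : continuous (fun x : 'rV[R]_m.+1 => Gprof1 ep (sqn (tl x))).
Proof.
apply: contM; first exact: contC.
apply: contB; first exact: contC.
by apply: contM; [exact: contC|exact: (cpow (q := 3) _ cr)].
Qed.

(** The slope is [A1] plus [hv (c - l)] times [B1], with both functions continuous: it jumps only in
    the level, at [c]. Measurability and bounds on the cube follow, while every single sheet is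
    C^1. *)
Let A1 (j : 'I_m) x : R := 2 * tl x ord0 j *
  (k * ppow (k - 1) (ep * (sqn (tl x) - 1 / 2) - x ord0 ord0) * ep).
Let B1 (j : 'I_m) x : R := 2 * tl x ord0 j * (k * ppow (k - 1) (Gprof ep (sqn (tl x))) * Gprof1 ep (sqn (tl x)) -
    k * ppow (k - 1) (ep * (sqn (tl x) - 1 / 2)) * ep).

Let ctl2 j : continuous (fun x : 'rV[R]_m.+1 => 2 * tl x ord0 j).
Proof.
apply: contM; first exact: contC.
by under eq_fun do rewrite tlE; exact: continuous_coord.
Qed.

Let cA1 j : continuous (A1 j).
Proof.
apply: contM; first exact: ctl2.
apply: contM; last exact: contC.
by apply: contM; [exact: contC|exact: (cpow k10 cwl)].
Qed.

Let cB1 j : continuous (B1 j).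
Proof.
apply: contM; first exact: ctl2.
apply: contB.
  apply: contM; last exact: cG1.
  by apply: contM; [exact: contC|exact: (cpow k10 cG)].
apply: contM; last exact: contC.
by apply: contM; [exact: contC|exact: (cpow k10 cw)].
Qed.

Let hvE c l : ((l < c)%R%:R : R) = hv (c - l).
Proof. by rewrite /hv subr_gt0; case: ifP. Qed.

Let mhv c : measurable_fun setT (fun x : 'rV[R]_m.+1 => hv (c - x ord0 ord0)).
Proof.
apply: measurableT_comp; first exact: measurable_hv.
by apply: continuous_measurable_rV; apply: contB; [exact: contC|exact: cz].
Qed.

Let slopeE c j : sheet_slope c j = fun x => A1 j x + hv (c - x ord0 ord0) * B1 j x.
Proof. by apply/funext => x; rewrite /sheet_slope /sheet1 hvE /A1 /B1; ring. Qed.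

Lemma measurable_sheet_slope c j : measurable_fun setT (sheet_slope c j).
Proof.
rewrite slopeE; apply: measurable_funD; first by apply: continuous_measurable_rV; exact: cA1.
apply: measurable_funM; first exact: mhv.
by apply: continuous_measurable_rV; exact: cB1.
Qed.

Lemma measurable_sheet_graph c : measurable_fun setT (sheet_graph c).
Proof.
rewrite /sheet_graph /sheet; apply: measurable_funD.
  by apply: continuous_measurable_rV; exact: (cpow k0 cwl).
under eq_fun do rewrite hvE; apply: measurable_funM; first exact: mhv.
apply: continuous_measurable_rV; apply: contB; first exact: (cpow k0 cG).
exact: (cpow k0 cw).
Qed.

Lemma sheet_slope_bounded c j : exists M, forall p, cube p -> `|sheet_slope c j p| <= M.
Proof.
have [MA hA] := continuous_bounded_compact (@compact_cube R m.+1) (@cA1 j).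
have [MB hB] := continuous_bounded_compact (@compact_cube R m.+1) (@cB1 j).
exists (MA + MB) => p cp; rewrite slopeE (le_trans (ler_normD _ _))// lerD ?hA//.
apply: le_trans (hB p cp); rewrite normrM ler_piMl//.
by rewrite ger0_norm ?hv_ge0// hv_le1.
Qed.

Lemma continuous_sheet_slope c l j : continuous (fun y => sheet_slope c j (rV_cons (l, y))).
Proof.
rewrite slopeE; under eq_fun do rewrite rV_consE0 /=.
apply: contD; first exact: (@continuous_slice1 _ _ (A1 j)) (@cA1 j).
by apply: contM; [exact: contC|exact: (@continuous_slice1 _ _ (B1 j)) (@cB1 j)].
Qed.

Definition clamp b : R := Num.min (Num.max b 0) T.

(** The closed form of [layered], from which trace and distinctness are read off. The factor
    [1 - hv (1 / 2 - s)] selects 1/2 <= s; for s < 1/2 and z > 0, the levels below [x] are all of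
    them above the lens, and those from [c] to [T] inside it. *)
Definition layer_value c x : R :=
  hv (x ord0 ord0) * ((1 - hv (1 / 2 - sqn (tl x))) *
     (T - clamp (ep * (sqn (tl x) - 1 / 2) - ppow k^-1 (x ord0 ord0))) +
   hv (1 / 2 - sqn (tl x)) *
     (T - c * (1 - hv (x ord0 ord0 - ppow k (Gprof ep (sqn (tl x))))))).

Lemma clamp_bounds b : 0 <= clamp b <= T.
Proof.
rewrite /clamp le_min (ltW T0) andbT ge_min lexx orbT andbT.
by rewrite le_max lexx orbT.
Qed.

Lemma sheet_ge0 c l s : 0 <= l -> 0 <= sheet c l s.
Proof.
move=> l0; have [s12|s12] := leP (1 / 2) s; first by rewrite sheet_outer// ppow_ge0.
by rewrite (sheet_lens k0 ep0)// ?(ltW s12)// mulr_ge0 ?ppow_ge0.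
Qed.

Let ppow_lt_root w z : 0 < z -> (ppow k w < z) = (w < ppow k^-1 z).
Proof.
move=> z0; have zE : ppow k (ppow k^-1 z) = z.
  by rewrite ppow_comp mulVf ?gt_eqF// ppow_ge0E ?(ltW z0)// powRr1// ltW.
have [w0|w0] := leP w 0.
  rewrite ppow_le0 ?gt_eqF// z0; apply/esym; apply: (le_lt_trans w0).
  by rewrite ppow_ge0E ?(ltW z0)// powR_gt0.
apply/idP/idP => h; rewrite ltNge; apply/negP => h'.
  by have := ppow_mono (ltW k0) h'; rewrite zE leNgt h.
have ki : 0 <= k^-1 by rewrite invr_ge0 ltW.
have := ppow_mono ki h'; rewrite ppow_comp mulfV ?gt_eqF// (ppow_ge0E _ (ltW w0)).
by rewrite powRr1 ?(ltW w0)// leNgt h.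
Qed.

(** At a fixed point the levels whose sheet lies below form an interval ending at [T]; each case
    only computes its left end, which is [T] itself when z <= 0. *)
Lemma layeredE c x : 0 <= c <= T -> layered T (sheet_graph c) x = layer_value c x.
Proof.
move=> /andP[c0 cT]; rewrite /layer_value /layered; set z := x ord0 ord0; set s := sqn (tl x).
pose h l := hv (z - sheet_graph c (rV_cons (l, tl x))).
have mh : measurable_fun setT h.
  apply: measurableT_comp; first exact: measurable_hv.
  apply: measurable_funB => //; apply: measurableT_comp; first exact: measurable_sheet_graph.
  apply: measurable_fun_rV => i; case: (unliftP ord0 i) => [j ->|->].
    by under eq_fun do rewrite rV_consES; exact: measurable_cst.
  by under eq_fun do rewrite rV_consE0; exact: measurable_id.
have h01 l : h l = 0 \/ h l = 1 by rewrite /h /hv; case: ifP; [right|left].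
have hE l : h l = hv (z - sheet c l s) by rewrite /h /sheet_graph rV_consE0 tl_cons.
have hv1 (t : R) : 0 < t -> hv t = 1 by rewrite /hv => ->.
have hv0 (t : R) : t <= 0 -> hv t = 0 by rewrite /hv ltNge => ->.
have [z0|z0] := leP z 0.
  rewrite (hv0 z z0) mul0r (@Rintegral_level_interval _ T T h) ?subrr ?(ltW T0)//=.
  - by move=> l /andP[_ lT] /(le_lt_trans lT); rewrite ltxx.
  - move=> l /andP[l0 _] _; rewrite hE hv0// subr_le0 (le_trans z0)//.
    exact: sheet_ge0.
rewrite (hv1 z z0) mul1r.
have [s12|s12] := leP (1 / 2) s.
  rewrite (hv0 (1 / 2 - s)) ?subr_le0// subr0 mul1r mul0r addr0.
  have key l : h l = hv (l - (ep * (s - 1 / 2) - ppow k^-1 z)).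
    rewrite hE sheet_outer// /hv !subr_gt0.
    suff -> : (ppow k (ep * (s - 1 / 2) - l) < z) = (ep * (s - 1 / 2) - ppow k^-1 z < l) by [].
    rewrite ltrBlDr -ltrBlDl; exact: ppow_lt_root.
  set b := ep * (s - 1 / 2) - ppow k^-1 z in key *.
  rewrite (@Rintegral_level_interval _ T (clamp b) h) ?clamp_bounds//=.
  - move=> l /andP[l0 lT]; rewrite key /clamp => h'; rewrite hv1// subr_gt0.
    move: h'; rewrite gt_min gt_max => /orP[/andP[]//|/(lt_le_trans)/(_ lT)].
    by rewrite ltxx.
  - move=> l /andP[l0 lT]; rewrite key /clamp => h'; rewrite hv0// subr_le0.
    move: h'; rewrite lt_min lt_max => /andP[/orP[/ltW//|]].
    by rewrite ltNge l0.
have hs : 0 < 1 / 2 - s by rewrite subr_gt0.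
rewrite (hv1 _ hs) subrr mul0r mul1r add0r.
have hE' l : 0 <= l -> h l = hv (z - (l < c)%R%:R * ppow k (Gprof ep s)).
  by move=> l0; rewrite hE (sheet_lens k0 ep0)// ltW.
have [zG|zG] := ltP (ppow k (Gprof ep s)) z.
  rewrite (hv1 (z - _)) ?subr_gt0// subrr mulr0 subr0.
  rewrite (@Rintegral_level_interval _ T 0 h) ?subr0 ?lexx ?(ltW T0)//=.
  - move=> l /andP[l0 _] _; rewrite hE'// hv1// subr_gt0.
    by case: (l < c); rewrite ?mul1r ?mul0r.
  - by move=> l /andP[l0 _]; rewrite ltNge l0.
rewrite (hv0 (z - _)) ?subr_le0// subr0 mulr1.
rewrite (@Rintegral_level_interval _ T c h) ?c0//=.
- move=> l /andP[l0 _] cl; rewrite hE'// hv1// subr_gt0.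
  by rewrite (le_gtF (ltW cl)) mul0r.
- move=> l /andP[l0 _] lc; rewrite hE'// hv0// subr_le0.
  by rewrite lc mul1r.
Qed.

Lemma measurable_layer_value c : measurable_fun setT (layer_value c).
Proof.
have mhz : measurable_fun setT (fun x : 'rV[R]_m.+1 => hv (x ord0 ord0)).
  by apply: measurableT_comp; [exact: measurable_hv|exact: measurable_rV_coord].
have mhs : measurable_fun setT (fun x : 'rV[R]_m.+1 => hv (1 / 2 - sqn (tl x))).
  by apply: measurableT_comp; [exact: measurable_hv|exact: continuous_measurable_rV].
have mhG : measurable_fun setT (fun x : 'rV[R]_m.+1 => hv (x ord0 ord0 - ppow k (Gprof ep (sqn (tl x))))).
  apply: measurableT_comp; first exact: measurable_hv.
  by apply: continuous_measurable_rV; apply: contB; [exact: cz|exact: (cpow k0 cG)].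
have mb : measurable_fun setT (fun x : 'rV[R]_m.+1 => ep * (sqn (tl x) - 1 / 2) - ppow k^-1 (x ord0 ord0)).
  apply: continuous_measurable_rV; apply: contB; first exact: cw.
  by apply: cpow; [rewrite invr_gt0|exact: cz].
apply: measurable_funM => //; apply: measurable_funD; apply: measurable_funM => //.
- exact: measurable_funB.
- apply: measurable_funB => //.
  by apply: measurable_minr => //; apply: measurable_maxr.
- by apply: measurable_funB => //; apply: measurable_funM => //; exact: measurable_funB.
Qed.

Lemma layer_value_bounds c x : 0 <= c <= T -> 0 <= layer_value c x <= T.
Proof.
move=> /andP[c0 cT]; rewrite /layer_value.
have /andP[b0 bT] := clamp_bounds (ep * (sqn (tl x) - 1 / 2) - ppow k^-1 (x ord0 ord0)).
move: T0 c0 cT b0 bT; set t := T; set b := clamp _ => t0 c0 ct b0 bt.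
rewrite /hv; case: ifP => _; case: ifP => _; try case: ifP => _;
  apply/andP; split; lra.
Qed.

Lemma layer_value_lens c x : 0 < x ord0 ord0 -> sqn (tl x) < 1 / 2 ->
  x ord0 ord0 < ppow k (Gprof ep (sqn (tl x))) -> layer_value c x = T - c.
Proof.
move=> z0 s12 zG; rewrite /layer_value /hv z0 !subr_gt0 s12 ltNge (ltW zG) /=; ring.
Qed.

(* The last term raises the argument above [T] where [z <= 0], so that the value
   there is [0]. *)
Definition boundary_value x : R :=
  T - clamp (ep * (sqn (tl x) - 1 / 2) - ppow k^-1 (x ord0 ord0) +
    ep * Num.max (- x ord0 ord0) 0).

Lemma continuous_boundary_value : continuous boundary_value.
Proof.
apply: contB; first exact: contC.
have cmax (g : 'rV[R]_m.+1 -> R) b : continuous g -> continuous (fun x => Num.max (g x) b).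
  by move=> cg x; apply: (@continuous_max _ _ g (fun=> b)); [exact: cg|exact: cst_continuous].
have cmin (g : 'rV[R]_m.+1 -> R) b : continuous g -> continuous (fun x => Num.min (g x) b).
  by move=> cg x; apply: (@continuous_min _ _ g (fun=> b)); [exact: cg|exact: cst_continuous].
apply: (cmin (fun x => _)); apply: (cmax (fun x => _)); apply: contD.
  apply: contB; first exact: cw.
  by apply: cpow; [rewrite invr_gt0|exact: cz].
apply: contM; first exact: contC.
by apply: (cmax (fun x => _)); apply: contN; exact: cz.
Qed.

(** This shell misses the lens: over s < 1/2 a point with z > 0 has height above 1/2, whereas the
    lens is at most (1/2)^k high. Hence [c] disappears from the formula. *)
Lemma layer_value_near_boundary c x : sqn x < 1 -> 3 / 4 < sqn x ->
  layer_value c x = boundary_value x.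
Proof.
rewrite sqn_tl /layer_value /boundary_value; set z := x ord0 ord0; set s := sqn (tl x) => x1 x34.
have s0 : 0 <= s by exact: sqn_ge0.
have [z0|z0] := leP z 0.
  rewrite /hv ltNge z0 mul0r ppow_le0 ?invr_neq0 ?gt_eqF// subr0.
  rewrite (max_idPl _) ?oppr_ge0//.
  rewrite (_ : clamp _ = T) ?subrr// /clamp; apply: min_r; rewrite le_max; apply/orP; left.
  (* As |z| < 1, the term - z dominates z^2, so the argument of [clamp] exceeds ep (|x|^2 - 1/2),
     hence [T]. *)
  have z1 : z ^+ 2 <= - z by rewrite expr2; nra.
  have : 1 / 4 <= s - 1 / 2 + - z by lra.
  by rewrite -(ler_pM2l ep0) mulrDr; lra.
have mz : Num.max (- z) 0 = 0 by rewrite max_r// oppr_le0 ltW.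
rewrite mz mulr0 addr0 {1}/hv z0 mul1r.
have [s12|s12] := leP (1 / 2) s.
  by rewrite /hv subr_gt0 ltNge s12 subr0 mul1r mul0r addr0.
have z12 : 1 / 2 < z by rewrite ltNge; apply/negP => h; nra.
have Gz : ppow k (Gprof ep s) < z.
  apply: le_lt_trans z12; apply: (@le_trans _ _ (ppow k (1 / 2))).
    apply: ppow_mono; first exact: ltW.
    apply: (le_trans (Gprof_le ep0 _)); first by apply/andP; split; lra.
    by move: ep1; lra.
  rewrite ppow_ge0E ?divr_ge0// -[leRHS]powRr1 ?divr_ge0//.
  apply: ger_powR; last exact: ltW.
  by apply/andP; split; lra.
rewrite /hv !subr_gt0 s12 Gz subrr mul0r add0r mulr0 subr0 mul1r.
rewrite (_ : clamp _ = 0) ?subr0// /clamp max_r ?min_l ?(ltW T0)//.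
have := ppow_ge0 k^-1 z; have : ep * (s - 1 / 2) <= 0 by rewrite pmulr_rle0//; lra.
lra.
Qed.

End sheets.

(** * Traces of functions that coincide with a continuous function near the sphere *)

Section open_positive.
Context {R : realType} {n : nat}.
Local Notation lam := (@lebesgue_rV R n).
Local Notation Omega := (@oball R n).

Lemma ae_open_ex (D : set 'rV[R]_n) (Q : 'rV[R]_n -> Prop) : open D -> D !=set0 ->
  {ae lam, forall z, D z -> Q z} -> exists2 z, D z & Q z.
Proof.
move=> oD [x0 Dx0] [A [mA A0 hA]]; apply: contrapT => nex.
have DA : D `<=` A.
  by move=> z Dz; apply: hA => /= h; apply: nex; exists z => //; exact: h.
have mD : measurable D by exact: open_measurable_rV.
have := open_lebesgue_rV_gt0 oD Dx0; rewrite ltNge => /negP; apply.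
by rewrite -A0; apply: le_measure; rewrite ?inE.
Qed.

(** Upper bounds for the essential supremum come from continuity of [f], since [u] and [f] agree on
    the ball near [x]. *)
Lemma BV_with_trace_near_boundary (f u : 'rV[R]_n -> R) : continuous f ->
  (forall x, sqn x < 1 -> 3 / 4 < sqn x -> u x = f x) -> BV Omega u ->
  BV_with_trace Omega f u.
Proof.
move=> cf uf bvu; split=> // x bx.
have clx : closure Omega x by case: bx.
have sx : sqn x = 1 by move: bx; rewrite boundary_oball.
pose E r := ess_sup_on (Omega `&` [set y | enorm (x - y) < r]) (fun y => `|f x - u y|%:E).
have opn r : open [set y : 'rV[R]_n | enorm (x - y) < r].
  apply: (@open_comp _ _ (fun y : 'rV[R]_n => enorm (x - y)) [set t | t < r]).
    by move=> y _; exact: continuous_enormB.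
  exact: open_lt.
(* An essential supremum over a null set would be [-oo]; nonnegativity holds because the ball meets
   every neighbourhood of a boundary point in a nonempty open set, which has positive measure. *)
have E0 r : 0 < r -> (0 <= E r)%E.
  move=> r0; apply: le_ereal_inf_tmp => y hy; rewrite leNgt; apply/negP => y0.
  have [||z Dz] := ae_open_ex _ _ hy.
  - by apply: openI; [exact: open_oball|exact: opn].
  - apply: clx; apply: open_nbhs_nbhs; split; first exact: opn.
    by rewrite /= subrr enorm0.
  - by move=> /le_lt_trans/(_ y0); rewrite lte_fin ltNge normr_ge0.
have Ee e : 0 < e -> \forall r \near 0^'+, (E r <= e%:E)%E.
  move=> e0.
  have N : nbhs x ([set y | `|f x - f y| <= e] `&` [set y | 3 / 4 < sqn y]).
    apply: filterI.
      by have /(@cvgrPdist_le _ _ _ (nbhs x)) := cf x; apply.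
    apply: open_nbhs_nbhs; split; last by rewrite /= sx; lra.
    by apply: (@open_comp _ _ (@sqn R n) [set t | 3 / 4 < t]);
      [move=> y _; exact: cont_sqn|exact: open_gt].
  have [d d0 hd] := nbhs_box N.
  near=> r; apply: ereal_inf_lbound; apply: (filterS (P := setT)); last exact: filterT.
  move=> y _ [Oy yr]; have [h1 h2] : ([set y | `|f x - f y| <= e] `&` [set y | 3 / 4 < sqn y]) y.
    apply: hd => i; have := coord_le_enorm (x - y) i; rewrite !mxE => /le_lt_trans; apply.
    by apply: (lt_trans yr); near: r; exact: nbhs_right_lt.
  by rewrite uf.
apply/fine_cvgP; split.
  near=> r; have r0 : 0 < r by near: r; exact: nbhs_right_gt.
  have r1 : (E r <= 1%:E)%E by near: r; exact: Ee.
  by rewrite ge0_fin_numE ?E0// (le_lt_trans r1)// ltry.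
apply/cvgrPdist_le => e e0; near=> r.
have r0 : 0 < r by near: r; exact: nbhs_right_gt.
have re : (E r <= e%:E)%E by near: r; exact: Ee.
rewrite sub0r normrN ger0_norm ?fine_ge0 ?E0//= -lee_fin fineK//.
by rewrite ge0_fin_numE ?E0// (le_lt_trans re)// ltry.
Unshelve. all: by end_near. Qed.

End open_positive.

(** * Minimality and distinctness of the stacked functions *)

Section layered_minimizers.
Context {R : realType} {m : nat}.
Variables (alpha k p nu ep sg : R).
Hypotheses (m0 : (0 < m)%N) (alpha0 : 0 < alpha) (alpha1 : alpha < 1)
  (pE : p = (1 + alpha) / 2) (kE : k * (1 - alpha) = 2)
  (nu0 : 0 < nu) (nuE : expR nu = 1 + 1 / 300)
  (ep0 : 0 < ep) (ep1 : ep <= 1) (sgE : sg = 2 * m%:R * ep) (cal : nu * (p + 1) = sg * k).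
Local Notation Omega := (@oball R m.+1).
Local Notation lam := (@lebesgue_rV R m.+1).
Local Notation T := (ep / 4).
Local Notation Z := (@Zfield R m k p nu ep sg).
Local Notation a := (@weight R m k p nu ep sg).
Local Notation u := (@layer_value R m k ep).
Local Notation f := (@boundary_value R m k ep).
Local Notation Phi c := (sheet_point (sheet_graph (m := m) k ep c)).
Local Notation W c := (sheet_density T (sheet_slope (m := m) k ep c)).

Let k2 : 2 < k.
Proof.
have h : 0 < 1 - alpha by rewrite subr_gt0.
rewrite -(ltr_pM2r h) kE; move: alpha0 => ?; lra.
Qed.
Let k1 : 1 < k. Proof. by apply: lt_trans k2; rewrite ltr1n. Qed.
Let p0 : 0 < p. Proof. by rewrite pE divr_gt0// addr_gt0. Qed.
Let T0 : 0 < T. Proof. by rewrite divr_gt0. Qed.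
Let T1 : T <= 1. Proof. by move: ep1; lra. Qed.
Let mO : measurable Omega := @measurable_oball R m.+1.

Let mPhi c : measurable_fun setT (Phi c).
Proof. by apply: measurable_sheet_point; exact: measurable_sheet_graph. Qed.

Let bW c i : bms (W c i).
Proof.
apply: bms_sheet_density; first by move=> j; exact: measurable_sheet_slope.
by move=> j; exact: sheet_slope_bounded.
Qed.

Let iW c i : lam.-integrable setT (EFin \o W c i).
Proof. exact: bms_integrable. Qed.

Let iN c : lam.-integrable setT (EFin \o (fun q => enorm (\row_i W c i q))).
Proof.
have mN : measurable_fun setT (fun q => enorm (\row_i W c i q)).
  by apply: measurable_enorm => i; have [] := bW c i.
have iS : lam.-integrable setT (EFin \o (fun q => \sum_i `|W c i q|)).
  have h i : lam.-integrable setT (EFin \o (fun q => `|W c i q|)) by exact: integrable_norm.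
  by have [] := Rintegral_sum measurableT (index_enum 'I_m.+1) h.
apply: (le_integrable measurableT _ _ iS); first exact/measurable_EFinP.
move=> q _; rewrite /= lee_fin ger0_norm ?enorm_ge0// ger0_norm ?sumr_ge0//.
by apply: le_trans (enorm_le_sum _) _; apply: ler_sum => i _; rewrite mxE.
Qed.

Let representation c : 0 <= c <= T -> forall phi, test_function Omega phi -> forall i,
  \int[lam]_(x in Omega) (u c x * partial i phi x) =
  - \int[lam]_q (phi (Phi c q) * W c i q).
Proof.
move=> cT phi tphi i; have [sphi _] := tphi.
have [_ supp1] := test_function_supp tphi.
rewrite Rintegral_oball; last first.
  by move=> x; rewrite mulf_eq0 negb_or => /andP[_]; exact: supp1.
transitivity (\int[lam]_x (layered T (sheet_graph k ep c) x * partial i phi x)).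
  by apply: eq_Rintegral => x _; rewrite layeredE.
apply: (@layered_gradient R m T (sheet_graph k ep c) (sheet_slope k ep c)
  _ _ _ _ _ _ _ phi (fun i => partial i phi)) => //.
- exact: measurable_sheet_graph.
- by move=> j; exact: measurable_sheet_slope.
- by move=> l j x; exact: is_derive_sheet_graph.
- by move=> l; exact: continuous_sheet_graph.
- by move=> l j; exact: continuous_sheet_slope.
- by move=> j; exact: sheet_slope_bounded.
- by move=> j x; exact: smooth_is_derive.
- exact: smooth_continuous sphi.
- by move=> j; exact: smooth_continuous (smooth_partial j sphi).
- exact: test_function_bms.
- by move=> j; exact: test_function_partial_bms.
Qed.

Let integrable_u c : 0 <= c <= T -> lam.-integrable Omega (EFin \o u c).
Proof.
move=> cT; apply: measurable_bounded_integrable => //.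
- exact: lebesgue_oball_lty.
- by apply: measurable_funTS; exact: measurable_layer_value.
- exists T; split; rewrite ?num_real// => M TM x _.
  have /andP[h0 h1] := layer_value_bounds k ep0 x cT.
  have hn : `|u c x| <= T by rewrite ger0_norm.
  exact: le_trans hn (ltW TM).
Qed.

Lemma layer_value_trace c : 0 <= c <= T -> BV_with_trace Omega f (u c).
Proof.
move=> cT; apply: BV_with_trace_near_boundary.
- exact: continuous_boundary_value.
- by move=> x x1 x34; exact: layer_value_near_boundary.
- exact: (represented_BV (mPhi c) (iW c) (integrable_u cT) (representation cT)).
Qed.

(** At a point of a sheet Z is a nonnegative multiple of the density, so Cauchy-Schwarz is an
    equality; off the level domain both sides are [0]. *)
Let calibrated c q : Omega (Phi c q) ->
  a (Phi c q) * enorm (\row_i W c i q) = \sum_i Z i (Phi c q) * W c i q.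
Proof.
move=> Oq; rewrite /sheet_density indicE.
have [|_] := boolP (q \in level_domain T); last first.
  rewrite big1; last by move=> i _; rewrite mul0r mulr0.
  rewrite (@enorm_row_ext _ _ _ (fun=> 0)) => [|i]; last by rewrite mul0r.
  rewrite (_ : \row_i 0 = 0) ?enorm0 ?mulr0//.
  by apply/rowP => i; rewrite !mxE.
rewrite inE => -[_ /andP[l0 _]].
set x := Phi c q; set N := sheet_normal (sheet_slope k ep c).
have ZN i : Z i x = Z ord0 x * N i q.
  rewrite /N /sheet_normal; case: (unliftP ord0 i) => [j ->|->]; last by rewrite mulr1.
  exact: (Zfield_sheet m0 alpha0 alpha1 pE kE ep0 sgE cal j l0 (ltW Oq)).
have Z0 : 0 <= Z ord0 x.
  apply: le_trans (Zfield0_ge m0 alpha0 alpha1 pE kE nu0 nuE ep0 ep1 sgE (ltW Oq)).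
  by rewrite divr_ge0.
have -> : a x = Z ord0 x * enorm (\row_i N i q).
  rewrite /weight (@enorm_row_ext _ _ _ _ ZN) /enorm.
  under eq_bigr do rewrite mxE exprMn.
  rewrite -mulr_sumr sqrtrM ?sqr_ge0// sqrtr_sqr ger0_norm//.
  by congr (_ * Num.sqrt _); apply: eq_bigr => i _; rewrite mxE.
rewrite (_ : \row_i (true%:R * N i q) = \row_i N i q); last first.
  by apply/rowP => i; rewrite !mxE mul1r.
rewrite -mulrA -expr2 sqr_enorm mulr_sumr; apply: eq_bigr => i _.
by rewrite mxE (ZN i) mul1r expr2 mulrA.
Qed.

(** Positivity of [e] stands under the existential so that a whole sequence of fields can be chosen
    at once; for [e <= 0] the witness is a dummy. *)
Let V_exists e : exists V : 'I_m.+1 -> 'rV[R]_m.+1 -> R, 0 < e ->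
  [/\ forall i, smooth (V i), forall x, \sum_i partial i (V i) x = 0 &
    forall i x, sqn x <= 1 -> `|V i x - Z i x| <= e].
Proof.
have [e0|e0] := ltP 0 e; last by exists Z.
have [d d0 hd] := @Zdamped_uniform R m k p nu ep sg k1 p0 e e0.
exists (Zdamped k p nu ep sg d) => _; split => //.
- by move=> i; exact: smooth_Zdamped.
- by move=> x; exact: divergence_Zdamped.
Qed.

Theorem layer_value_minimizer c : 0 <= c <= T ->
  least_gradient_minimizers Omega a f (u c).
Proof.
move=> cT; split; first exact: layer_value_trace.
have /choice[V hV] : forall j : nat, exists V, _ := fun j => V_exists j.+1%:R^-1.
have V0 (j : nat) : 0 < j.+1%:R^-1 :> R by rewrite invr_gt0.
(* Each of the [m.+1] components is approximated within 1 / (j + 1), and the Euclidean norm is at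
   most the sum of the components in absolute value. *)
pose eps (j : nat) : R := m.+1%:R * j.+1%:R^-1.
have VZ j x : sqn x <= 1 -> enorm (\row_i (V j i x - Z i x)) <= eps j.
  move=> x1; have [_ _ h] := hV j (V0 j).
  apply: le_trans (enorm_le_sum _) _.
  apply: (@le_trans _ _ (\sum_(i < m.+1) j.+1%:R^-1)).
    by apply: ler_sum => i _; rewrite mxE h.
  by rewrite sumr_const card_ord /eps mulr_natl.
have [K hK] := @weight_bounded R m alpha k p nu ep sg alpha0 alpha1 pE kE.
apply: (@calibrated_minimizer R m.+1 _ _ lam (Phi c) (W c) (u c) f a V eps (1 / 2) K).
- exact: mPhi.
- exact: iW.
- exact: iN.
- exact: representation.
- exact: (measurable_weight nu ep sg alpha0 alpha1 pE kE).
- by rewrite divr_gt0.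
- move=> x /ltW x1; rewrite hK// andbT.
  exact: (weight_ge m0 alpha0 alpha1 pE kE nu0 nuE ep0 ep1 sgE x1).
- by move=> j i; have [] := hV j (V0 j).
- by move=> j x; have [] := hV j (V0 j).
- move=> j x /ltW x1.
  rewrite (_ : \row_i V j i x = \row_i Z i x + \row_i (V j i x - Z i x)); last first.
    by apply/rowP => i; rewrite !mxE addrC subrK.
  by rewrite (le_trans (enormD _ _))// lerD2l VZ.
- move=> j q Oq; rewrite calibrated//.
  have -> : \sum_i Z i (Phi c q) * W c i q = \sum_i V j i (Phi c q) * W c i q +
      dot (- \row_i (V j i (Phi c q) - Z i (Phi c q))) (\row_i W c i q).
    rewrite /dot -big_split; apply: eq_bigr => i _.
    by rewrite !mxE /= -mulrDl opprB addrC subrK.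
  rewrite lerD2l; apply: le_trans (dot_le_enorm _ _) _; rewrite enormN.
  by rewrite ler_wpM2r ?enorm_ge0// VZ// ltW.
- by move=> j; rewrite mulr_ge0// invr_ge0.
- rewrite -[X in _ --> X](mulr0 m.+1%:R); apply: cvgM; first exact: cvg_cst.
  exact: cvg_harmonic.
- exact: layer_value_trace.
Qed.

(** Inside the lens the value is T - c, and the interior [D] of the lens is a nonempty open set, so
    almost-everywhere equality can be evaluated at one of its points. *)
Lemma layer_value_class_inj c1 c2 : ae_class Omega (u c1) = ae_class Omega (u c2) -> c1 = c2.
Proof.
move=> h; have : ae_class Omega (u c2) (u c1).
  by rewrite -h; apply: ae_eq_refl.
move=> h12.
pose D := Omega `&` ([set x : 'rV[R]_m.+1 | 0 < x ord0 ord0] `&` ([set x : 'rV[R]_m.+1 | sqn (tl x) < 1 / 2] `&`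
  [set x : 'rV[R]_m.+1 | 0 < ppow k (Gprof ep (sqn (tl x))) - x ord0 ord0])).
have cs : continuous (fun x : 'rV[R]_m.+1 => sqn (tl x)).
  exact: (smooth_continuous smooth_sqn_tl).
have cz : continuous (fun x : 'rV[R]_m.+1 => x ord0 ord0) by exact: continuous_coord.
have cg : continuous (fun x : 'rV[R]_m.+1 => ppow k (Gprof ep (sqn (tl x))) - x ord0 ord0).
  apply: contB; last exact: cz.
  apply: (cont_comp (F := ppow k)); first by apply: continuous_ppow; apply: lt_trans k2.
  apply: contM; first exact: contC.
  apply: contD; first by apply: contB; [exact: cs|exact: contC].
  apply: contM; first exact: contC.
  apply: (cont_comp (F := ppow 4)); first exact: continuous_ppow.
  by apply: contB; [exact: contC|exact: cs].
have oD : open D.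
  apply: openI; first exact: open_oball.
  apply: openI.
    by apply: (@open_comp _ _ (fun x : 'rV[R]_m.+1 => x ord0 ord0) [set t | 0 < t]);
      [move=> y _; exact: cz|exact: open_gt].
  apply: openI.
    by apply: (@open_comp _ _ (fun x : 'rV[R]_m.+1 => sqn (tl x)) [set t | t < 1 / 2]);
      [move=> y _; exact: cs|exact: open_lt].
  by apply: (@open_comp _ _ (fun x : 'rV[R]_m.+1 => ppow k (Gprof ep (sqn (tl x))) - x ord0 ord0)
      [set t | 0 < t]); [move=> y _; exact: cg|exact: open_gt].
have D0 : D !=set0.
  pose h0 : R := ppow k (Gprof ep 0).
  have G0 : Gprof ep 0 = ep / 2.
    rewrite /Gprof subr0 ppow_ge0E ?divr_ge0// powR_mulrn ?divr_ge0//.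
    by rewrite !exprS expr0; field.
  have h00 : 0 < h0 by rewrite /h0 G0 ppow_ge0E ?powR_gt0 ?divr_gt0// ltW// divr_gt0.
  have h01 : h0 <= 1.
    rewrite -[leRHS](_ : ppow k 1 = 1); last by rewrite ppow_ge0E// powR1.
    by apply: ppow_mono; [exact: ltW (lt_trans _ k2)|rewrite G0; move: ep1; lra].
  (* The point of the axis halfway up the lens, whose height there is positive since [Gprof ep 0] is
     ep/2. *)
  exists (rV_cons (h0 / 2, 0)).
  have s0 : sqn (0 : 'rV[R]_m) = 0 by rewrite /sqn big1// => i _; rewrite mxE expr0n.
  rewrite /D /oball /= sqn_tl rV_consE0 tl_cons s0 /=.
  split; first by rewrite addr0 expr_lt1 ?divr_ge0 ?(ltW h00)//; lra.
  by split; [lra|split; [lra|rewrite -/h0; lra]].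
have [z [_ [z0 [zs zg]]]] := ae_open_ex oD D0 (filterS (fun x (hx : Omega x -> _) (Dx : D x) => hx Dx.1) h12).
have zg' : z ord0 ord0 < ppow k (Gprof ep (sqn (tl z))) by rewrite -subr_gt0.
have E c : u c z = T - c by exact: layer_value_lens.
by rewrite (E c1) (E c2) => /addrI/oppr_inj.
Qed.

End layered_minimizers.

(** * Choice of the parameters and conclusion *)

Lemma ln1D_bounds (R : realType) (r : R) : 0 < r ->
  [/\ 0 < ln (1 + r), ln (1 + r) <= r & expR (ln (1 + r)) = 1 + r].
Proof.
move=> r0; have E : expR (ln (1 + r)) = 1 + r by rewrite lnK// posrE addr_gt0.
split=> //; first by rewrite -ltr_expR expR0 E ltrDl.
by have := expR_ge1Dx (ln (1 + r)); rewrite E lerD2l.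
Qed.

(* [k * (1 - alpha) = 2] gives [k * p = k - 1], so that [Eprof1 (ppow k w)] is a
   multiple of the derivative of [ppow k] at [w]; [nu * (p + 1) = sg * k] adjusts
   the factor. The constant [300] makes the oscillation of [Eprof] small with
   respect to the bound [55] of the multiplier. *)
Lemma parameters_exist (R : realType) (alpha : R) (m : nat) : 0 < alpha -> alpha < 1 ->
  (0 < m)%N -> exists k p nu ep sg : R,
  [/\ p = (1 + alpha) / 2, k * (1 - alpha) = 2, 0 < nu & expR nu = 1 + 1 / 300] /\
  [/\ 0 < ep, ep <= 1, sg = 2 * m%:R * ep & nu * (p + 1) = sg * k].
Proof.
move=> alpha0 alpha1 m0.
have a0 : 0 < 1 - alpha by rewrite subr_gt0.
have [k kE] : exists k, k * (1 - alpha) = 2.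
  by exists (2 / (1 - alpha)); rewrite divfK// gt_eqF.
have k2 : 2 < k by rewrite -(ltr_pM2r a0) kE; lra.
have k0 : 0 < k by exact: lt_trans k2.
have r0 : 0 < 1 / 300 :> R by rewrite divr_gt0// ltr0n.
have [nu [nu0 nu1 nuE]] : exists nu : R, [/\ 0 < nu, nu <= 1 / 300 & expR nu = 1 + 1 / 300].
  by exists (ln (1 + 1 / 300)); exact: ln1D_bounds.
have [p pE] : exists p, p = (1 + alpha) / 2 by eexists.
have m1 : 1 <= m%:R :> R by rewrite ler1n.
have M0 : 0 < 2 * m%:R * k.
  apply: mulr_gt0; last exact: k0.
  by rewrite pmulr_rgt0 ?ltr0n.
(* This [ep] solves nu (p + 1) = sg k with sg = 2 m ep, the normalization that makes the multiplier
   1 for 1/2 <= s. *)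
exists k, p, nu, (nu * (p + 1) / (2 * m%:R * k)).
exists (2 * m%:R * (nu * (p + 1) / (2 * m%:R * k))); split; split=> //.
- by rewrite divr_gt0// mulr_gt0// pE; lra.
- rewrite ler_pdivrMr// mul1r.
  apply: (@le_trans _ _ (1 / 300 * 2)).
    by apply: ler_pM; rewrite ?(ltW nu0)// pE; lra.
  apply: (@le_trans _ _ (2 * 1 * 2)); first by lra.
  by apply: ler_pM => //; [rewrite ler_pM2l|exact: ltW].
- by rewrite [RHS]mulrAC [RHS]mulrC divfK// gt_eqF.
Qed.

Theorem proposition1p1 (R : realType) (n : nat) (n_ge2 : (2 <= n)%N)
    (alpha : R) (alpha_gt0 : 0 < alpha) (alpha_lt1 : alpha < 1) :
  exists (Omega : set 'rV[R]_n) (f a : 'rV[R]_n -> R),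
    (smooth_domain Omega /\ bounded_set Omega /\ connected (boundary Omega)) /\
    {within boundary Omega, continuous f} /\
    C1_hoelder alpha Omega a /\
    0 < inf [set a x | x in Omega] /\
    infinite_set [set ae_class Omega u
                 | u in least_gradient_minimizers Omega a f].
Proof.
case: n n_ge2 => [//|[//|m]] _.
have [k [p [nu [ep [sg [[pE kE nu0 nuE] [ep0 ep1 sgE cal]]]]]]] :=
  parameters_exist alpha_gt0 alpha_lt1 (ltn0Sn m).
pose a := weight (m := m.+1) k p nu ep sg.
pose f := boundary_value (m := m.+1) k ep.
exists (oball m.+2), f, a; split; [|split; [|split; [|split]]].
- split; first exact: smooth_domain_oball.
  split; last exact: connected_sphere.
  by apply: bounded_sqn_le1 => x; exact: ltW.
- have k2 : 2 < k by rewrite -(ltr_pM2r (_ : 0 < 1 - alpha)) ?subr_gt0// kE; lra.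
  by apply: continuous_subspaceT => x; exact: continuous_boundary_value.
- exact: (C1_hoelder_weight (ltn0Sn m) alpha_gt0 alpha_lt1 pE kE nu0 nuE ep0 ep1 sgE).
- apply: (@lt_le_trans _ _ (1 / 2)); first by rewrite divr_gt0.
  apply: lb_le_inf.
    exists (a 0); exists 0 => //.
    by rewrite /oball /= /sqn big1// => i _; rewrite mxE expr0n.
  move=> _ [x Ox <-].
  exact: (weight_ge (ltn0Sn m) alpha_gt0 alpha_lt1 pE kE nu0 nuE ep0 ep1 sgE (ltW Ox)).
(* Distinct levels in ]0, ep/4]: the classes of their minimizers form an injective sequence, so
   finitely many classes would make the natural numbers finite. *)
pose c (j : nat) : R := ep / 4 / j.+1%:R.
have cT j : 0 <= c j <= ep / 4.
  have T0 : 0 <= ep / 4 by rewrite divr_ge0// ltW.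
  by rewrite divr_ge0//= ler_pdivrMr ?ltr0Sn// ler_peMr// ler1n.
pose F j := ae_class (oball m.+2) (layer_value (m := m.+1) k ep (c j)).
move=> /(@finite_preimage _ _ _ F) fin; apply: infinite_nat.
apply: sub_finite_set (fin _) => [j _|].
  exists (layer_value (m := m.+1) k ep (c j)); last by [].
  exact: (layer_value_minimizer (ltn0Sn m) alpha_gt0 alpha_lt1 pE kE nu0 nuE
    ep0 ep1 sgE cal (cT j)).
move=> i j _ _ ij.
have : c i = c j by exact: (layer_value_class_inj alpha_gt0 alpha_lt1 kE ep0 ep1 ij).
have e4 : ep / 4 != 0 by rewrite mulf_neq0 ?invr_neq0// gt_eqF.
by move=> /(mulfI e4)/invr_inj/eqP; rewrite eqr_nat => /eqP[].
Qed.
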